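(* Let $n>2$, let $M_t$, $t\in[0,\tfrac{\pi}{d}]$, be an isoparametric foliation on $(S^{n-1}(1),g^{\mathrm{st}})\subset\mathbb{R}^n$ with $d$ principal curvatures, let $F$ be a Minkowski norm on $\mathbb{R}^n$ induced by $M_t$, let $g$ be its Hessian metric and $S_F=\{x\in\mathbb{R}^n\,|\,F(x)=1\}$ its indicatrix. Then the foliation $N_t=S_F\cap\mathbb{R}_{>0}M_t$, $t\in[0,\tfrac{\pi}{d}]$, on the Riemannian manifold $(S_F,g|_{S_F})$ is isoparametric, i.e. the $N_t$ are exactly the non-empty level sets of an isoparametric function on $(S_F,g|_{S_F})$.
   Context: An isoparametric function on a Riemannian manifold $(M,g)$ is a smooth $p:M\to\mathbb{R}$, regular almost everywhere, with $g(\mathrm{grad}\,p,\mathrm{grad}\,p)=a\circ p$ and $\Delta p=b\circ p$ for some one-variable functions $a,b$; the family of its non-empty level sets is called an isoparametric foliation. $g^{\mathrm{st}}$ is the standard flat metric of $\mathbb{R}^n$ (also its restriction to submanifolds). An isoparametric foliation on $(S^{n-1}(1),g^{\mathrm{st}})$ with $d\in\{1,2,3,4,6\}$ principal curvatures is given by the level sets of an isoparametric function $p:S^{n-1}(1)\to[-1,1]$ which is the restriction of a homogeneous polynomial of degree $d$ on $\mathbb{R}^n$ and has $\pm1$ as its only critical values; each $p^{-1}(s)$, $-1<s<1$, is a closed connected hypersurface with exactly $d$ distinct principal curvatures, and $p^{-1}(\pm1)$ are the two focal submanifolds. It is parametrized as $M_t$, $t\in[0,\tfrac{\pi}d]$,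 so that $\mathrm{dist}_{S^{n-1}(1)}(x,M_0)=t$ for all $x\in M_t$, where $M_0$ and $M_{\pi/d}$ are the focal submanifolds. A Minkowski norm on $\mathbb{R}^n$ is a continuous function $F:\mathbb{R}^n\to\mathbb{R}_{\ge0}$ which is positive and smooth on $\mathbb{R}^n\setminus\{0\}$, satisfies $F(\lambda x)=\lambda F(x)$ for all $\lambda\ge0$, and for which the Hessian matrix of $E=\tfrac12F^2$ is positive definite at every $x\neq0$. Its Hessian metric is the Riemannian metric $g=\mathrm{d}^2E$ on $\mathbb{R}^n\setminus\{0\}$ given by this Hessian matrix in linear coordinates. $F$ is induced by $M_t$ if it is constant on each $M_t$. *)

(* Defs.v *)
(* Vectors of R^n are row vectors 'rV[R]_n. *)
From HB Require Import structures.
From mathcomp Require Import all_boot all_order all_algebra.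
From mathcomp Require Import all_classical all_reals all_analysis.
(* The notations of mpoly clash with those of MathComp-Analysis: mpoly n R is
   the type {mpoly R[n]} and P \is ishomog1 d mdeg means that P is homogeneous
   of degree d. *)
From mathcomp Require Import -(notations) mpoly.

Set Implicit Arguments.
Unset Strict Implicit.
Unset Printing Implicit Defensive.

Import Order.TTheory GRing.Theory Num.Theory.
Import numFieldNormedType.Exports.

Local Open Scope classical_set_scope.
Local Open Scope ring_scope.

(** * Smooth maps and Euclidean notions *)

Definition partial (R : realType) (m : nat) (V : normedModType R)
    (i : 'I_m) (f : 'rV[R]_m -> V) : 'rV[R]_m -> V :=
  fun x => 'D_(delta_mx 0 i) f x.

(* C^infinity on an open set U: every iterated partial derivative is (Frechet)
   differentiable, hence in particular continuous, at every point of U.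
   The values of f outside U are irrelevant. *)
Definition smooth_on (R : realType) (m : nat) (V : normedModType R)
    (U : set 'rV[R]_m) (f : 'rV[R]_m -> V) : Prop :=
  forall (s : seq 'I_m) (x : 'rV[R]_m), U x ->
    differentiable (foldr (@partial R m V) f s) x.

Definition dot (R : realType) (n : nat) (x y : 'rV[R]_n) : R :=
  (x *m y^T) 0 0.

Definition posdefmx (R : realType) (n : nat) (A : 'M[R]_n) : Prop :=
  A^T = A /\ forall v : 'rV[R]_n, v != 0 -> 0 < (v *m A *m v^T) 0 0.

Definition hessian (R : realType) (n : nat) (E : 'rV[R]_n -> R)
    (x : 'rV[R]_n) : 'M[R]_n :=
  \matrix_(i, j) partial i (partial j E) x.

(* Lebesgue null sets of R^m: for every e > 0 there is a countable cover by
   boxes of total volume at most e. *)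
Definition lebesgue_null (R : realType) (m : nat) (A : set 'rV[R]_m) : Prop :=
  forall e : R, 0 < e -> exists l r : nat -> 'rV[R]_m,
    [/\ forall k i, l k 0 i <= r k 0 i,
        A `<=` \bigcup_k [set x | forall i, l k 0 i <= x 0 i <= r k 0 i] &
        (\sum_(0 <= k <oo) (\prod_(i < m) (r k 0 i - l k 0 i))%:E <= e%:E)%E].

(** * Riemannian submanifolds of R^n

   A metric is given by a matrix field g on (a neighbourhood of S in) R^n,
   a tangent vector of S being a vector of R^n; only the restriction of g to
   the tangent spaces of S matters. *)

(* Local parametrization of S by an open subset U of R^m: a smooth immersion
   that is a homeomorphism of U onto an open subset of S.  The rows of the
   Jacobian 'J phi u are the coordinate vectors at phi u. *)
Record local_param (R : realType) (m n : nat) (S : set 'rV[R]_n)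
    (U : set 'rV[R]_m) (phi : 'rV[R]_m -> 'rV[R]_n) : Prop := LocalParam {
  lp_open : open U;
  lp_smooth : smooth_on U phi;
  lp_sub : phi @` U `<=` S;
  lp_immersion : forall u, U u -> row_free ('J phi u);
  lp_inj : forall u v, U u -> U v -> phi u = phi v -> u = v;
  lp_open_map : forall V, open V -> V `<=` U ->
    exists2 W : set 'rV[R]_n, open W & phi @` V = S `&` W
}.

Definition submanifold (R : realType) (m n : nat) (S : set 'rV[R]_n) : Prop :=
  forall x, S x -> exists (U : set 'rV[R]_m) (phi : 'rV[R]_m -> 'rV[R]_n),
    local_param S U phi /\ (phi @` U) x.

(* The matrix (g_ij) of the induced metric in local coordinates. *)
Definition gram (R : realType) (m n : nat) (g : 'rV[R]_n -> 'M[R]_n)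
    (phi : 'rV[R]_m -> 'rV[R]_n) (u : 'rV[R]_m) : 'M[R]_m :=
  'J phi u *m g (phi u) *m ('J phi u)^T.

Definition riemannian_submanifold (R : realType) (m n : nat)
    (S : set 'rV[R]_n) (g : 'rV[R]_n -> 'M[R]_n) : Prop :=
  submanifold m S /\
  forall (U : set 'rV[R]_m) (phi : 'rV[R]_m -> 'rV[R]_n),
    local_param S U phi ->
    smooth_on U (gram g phi) /\ forall u, U u -> posdefmx (gram g phi u).

Definition differential (R : realType) (m n : nat) (phi : 'rV[R]_m -> 'rV[R]_n)
    (f : 'rV[R]_n -> R) (u : 'rV[R]_m) : 'rV[R]_m :=
  \row_i partial i (f \o phi) u.

(* grad^i = sum_j g^ij d_j f *)
Definition grad (R : realType) (m n : nat) (g : 'rV[R]_n -> 'M[R]_n)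
    (phi : 'rV[R]_m -> 'rV[R]_n) (f : 'rV[R]_n -> R) (u : 'rV[R]_m) :
    'rV[R]_m :=
  differential phi f u *m invmx (gram g phi u).

Definition grad_sqnorm (R : realType) (m n : nat) (g : 'rV[R]_n -> 'M[R]_n)
    (phi : 'rV[R]_m -> 'rV[R]_n) (f : 'rV[R]_n -> R) (u : 'rV[R]_m) : R :=
  (grad g phi f u *m gram g phi u *m (grad g phi f u)^T) 0 0.

(* The Laplace-Beltrami operator in local coordinates:
   (1 / sqrt (det g)) sum_i d_i (sqrt (det g) grad^i). *)
Definition laplacian (R : realType) (m n : nat) (g : 'rV[R]_n -> 'M[R]_n)
    (phi : 'rV[R]_m -> 'rV[R]_n) (f : 'rV[R]_n -> R) (u : 'rV[R]_m) : R :=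
  (Num.sqrt (\det (gram g phi u)))^-1 *
  \sum_(i < m) partial i
    (fun v => Num.sqrt (\det (gram g phi v)) * grad g phi f v 0 i) u.

Definition critical_points (R : realType) (m n : nat) (S : set 'rV[R]_n)
    (f : 'rV[R]_n -> R) : set 'rV[R]_n :=
  [set x | exists (U : set 'rV[R]_m) (phi : 'rV[R]_m -> 'rV[R]_n) u,
     [/\ local_param S U phi, U u, phi u = x & differential phi f u = 0]].

Record isoparametric_function (R : realType) (m n : nat) (S : set 'rV[R]_n)
    (g : 'rV[R]_n -> 'M[R]_n) (f : 'rV[R]_n -> R) : Prop :=
  IsoparametricFunction {
  iso_riemannian : riemannian_submanifold m S g;
  iso_smooth : forall (U : set 'rV[R]_m) phi,
    local_param S U phi -> smooth_on U (f \o phi);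
  iso_regular_ae : forall (U : set 'rV[R]_m) phi, local_param S U phi ->
    lebesgue_null (U `&` phi @^-1` critical_points m S f);
  iso_eqs : exists a b : R -> R,
    forall (U : set 'rV[R]_m) phi, local_param S U phi -> forall u, U u ->
      grad_sqnorm g phi f u = a (f (phi u)) /\
      laplacian g phi f u = b (f (phi u))
}.

Definition level_set (R : realType) (n : nat) (S : set 'rV[R]_n)
    (f : 'rV[R]_n -> R) (c : R) : set 'rV[R]_n :=
  [set x | S x /\ f x = c].

Definition level_sets (R : realType) (n : nat) (S : set 'rV[R]_n)
    (f : 'rV[R]_n -> R) : set (set 'rV[R]_n) :=
  [set L | L !=set0 /\ exists c, L = level_set S f c].

Definition isoparametric_foliation (R : realType) (m n : nat)
    (S : set 'rV[R]_n) (g : 'rV[R]_n -> 'M[R]_n) (L : set (set 'rV[R]_n)) :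
    Prop :=
  exists2 f : 'rV[R]_n -> R,
    isoparametric_function m S g f & L = level_sets S f.

(* Riemannian distance in (S, g) from x to A: infimum of the lengths of the
   C^1 curves [0, 1] -> S from x to a point of A.  Such a curve is given with
   a C^1 extension to R with values in R^n, which always exists. *)
Definition riem_dist (R : realType) (n : nat) (S : set 'rV[R]_n)
    (g : 'rV[R]_n -> 'M[R]_n) (x : 'rV[R]_n) (A : set 'rV[R]_n) : R :=
  inf [set \int[lebesgue_measure]_(t in `[0, 1]%classic)
             Num.sqrt ((derive1 gamma t *m g (gamma t) *m (derive1 gamma t)^T) 0 0) |
       gamma in [set c : R -> 'rV[R]_n |
         [/\ (forall t, derivable c t 1) /\ continuous (derive1 c),
             forall t, 0 <= t <= 1 -> S (c t), c 0 = x & A (c 1)]]].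

(** * The unit sphere and its isoparametric foliations *)

Definition flat_metric (R : realType) (n : nat) : 'rV[R]_n -> 'M[R]_n :=
  fun=> 1%:M.

Definition sphere (R : realType) (n : nat) : set 'rV[R]_n :=
  [set x | dot x x = 1].

(* nu is a smooth unit normal field, in the sphere, along the hypersurface of
   the sphere parametrized by phi. *)
Definition sphere_unit_normal (R : realType) (m n : nat) (U : set 'rV[R]_m)
    (phi nu : 'rV[R]_m -> 'rV[R]_n) : Prop :=
  smooth_on U nu /\
  forall u, U u -> [/\ dot (nu u) (nu u) = 1, dot (nu u) (phi u) = 0 &
                       'J phi u *m (nu u)^T = 0].

(* Eigenvalues of the shape operator X |-> - D_X nu.  The derivative of nu in
   R^n is also its covariant derivative in the sphere, because it is
   orthogonal to the position vector phi. *)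
Definition principal_curvatures (R : realType) (m n : nat)
    (phi nu : 'rV[R]_m -> 'rV[R]_n) (u : 'rV[R]_m) : set R :=
  [set k | exists2 w : 'rV[R]_m, w != 0 &
     - (w *m 'J nu u) = k *: (w *m 'J phi u)].

(* M t, for 0 <= t <= pi / d, is an isoparametric foliation on the unit sphere
   of R^n with d principal curvatures, t being the distance to the focal
   submanifold M 0; p is the defining isoparametric function. *)
Record sphere_foliation_by (R : realType) (n d : nat)
    (M : R -> set 'rV[R]_n) (p : 'rV[R]_n -> R) : Prop := SphereFoliationBy {
  sf_degree : d \in [:: 1; 2; 3; 4; 6]%N;
  sf_isoparametric :
    isoparametric_function n.-1 (@sphere R n) (@flat_metric R n) p;
  sf_polynomial : exists2 P : mpoly n R,
    P \is ishomog1 d mdeg &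
    forall x, @sphere R n x -> p x = meval (fun i => x 0 i) P;
  sf_range : forall x, @sphere R n x -> -1 <= p x <= 1;
  sf_critical_values :
    p @` critical_points n.-1 (@sphere R n) p = [set -1; 1];
  sf_hypersurface : forall s, -1 < s < 1 ->
    [/\ compact (level_set (@sphere R n) p s),
        connected (level_set (@sphere R n) p s),
        submanifold n.-2 (level_set (@sphere R n) p s) &
        forall (U : set 'rV[R]_(n.-2)) phi nu,
          local_param (level_set (@sphere R n) p s) U phi ->
          sphere_unit_normal U phi nu ->
          forall u, U u -> (principal_curvatures phi nu u #= `I_d)%card];
  sf_leaves :
    [set M t | t in [set t | 0 <= t <= pi / d%:R]] = level_sets (@sphere R n) p;
  sf_focal : [set M 0; M (pi / d%:R)] =
    [set level_set (@sphere R n) p 1; level_set (@sphere R n) p (-1)];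
  sf_dist : forall t x, 0 <= t <= pi / d%:R -> M t x ->
    riem_dist (@sphere R n) (@flat_metric R n) x (M 0) = t
}.

Definition sphere_isoparametric_foliation (R : realType) (n d : nat)
    (M : R -> set 'rV[R]_n) : Prop :=
  exists p : 'rV[R]_n -> R, sphere_foliation_by d M p.

(** * Minkowski norms *)

Definition energy (R : realType) (n : nat) (F : 'rV[R]_n -> R) :
    'rV[R]_n -> R :=
  fun x => F x ^+ 2 / 2.

(* Only its values at x != 0 are meaningful. *)
Definition hessian_metric (R : realType) (n : nat) (F : 'rV[R]_n -> R) :
    'rV[R]_n -> 'M[R]_n :=
  hessian (energy F).

Record minkowski_norm (R : realType) (n : nat) (F : 'rV[R]_n -> R) : Prop :=
  MinkowskiNorm {
  mn_continuous : continuous F;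
  mn_ge0 : forall x, 0 <= F x;
  mn_gt0 : forall x, x != 0 -> 0 < F x;
  mn_smooth : smooth_on [set x | x != 0] F;
  mn_homog : forall (l : R) x, 0 <= l -> F (l *: x) = l * F x;
  mn_convex : forall x, x != 0 -> posdefmx (hessian_metric F x)
}.

Definition indicatrix (R : realType) (n : nat) (F : 'rV[R]_n -> R) :
    set 'rV[R]_n :=
  [set x | F x = 1].

Definition induced_by (R : realType) (n d : nat) (M : R -> set 'rV[R]_n)
    (F : 'rV[R]_n -> R) : Prop :=
  forall t, 0 <= t <= pi / d%:R -> forall x y, M t x -> M t y -> F x = F y.

Definition positive_cone (R : realType) (n : nat) (A : set 'rV[R]_n) :
    set 'rV[R]_n :=
  [set x | exists l : R, 0 < l /\ exists2 y, A y & x = l *: y].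

(* Main.v *)
(* Let p be extended to be constant on rays and let E = F^2 / 2, h = d^2 E.  The
   Hessian metric is a cone metric whose section is the indicatrix, so that on the
   indicatrix |grad p|^2 and the Laplacian of p are ambient expressions:
   h^-1(dp, dp) and tr (h^-1 (d^2 p - D_X h / 2)) with X = h^-1 dp.  For the
   Euclidean norm this turns the hypothesis on p into the statement that |dp|^2 and
   tr B, for B = d^2 p, are functions of |x| and p.

   Call u invariant if it is a function of |x| and p on the cone -1 < p < 1.  Then du
   is a combination of the position vector x and of dp with invariant coefficients.
   Applied to u = |dp|^2 / 2, this gives that B preserves the plane spanned by x and
   dp, together with a Riccati equation D_(dp) B = - B^2 + d^2 u.  Taking traces, it
   follows by induction that all the tr (B^k) are invariant, which replaces the
   constancy of the principal curvatures.  Hence all the fields in the algebra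
   generated by B, by invariant functions and by tensors in x and dp have invariant
   traces; h and D_X h are such fields, because E is invariant, and so is h^-1 by
   Cayley-Hamilton.  Invariance at the focal values p = 1 and p = -1 follows by
   continuity, since p is nowhere locally constant. *)
Require Import Defs.
From mathcomp Require Import all_boot all_order all_algebra.
From mathcomp Require Import all_classical all_reals all_analysis.
From mathcomp Require Import perm ring lra.
From mathcomp Require Import -(notations) mpoly.
Import Order.TTheory GRing.Theory Num.Theory.
Import numFieldNormedType.Exports.
Local Open Scope classical_set_scope.
Local Open Scope ring_scope.

Set Implicit Arguments.
Unset Strict Implicit.
Unset Printing Implicit Defensive.

(** * Differential calculus and smooth functions on R^n *)

(** A function of |x| and p is never written as such: [invariant] compares its values at two points
    with the same |x| and p, so no regularity of functions of these two quantities has to be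
    established. Two devices make this workable. Derivatives are compared by [derive_along_levels],
    which plays the part of a local change of parameter. The inverse of h is replaced, for two given
    points at a time, by one polynomial in h with constant coefficients, so that it stays in the
    algebra.

    The term D_X h is within reach because X = h^-1 dp lies in the plane of x and dp and D_x h = 0
    by homogeneity. Only the derivative along dp is left, which is the direction controlled by the
    Riccati equation. *)

Section Calculus.
Variable R : realType.

Lemma open_near (T : topologicalType) (U : set T) (x : T) (P : T -> Prop) :
  open U -> U x -> (forall y, U y -> P y) -> \near x, P x.
Proof.
move=> Uo Ux UP; have : nbhs x U by exact: open_nbhs_nbhs.
exact: filterS.
Qed.

(** Both functions have the same first order expansion at x, and [diff_unique] identifies its linear
    part as the differential of g. *)
Lemma differentiable_near (V W : normedModType R) (f g : V -> W) x :
  (\near x, f x = g x) -> differentiable f x -> differentiable g x.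
Proof.
move=> fg df; have fxgx : f x = g x := nbhs_singleton fg.
have fg0 : \forall h \near (0 : V), f (h + x) = g (h + x).
  by move: fg; rewrite (near_shift 0 x) subr0.
have [dc /eqaddoP dfo] := (diff_locallyP x f).1 df.
have dgo : g \o shift x = cst (g x) + 'd f x +o_ 0 id.
  apply/eqaddoP => e e0; have := dfo e e0.
  by apply: filterS2 fg0 => h fgh; rewrite !fctE /= fgh fxgx.
have dfg := diff_unique dc dgo.
by apply/diff_locallyP; rewrite dfg.
Qed.

Section PointwiseRules.
Variable m : nat.
Implicit Types (f g : 'rV[R]_m -> R) (x v : 'rV[R]_m) (i : 'I_m).

Lemma partial_near i f g x :
  (\near x, f x = g x) -> partial i f x = partial i g x.
Proof. exact: near_eq_derive. Qed.

Lemma partial_eq_on (U : set 'rV[R]_m) i f g x : open U -> U x ->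
  (forall y, U y -> f y = g y) -> partial i f x = partial i g x.
Proof. by move=> Uo Ux fg; apply/partial_near/(open_near Uo Ux). Qed.

Lemma derive_sum_partial f x v : differentiable f x ->
  'D_v f x = \sum_i v 0 i * partial i f x.
Proof.
move=> df; rewrite deriveE // {1}(row_sum_delta v) linear_sum /=.
by apply: eq_bigr => i _; rewrite linearZ /= /partial deriveE.
Qed.

Lemma derivable_partial (i : 'I_m) f x : differentiable f x -> derivable f x (delta_mx 0 i).
Proof. exact: diff_derivable. Qed.

Lemma partial_cst i (c : R) x : partial i (fun=> c) x = 0.
Proof. exact: derive_cst. Qed.

Lemma partialD i f g x : differentiable f x -> differentiable g x ->
  partial i (fun y => f y + g y) x = partial i f x + partial i g x.
Proof.
move=> df dg.
by rewrite /partial (deriveD (@derivable_partial i _ _ df) (@derivable_partial i _ _ dg)).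
Qed.

Lemma partialM i f g x : differentiable f x -> differentiable g x ->
  partial i (fun y => f y * g y) x = partial i f x * g x + f x * partial i g x.
Proof.
move=> df dg.
rewrite /partial (deriveM (@derivable_partial i _ _ df) (@derivable_partial i _ _ dg)).
by rewrite addrC /GRing.scale /= [g x * _]mulrC.
Qed.

Lemma partialV i f x : differentiable f x -> f x != 0 ->
  partial i (fun y => (f y)^-1) x = - (partial i f x * (f x)^-1 * (f x)^-1).
Proof.
move=> df f0; rewrite /partial (deriveV f0 (@derivable_partial i _ _ df)).
by rewrite /GRing.scale /= mulNr expr2 invfM mulrC mulrA.
Qed.

Lemma differentiable_sumf (I : Type) (s : seq I) (P : pred I) (F : I -> 'rV[R]_m -> R) x :
  (forall j, differentiable (F j) x) ->
  differentiable (fun y => \sum_(j <- s | P j) F j y) x.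
Proof.
move=> dF; elim: s => [|a s IH].
  by under eq_fun do rewrite big_nil; exact: differentiable_cst.
under eq_fun do rewrite big_cons.
by case: (P a) => //; apply: differentiableD.
Qed.

Lemma partial_sum (I : Type) (s : seq I) (P : pred I) i (F : I -> 'rV[R]_m -> R) x :
  (forall j, differentiable (F j) x) ->
  partial i (fun y => \sum_(j <- s | P j) F j y) x = \sum_(j <- s | P j) partial i (F j) x.
Proof.
move=> dF; elim: s => [|a s IH].
  by rewrite big_nil; under eq_fun do rewrite big_nil; exact: partial_cst.
rewrite big_cons; under [in LHS]eq_fun do rewrite big_cons.
by case: (P a) => //; rewrite partialD ?IH //; exact: differentiable_sumf.
Qed.

Lemma differentiable_coord_rV x (j : 'I_m) : differentiable (fun y : 'rV[R]_m => y 0 j) x.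
Proof. exact: differentiable_coord. Qed.

Lemma partial_coord i (j : 'I_m) x :
  partial i (fun y : 'rV[R]_m => y 0 j) x = (i == j)%:R.
Proof.
have dc : derivable (id : 'rV[R]_m -> 'rV[R]_m) x (delta_mx 0 i) by exact: derivable_id.
have := derive_mx dc; rewrite derive_id => /matrixP /(_ 0 j).
rewrite !mxE /= => h; rewrite /partial; etransitivity; first exact: esym h.
by rewrite eq_sym.
Qed.

Lemma differentiable_mx (p q : nat) (f : 'rV[R]_m -> 'M[R]_(p, q)) x :
  (forall a b, differentiable (fun y => f y a b : R) x) -> differentiable f x.
Proof.
move=> df.
have -> : f = fun y => (\sum_(ab : 'I_p * 'I_q) f y ab.1 ab.2 *: delta_mx ab.1 ab.2).
  by apply/funext => y; rewrite {1}(matrix_sum_delta (f y)) pair_big.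
elim: (index_enum _) => [|ab s IH].
  by under eq_fun do rewrite big_nil; exact: differentiable_cst.
under eq_fun do rewrite big_cons.
by apply: differentiableD => //; apply: differentiableZl.
Qed.

Lemma differentiable_mx_coord (p q : nat) (f : 'rV[R]_m -> 'M[R]_(p, q)) x a b :
  differentiable f x -> differentiable (fun y => f y a b : R) x.
Proof.
move=> df; apply: (@differentiable_comp _ _ _ _ f (fun N : 'M[R]_(p, q) => N a b : R) x df).
exact: differentiable_coord.
Qed.

Lemma partial_mxE (p q : nat) i (f : 'rV[R]_m -> 'M[R]_(p, q)) x a b :
  differentiable f x -> partial i f x a b = partial i (fun y => f y a b : R) x.
Proof.
by move=> df; rewrite /partial derive_mx ?mxE //; apply: diff_derivable.
Qed.

Lemma jacobian_partial (n : nat) (f : 'rV[R]_m -> 'rV[R]_n) x i j : differentiable f x ->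
  ('J f x) i j = partial i (fun y => f y 0 j) x.
Proof.
by move=> df; rewrite -partial_mxE // /partial deriveE // /jacobian /lin1_mx mxE.
Qed.

End PointwiseRules.

Lemma differentiable_compf (m n : nat) (f : 'rV[R]_n -> R) (phi : 'rV[R]_m -> 'rV[R]_n) x :
  differentiable phi x -> differentiable f (phi x) ->
  differentiable (fun y => f (phi y)) x.
Proof. by move=> dphi df; apply: (differentiable_comp dphi df). Qed.

Lemma partial_comp (m n : nat) i (f : 'rV[R]_n -> R) (phi : 'rV[R]_m -> 'rV[R]_n) x :
  differentiable phi x -> differentiable f (phi x) ->
  partial i (fun y => f (phi y)) x =
  \sum_j partial i (fun y => phi y 0 j) x * partial j f (phi x).
Proof.
move=> dphi df; rewrite /partial deriveE; last exact: differentiable_compf.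
rewrite (diff_comp dphi df) /= -[LHS]deriveE // derive_sum_partial //.
by apply: eq_bigr => j _; rewrite -deriveE // -/(partial i phi x) partial_mxE.
Qed.

Lemma differentiable_sqrt (m : nat) (f : 'rV[R]_m -> R) x :
  differentiable f x -> 0 < f x -> differentiable (fun y => Num.sqrt (f y)) x.
Proof.
move=> df f0; apply: (differentiable_comp df).
by apply/derivable1_diffP; have [] := is_derive1_sqrt f0.
Qed.

Lemma partial_sqrt (m : nat) i (f : 'rV[R]_m -> R) x :
  differentiable f x -> 0 < f x ->
  partial i (fun y => Num.sqrt (f y)) x = partial i f x * (2 * Num.sqrt (f x))^-1.
Proof.
move=> df f0; have ds : derivable (@Num.sqrt R) (f x) 1 by have [] := is_derive1_sqrt f0.
have ds' : differentiable (@Num.sqrt R) (f x) by exact/derivable1_diffP.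
rewrite /partial deriveE; last exact: differentiable_sqrt.
rewrite (diff_comp df ds') /= -[X in 'd _ _ X]deriveE //.
rewrite -[X in 'd _ _ X]mulr1 linearZ /= -deriveE // derive_sqrt //.
Qed.

End Calculus.

(** * Closure properties of smooth functions *)

Section Smooth.
Variable R : realType.

(** [foldr] applies the last index of the list first, so a derivative is peeled off by splitting the
    list at its end. *)
Lemma smooth_onP (m : nat) (V : normedModType R) (U : set 'rV[R]_m) (f : 'rV[R]_m -> V) :
  smooth_on U f <->
  (forall x, U x -> differentiable f x) /\ forall i, smooth_on U (partial i f).
Proof.
split=> [sf|[df sf] s].
  by split=> [x Ux|i s]; [exact: (sf [::])|rewrite -foldr_rcons; exact: sf].
by case/lastP: s => [|s i] x Ux; [exact: df|rewrite foldr_rcons; exact: sf].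
Qed.

Lemma smooth_on_diff (m : nat) (V : normedModType R) (U : set 'rV[R]_m) (f : 'rV[R]_m -> V) x :
  smooth_on U f -> U x -> differentiable f x.
Proof. by move=> /smooth_onP[+ _]; exact. Qed.

Lemma smooth_on_partial (m : nat) (V : normedModType R) (U : set 'rV[R]_m) (f : 'rV[R]_m -> V) i :
  smooth_on U f -> smooth_on U (partial i f).
Proof. by move=> /smooth_onP[_ +]; exact. Qed.

Lemma smooth_on_sub (m : nat) (V : normedModType R) (U U' : set 'rV[R]_m) (f : 'rV[R]_m -> V) :
  U' `<=` U -> smooth_on U f -> smooth_on U' f.
Proof. by move=> UU sf s x /UU; exact: sf. Qed.

(* The closure of smooth functions under the algebraic operations is proved at
   once: the partial derivatives of an expression are again expressions. *)
Inductive smooth_expr (m : nat) (U : set 'rV[R]_m) : ('rV[R]_m -> R) -> Prop :=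
| SEbase f : smooth_on U f -> smooth_expr U f
| SEext f g : (forall x, U x -> f x = g x) -> smooth_expr U f -> smooth_expr U g
| SEadd f g : smooth_expr U f -> smooth_expr U g -> smooth_expr U (fun x => f x + g x)
| SEmul f g : smooth_expr U f -> smooth_expr U g -> smooth_expr U (fun x => f x * g x)
| SEinv f : (forall x, U x -> f x != 0) -> smooth_expr U f ->
    smooth_expr U (fun x => (f x)^-1)
| SEsqrt f : (forall x, U x -> 0 < f x) -> smooth_expr U f ->
    smooth_expr U (fun x => Num.sqrt (f x))
| SEcomp (n : nat) (V : set 'rV[R]_n) (f : 'rV[R]_n -> R) (phi : 'rV[R]_m -> 'rV[R]_n) :
    smooth_on V f -> (forall x, U x -> V (phi x)) ->
    (forall j, smooth_expr U (fun x => phi x 0 j)) ->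
    smooth_expr U (fun x => f (phi x)).

Lemma smooth_on_cst (m : nat) (U : set 'rV[R]_m) (c : R) : smooth_on U (fun=> c).
Proof.
suff H s : exists c', foldr (@partial R m R) (fun=> c) s = fun=> c'.
  by move=> s x _; have [c' ->] := H s; exact: differentiable_cst.
elim: s => [|i s [c' IH]]; first by exists c.
by exists 0; rewrite /= IH; apply/funext => x; rewrite partial_cst.
Qed.

Lemma smooth_on_coord (m : nat) (U : set 'rV[R]_m) (j : 'I_m) :
  smooth_on U (fun x : 'rV[R]_m => x 0 j : R).
Proof.
apply/smooth_onP; split=> [x _|i]; first exact: differentiable_coord_rV.
have -> : partial i (fun x : 'rV[R]_m => x 0 j : R) = fun=> (i == j)%:R.
  by apply/funext => x; rewrite partial_coord.
exact: smooth_on_cst.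
Qed.

Lemma smooth_expr_step (m : nat) (U : set 'rV[R]_m) f : open U -> smooth_expr U f ->
  (forall x, U x -> differentiable f x) /\ forall i, smooth_expr U (partial i f).
Proof.
move=> Uo; elim=> {f}.
- by move=> f /smooth_onP[df sf]; split=> // i; apply: SEbase.
- move=> f g fg _ [df sf]; split=> [x Ux|i].
    by apply: differentiable_near (df x Ux); apply: open_near Uo Ux fg.
  by apply: SEext (sf i) => x Ux; apply: partial_eq_on Uo Ux fg.
- move=> f g sf [df pf] sg [dg pg]; split=> [x Ux|i].
    by apply: differentiableD; auto.
  apply: (@SEext _ _ (fun x => partial i f x + partial i g x)).
    by move=> x Ux; rewrite partialD; auto.
  exact: SEadd.
- move=> f g sf [df pf] sg [dg pg]; split=> [x Ux|i].
    by apply: differentiableM; auto.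
  apply: (@SEext _ _ (fun x => partial i f x * g x + f x * partial i g x)).
    by move=> x Ux; rewrite partialM; auto.
  by apply: SEadd; apply: SEmul.
- move=> f f0 sf [df pf]; split=> [x Ux|i].
    by apply: differentiableV; auto.
  apply: (@SEext _ _ (fun x => -1 * (partial i f x * (f x)^-1 * (f x)^-1))).
    by move=> x Ux; rewrite partialV ?mulN1r; auto.
  by apply: SEmul; [exact/SEbase/smooth_on_cst|do 2?[apply: SEmul] => //; exact: SEinv].
- move=> f f0 sf [df pf]; split=> [x Ux|i].
    by apply: differentiable_sqrt; auto.
  apply: (@SEext _ _ (fun x => partial i f x * (2 * Num.sqrt (f x))^-1)).
    by move=> x Ux; rewrite partial_sqrt; auto.
  apply: SEmul => //; apply: SEinv.
    by move=> x Ux; rewrite mulf_neq0 ?pnatr_eq0 // sqrtr_eq0 -ltNge; auto.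
  by apply: SEmul; [exact/SEbase/smooth_on_cst|exact: SEsqrt].
- move=> n V f phi sf UV sphi IH.
  have dphi x : U x -> differentiable phi x.
    by move=> Ux; apply: differentiable_mx => a b; rewrite ord1; apply: (IH b).1.
  have df x : U x -> differentiable f (phi x).
    by move=> Ux; apply: smooth_on_diff sf _; exact: UV.
  split=> [x Ux|i]; first by apply: differentiable_compf; auto.
  apply: (@SEext _ _ (fun x => \sum_j partial i (fun y => phi y 0 j) x * partial j f (phi x))).
    by move=> x Ux; rewrite partial_comp; auto.
  (* Finite sums are not a constructor, so the sum of the chain rule is rebuilt term by term with
     [SEadd]. *)
  elim: (index_enum _) => [|j s IHs].
    by apply: (@SEext _ _ (fun=> 0)) => [x _|]; [rewrite big_nil|exact/SEbase/smooth_on_cst].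
  apply: (@SEext _ _ (fun x => partial i (fun y => phi y 0 j) x * partial j f (phi x) +
     \sum_(j <- s) partial i (fun y => phi y 0 j) x * partial j f (phi x))).
    by move=> x _; rewrite big_cons.
  apply: SEadd => //; apply: SEmul; first exact: (IH j).2.
  by apply: (@SEcomp _ _ _ V (partial j f) phi) => //; exact: smooth_on_partial.
Qed.

Lemma smooth_exprW (m : nat) (U : set 'rV[R]_m) f : open U -> smooth_expr U f -> smooth_on U f.
Proof.
move=> Uo sf s; suff : smooth_expr U (foldr (@partial R m R) f s).
  by move/(smooth_expr_step Uo) => [].
by elim: s => //= i s /(smooth_expr_step Uo)[].
Qed.

Section Closure.
Variables (m : nat) (U : set 'rV[R]_m).
Hypothesis Uo : open U.
Implicit Types f g : 'rV[R]_m -> R.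

Lemma smooth_on_ext f g : (forall x, U x -> f x = g x) -> smooth_on U f -> smooth_on U g.
Proof. by move=> fg sf; apply/smooth_exprW/(SEext fg)/SEbase. Qed.

Lemma smooth_onD f g : smooth_on U f -> smooth_on U g -> smooth_on U (fun x => f x + g x).
Proof. by move=> sf sg; apply: smooth_exprW => //; apply: SEadd; apply: SEbase. Qed.

Lemma smooth_onM f g : smooth_on U f -> smooth_on U g -> smooth_on U (fun x => f x * g x).
Proof. by move=> sf sg; apply: smooth_exprW => //; apply: SEmul; apply: SEbase. Qed.

Lemma smooth_onN f : smooth_on U f -> smooth_on U (fun x => - f x).
Proof.
move=> sf; under eq_fun do rewrite -mulN1r.
by apply: smooth_onM => //; exact: smooth_on_cst.
Qed.

Lemma smooth_onB f g : smooth_on U f -> smooth_on U g -> smooth_on U (fun x => f x - g x).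
Proof. by move=> sf sg; apply: smooth_onD => //; exact: smooth_onN. Qed.

Lemma smooth_onX f k : smooth_on U f -> smooth_on U (fun x => f x ^+ k).
Proof.
move=> sf; elim: k => [|k IH].
  by under eq_fun do rewrite expr0; exact: smooth_on_cst.
by under eq_fun do rewrite exprS; exact: smooth_onM.
Qed.

Lemma smooth_onV f : (forall x, U x -> f x != 0) -> smooth_on U f ->
  smooth_on U (fun x => (f x)^-1).
Proof. by move=> f0 sf; apply: smooth_exprW => //; apply: SEinv => //; apply: SEbase. Qed.

Lemma smooth_on_sqrt f : (forall x, U x -> 0 < f x) -> smooth_on U f ->
  smooth_on U (fun x => Num.sqrt (f x)).
Proof. by move=> f0 sf; apply: smooth_exprW => //; apply: SEsqrt => //; apply: SEbase. Qed.

Lemma smooth_on_sum (I : Type) (s : seq I) (P : pred I) (F : I -> 'rV[R]_m -> R) :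
  (forall i, P i -> smooth_on U (F i)) -> smooth_on U (fun x => \sum_(i <- s | P i) F i x).
Proof.
move=> sF; elim: s => [|i s IH].
  by under eq_fun do rewrite big_nil; exact: smooth_on_cst.
under eq_fun do rewrite big_cons.
case Pi: (P i) => //.
by apply: smooth_onD => //; exact: sF.
Qed.

Lemma smooth_on_prod (I : Type) (s : seq I) (P : pred I) (F : I -> 'rV[R]_m -> R) :
  (forall i, P i -> smooth_on U (F i)) -> smooth_on U (fun x => \prod_(i <- s | P i) F i x).
Proof.
move=> sF; elim: s => [|i s IH].
  by under eq_fun do rewrite big_nil; exact: smooth_on_cst.
under eq_fun do rewrite big_cons.
case Pi: (P i) => //.
by apply: smooth_onM => //; exact: sF.
Qed.

Lemma smooth_on_comp (n : nat) (V : set 'rV[R]_n) (f : 'rV[R]_n -> R)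
    (phi : 'rV[R]_m -> 'rV[R]_n) :
  smooth_on V f -> (forall x, U x -> V (phi x)) ->
  (forall j, smooth_on U (fun x => phi x 0 j)) -> smooth_on U (fun x => f (phi x)).
Proof.
by move=> sf UV sphi; apply/smooth_exprW/(SEcomp sf UV) => // j; apply: SEbase.
Qed.

(** Iterated partial derivatives of the entries and entries of the iterated partial derivatives are
    compared on U only. Each induction therefore carries a field [B] that agrees there with the
    iterated derivative. *)
Lemma smooth_on_mxP (p q : nat) (A : 'rV[R]_m -> 'M[R]_(p, q)) :
  smooth_on U A <-> forall i j, smooth_on U (fun x => A x i j).
Proof.
split=> [sA i j s x Ux|sA].
  suff [B sB AB] : exists2 B : 'rV[R]_m -> 'M[R]_(p, q), smooth_on U B &
      forall x, U x -> foldr (@partial R m R) (fun x => A x i j) s x = B x i j.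
    apply: (@differentiable_near _ _ _ (fun x => B x i j)).
      by apply: (open_near Uo Ux) => y Uy; rewrite AB.
    by apply: differentiable_mx_coord; exact: smooth_on_diff sB Ux.
  elim: s => [|k s [B sB AB]]; first by exists A.
  exists (partial k B); first exact: smooth_on_partial.
  move=> y Uy /=; rewrite (partial_eq_on k Uo Uy AB) partial_mxE //.
  exact: smooth_on_diff sB Uy.
move=> s x Ux.
suff [B sB AB] : exists2 B : 'rV[R]_m -> 'M[R]_(p, q),
      (forall i j, smooth_on U (fun x => B x i j)) &
      forall x, U x -> foldr (@partial R m 'M[R]_(p, q)) A s x = B x.
  apply: (@differentiable_near _ _ _ B).
    by apply: (open_near Uo Ux) => y Uy; rewrite AB.
  by apply: differentiable_mx => i j; exact: smooth_on_diff (sB i j) Ux.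
elim: s => [|k s [B sB AB]]; first by exists A.
exists (fun x => \matrix_(i, j) partial k (fun x => B x i j) x).
  by move=> i j; under eq_fun do rewrite mxE; exact: smooth_on_partial.
move=> y Uy /=.
have -> : partial k (foldr (@partial R m 'M[R]_(p, q)) A s) y = partial k B y.
  by apply: near_eq_derive; exact: open_near Uo Uy AB.
apply/matrixP => i j; rewrite partial_mxE ?mxE //.
by apply: differentiable_mx => a b; exact: smooth_on_diff (sB a b) Uy.
Qed.

Lemma smooth_on_mulmx (p q r : nat) (A : 'rV[R]_m -> 'M[R]_(p, q)) (B : 'rV[R]_m -> 'M[R]_(q, r)) :
  smooth_on U A -> smooth_on U B -> smooth_on U (fun x => A x *m B x).
Proof.
move=> /smooth_on_mxP sA /smooth_on_mxP sB; apply/smooth_on_mxP => i j.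
under eq_fun do rewrite mxE.
by apply: smooth_on_sum => k _; exact: smooth_onM.
Qed.

Lemma smooth_on_trmx (p q : nat) (A : 'rV[R]_m -> 'M[R]_(p, q)) :
  smooth_on U A -> smooth_on U (fun x => (A x)^T).
Proof.
move=> /smooth_on_mxP sA; apply/smooth_on_mxP => i j.
by under eq_fun do rewrite mxE; exact: sA.
Qed.

Lemma smooth_on_addmx (p q : nat) (A B : 'rV[R]_m -> 'M[R]_(p, q)) :
  smooth_on U A -> smooth_on U B -> smooth_on U (fun x => A x + B x).
Proof.
move=> /smooth_on_mxP sA /smooth_on_mxP sB; apply/smooth_on_mxP => i j.
by under eq_fun do rewrite mxE; exact: smooth_onD.
Qed.

Lemma smooth_on_scalemx (p q : nat) f (A : 'rV[R]_m -> 'M[R]_(p, q)) :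
  smooth_on U f -> smooth_on U A -> smooth_on U (fun x => f x *: A x).
Proof.
move=> sf /smooth_on_mxP sA; apply/smooth_on_mxP => i j.
by under eq_fun do rewrite mxE; exact: smooth_onM.
Qed.

Lemma smooth_on_det (p : nat) (A : 'rV[R]_m -> 'M[R]_p) :
  smooth_on U A -> smooth_on U (fun x => \det (A x)).
Proof.
move=> /smooth_on_mxP sA; apply: smooth_on_sum => s _.
by apply: smooth_onM; [exact: smooth_on_cst|exact: smooth_on_prod].
Qed.

(** Cramer's formula makes the inverse a rational expression in the entries. *)
Lemma smooth_on_invmx (p : nat) (A : 'rV[R]_m -> 'M[R]_p) :
  (forall x, U x -> \det (A x) != 0) -> smooth_on U A -> smooth_on U (fun x => invmx (A x)).
Proof.
move=> A0 sA; apply/smooth_on_mxP => i j.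
apply: (@smooth_on_ext (fun x => (\det (A x))^-1 * cofactor (A x) j i)).
  by move=> x Ux; rewrite /invmx unitmxE unitfE A0 // !mxE.
apply: smooth_onM; first by apply: smooth_onV => //; exact: smooth_on_det.
apply: smooth_onM; first exact: smooth_on_cst.
apply: smooth_on_det; apply/smooth_on_mxP => a b.
by move/smooth_on_mxP : sA => sA; under eq_fun do rewrite !mxE; exact: sA.
Qed.

Lemma smooth_on_tr (p : nat) (A : 'rV[R]_m -> 'M[R]_p) :
  smooth_on U A -> smooth_on U (fun x => \tr (A x)).
Proof. by move=> /smooth_on_mxP sA; apply: smooth_on_sum => s _. Qed.

Lemma smooth_on_id : smooth_on U (fun x : 'rV[R]_m => x).
Proof. by apply/smooth_on_mxP => i j; rewrite ord1; exact: smooth_on_coord. Qed.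

End Closure.

Lemma smooth_on_comp_mx (m n p q : nat) (U : set 'rV[R]_m) (V : set 'rV[R]_n)
    (A : 'rV[R]_n -> 'M[R]_(p, q)) (phi : 'rV[R]_m -> 'rV[R]_n) :
  open U -> open V -> smooth_on V A -> (forall x, U x -> V (phi x)) -> smooth_on U phi ->
  smooth_on U (fun x => A (phi x)).
Proof.
move=> Uo Vo /(smooth_on_mxP Vo) sA UV /(smooth_on_mxP Uo) sphi.
apply/(smooth_on_mxP Uo) => i j.
exact: (smooth_on_comp Uo (sA i j) UV (sphi 0)).
Qed.

Lemma smooth_on_jacobian (m n : nat) (U : set 'rV[R]_m) (phi : 'rV[R]_m -> 'rV[R]_n) :
  open U -> smooth_on U phi -> smooth_on U (fun x => 'J phi x).
Proof.
move=> Uo sphi; apply/(smooth_on_mxP Uo) => i j.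
apply: (@smooth_on_ext _ _ Uo (partial i (fun y => phi y 0 j))).
  by move=> x Ux; rewrite jacobian_partial //; exact: smooth_on_diff sphi Ux.
by apply: smooth_on_partial; move/(smooth_on_mxP Uo) : sphi.
Qed.

End Smooth.

(** * Determinants, frames and mixed partial derivatives *)

Section MatrixRules.
Variables (R : realType) (m : nat).
Implicit Types (x : 'rV[R]_m) (i : 'I_m).

Lemma partial_mulmx (p q r : nat) i (A : 'rV[R]_m -> 'M[R]_(p, q))
    (B : 'rV[R]_m -> 'M[R]_(q, r)) x :
  differentiable A x -> differentiable B x ->
  partial i (fun y => A y *m B y) x = partial i A x *m B x + A x *m partial i B x.
Proof.
move=> dA dB.
have dc a b c : differentiable (fun y => A y a b * B y b c) x.
  by apply: differentiableM; exact: differentiable_mx_coord.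
have E a c : (fun y => (A y *m B y) a c) = fun y => \sum_b A y a b * B y b c.
  by apply/funext => y; rewrite mxE.
have dAB : differentiable (fun y => A y *m B y) x.
  by apply: differentiable_mx => a c; rewrite E; exact: differentiable_sumf.
apply/matrixP => a c; rewrite partial_mxE // E partial_sum // !mxE -big_split /=.
apply: eq_bigr => b _.
by rewrite partialM ?partial_mxE //; exact: differentiable_mx_coord.
Qed.

Lemma partial_trmx (p q : nat) i (A : 'rV[R]_m -> 'M[R]_(p, q)) x :
  differentiable A x -> partial i (fun y => (A y)^T) x = (partial i A x)^T.
Proof.
move=> dA; have E a c : (fun y => (A y)^T a c) = fun y => A y c a.
  by apply/funext => y; rewrite mxE.
apply/matrixP => a c; rewrite partial_mxE ?E ?mxE ?partial_mxE //.
by apply: differentiable_mx => ? ?; rewrite E; exact: differentiable_mx_coord.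
Qed.

Lemma partial_tr (p : nat) i (A : 'rV[R]_m -> 'M[R]_p) x :
  differentiable A x -> partial i (fun y => \tr (A y)) x = \tr (partial i A x).
Proof.
move=> dA; rewrite /mxtrace partial_sum; last by move=> j; exact: differentiable_mx_coord.
by apply: eq_bigr => j _; rewrite partial_mxE.
Qed.

Lemma partial_prod (I : eqType) (s : seq I) i (F : I -> 'rV[R]_m -> R) x :
  uniq s -> (forall j, differentiable (F j) x) ->
  partial i (fun y => \prod_(j <- s) F j y) x =
  \sum_(j <- s) partial i (F j) x * \prod_(k <- s | k != j) F k x.
Proof.
move=> us dF.
have dp t : differentiable (fun y => \prod_(j <- t) F j y) x.
  elim: t => [|a t IH].
    by under eq_fun do rewrite big_nil; exact: differentiable_cst.
  by under eq_fun do rewrite big_cons; exact: differentiableM.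
elim: s us => [_|a s IH /= /andP[as_ us]].
  by under eq_fun do rewrite big_nil; rewrite big_nil partial_cst.
under eq_fun do rewrite big_cons.
rewrite partialM // big_cons big_cons eqxx /= IH //; congr (_ + _).
  congr (_ * _); rewrite big_seq [RHS]big_seq_cond; apply: eq_bigl => k.
  by case: eqVneq => [->|]; rewrite ?(negPf as_) ?andbT.
rewrite big_distrr /= big_seq [RHS]big_seq; apply: eq_bigr => j js.
rewrite big_cons ifT; first by rewrite mulrCA.
by apply: contraNneq as_ => ->.
Qed.

(** Jacobi's formula. In the Leibniz expansion, differentiating the factor from row a gives the
    determinant of [A] with row a replaced by that of its derivative; this is then expanded along
    row a. *)
Lemma partial_det (p : nat) i (A : 'rV[R]_m -> 'M[R]_p) x :
  differentiable A x ->
  partial i (fun y => \det (A y)) x = \tr (\adj (A x) *m partial i A x).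
Proof.
move=> dA.
have dc a b : differentiable (fun y => A y a b) x by exact: differentiable_mx_coord.
have dp s : differentiable (fun y => \prod_a A y a (s a)) x.
  elim: (index_enum _) => [|a t IH].
    by under eq_fun do rewrite big_nil; exact: differentiable_cst.
  by under eq_fun do rewrite big_cons; exact: differentiableM.
pose D := partial i A x.
have rowa a : \sum_(s : 'S_p) (-1) ^+ s * (D a (s a) * \prod_(k | k != a) A x k (s k)) =
    \sum_b D a b * cofactor (A x) a b.
  pose A' := \matrix_(c, b) if c == a then D a b else A x c b.
  transitivity (\det A').
    apply: eq_bigr => s _; congr (_ * _); rewrite [RHS](bigD1 a) //= mxE eqxx; congr (_ * _).
    by apply: eq_bigr => k ka; rewrite mxE (negPf ka).
  rewrite (expand_det_row _ a); apply: eq_bigr => b _; rewrite mxE eqxx; congr (_ * (_ * \det _)).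
  by apply/matrixP => c e; rewrite !mxE eq_sym (negPf (neq_lift _ _)).
rewrite /determinant partial_sum; last first.
  by move=> s; apply: differentiableM; [exact: differentiable_cst|exact: dp].
transitivity (\sum_(s : 'S_p) \sum_a (-1) ^+ s * (D a (s a) * \prod_(k | k != a) A x k (s k))).
  apply: eq_bigr => s _; rewrite partialM; [|exact: differentiable_cst|exact: dp].
  rewrite partial_cst mul0r add0r partial_prod ?index_enum_uniq // big_distrr /=.
  by apply: eq_bigr => a _; rewrite /D partial_mxE.
rewrite exchange_big /=; under eq_bigr do rewrite rowa.
rewrite mxtrace_mulC; apply: eq_bigr => a _; rewrite mxE.
by apply: eq_bigr => b _; rewrite mxE.
Qed.

Lemma partial_det_unit (p : nat) i (A : 'rV[R]_m -> 'M[R]_p) x :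
  differentiable A x -> \det (A x) != 0 ->
  partial i (fun y => \det (A y)) x = \det (A x) * \tr (invmx (A x) *m partial i A x).
Proof.
move=> dA A0; rewrite partial_det // -mxtraceZ scalemxAl /invmx unitmxE unitfE A0.
by rewrite scalerA mulfV // scale1r.
Qed.

End MatrixRules.

(** * Positive definite matrices and the inverse of a metric in an adapted frame *)

Section PositiveDefinite.
Variable R : realType.

Lemma posdef_det_neq0 (p : nat) (A : 'M[R]_p) :
  (forall v : 'rV[R]_p, v != 0 -> 0 < (v *m A *m v^T) 0 0) -> \det A != 0.
Proof.
move=> pA; apply/det0P => -[v v0 vA].
by have := pA v v0; rewrite vA mul0mx mxE ltxx.
Qed.

Lemma dot_sum (p : nat) (v w : 'rV[R]_p) : (v *m w^T) 0 0 = \sum_i v 0 i * w 0 i.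
Proof. by rewrite mxE; apply: eq_bigr => i _; rewrite mxE. Qed.

Lemma dot_gt0 (p : nat) (v : 'rV[R]_p) : v != 0 -> 0 < (v *m v^T) 0 0.
Proof.
move=> v0; rewrite dot_sum lt_neqAle sumr_ge0 ?andbT => [|i _]; last by rewrite -expr2 sqr_ge0.
rewrite eq_sym; apply: contra v0 => /eqP s0; apply/eqP/rowP => i; rewrite mxE.
have sq j : true -> 0 <= v 0 j * v 0 j by move=> _; rewrite -expr2 sqr_ge0.
by have /eqP := psumr_eq0P sq s0 (erefl : xpredT i); rewrite mulf_eq0 orbb => /eqP.
Qed.

(** The segment from the identity to A consists of positive definite matrices. Along it the
    determinant is a polynomial that starts at 1 and has no zero, so it cannot become
    nonpositive. *)
Lemma posdef_det_gt0 (p : nat) (A : 'M[R]_p) :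
  (forall v : 'rV[R]_p, v != 0 -> 0 < (v *m A *m v^T) 0 0) -> 0 < \det A.
Proof.
move=> pA; rewrite ltNge; apply/negP => A0.
pose q : {poly R} := \det ('X *: map_mx polyC A + (1 - 'X)%:M).
have qE t : q.[t] = \det (t *: A + (1 - t)%:M).
  rewrite /q -[LHS]/(horner_eval t _) -det_map_mx; congr (\det _); apply/matrixP => a b.
  by rewrite mxE /= /horner_eval !mxE !hornerE hornerMn !hornerE.
have [t /andP[t0 t1]] : exists2 t, 0 <= t <= 1 & root (- q) t.
  apply: poly_ivt; rewrite ?ler01 // !hornerN !qE scale0r add0r subr0 det1.
  by rewrite scale1r subrr (raddf0 (@scalar_mx R p)) addr0 lerN10 oppr_ge0.
rewrite rootN rootE qE; apply/negP/posdef_det_neq0 => v v0.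
rewrite mulmxDr mulmxDl mxE -scalemxAr -scalemxAl mxE.
rewrite mul_mx_scalar -scalemxAl [X in _ + X]mxE.
have := pA v v0; have := dot_gt0 v0.
have [->|t_gt0] := eqVneq t 0; first by rewrite mul0r add0r subr0 mul1r.
move=> v2 vA; apply: ltr_wpDr.
  by rewrite mulr_ge0 ?subr_ge0 // ltW.
by rewrite mulr_gt0 // lt_neqAle eq_sym t_gt0.
Qed.

(* x is an h-unit vector h-orthogonal to the rows of J, so that the inverse of h
   splits in the frame made of x and J. *)
Lemma gram_inverse (m : nat) (J : 'M[R]_(m, m.+1)) (h : 'M[R]_m.+1) (x : 'rV[R]_m.+1) :
  row_free J -> h^T = h -> h \in unitmx -> J *m h *m x^T = 0 -> x *m h *m x^T = 1%:M ->
  J *m h *m J^T \in unitmx ->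
  J^T *m invmx (J *m h *m J^T) *m J = invmx h - x^T *m x.
Proof.
move=> Jf hs hu Jx xx Gu; set G := J *m h *m J^T.
have xJ : x *m h *m J^T = 0.
  by apply: trmx_inj; rewrite !trmx_mul trmxK hs mulmxA Jx trmx0.
pose C : 'M[R]_(1 + m, m.+1) := col_mx x J.
have Cu : row_free C.
  apply/inj_row_free => v; rewrite -(hsubmxK v) mul_row_col => vC.
  have v1 : lsubmx v = 0.
    have /(congr1 (mulmx^~ (h *m x^T))) := vC.
    by rewrite mulmxDl -!mulmxA (mulmxA x) xx (mulmxA J) Jx mulmx0 mulmx1 addr0 mul0mx.
  move: vC; rewrite v1 mul0mx add0r => vC.
  by rewrite (row_free_inj Jf _ : rsubmx v = 0) ?row_mx0 // vC mul0mx.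
(* [Y] is the candidate for the inverse of h: testing h Y on the invertible frame [C] shows that it
   is the identity. *)
pose Y := J^T *m invmx G *m J + x^T *m x.
have CY : C *m (h *m Y) = C.
  rewrite mulmxA mul_col_mx mul_col_mx /Y; congr col_mx.
    by rewrite mulmxDr !mulmxA xx mul1mx xJ !mul0mx add0r.
  by rewrite mulmxDr !mulmxA Jx mul0mx addr0 -/G mulmxV // mul1mx.
have Cu' : (C : 'M[R]_m.+1) \in unitmx by rewrite -row_free_unit.
have hY : h *m Y = 1%:M by rewrite -[LHS](mulKmx Cu') CY mulVmx.
have YE : Y = invmx h by rewrite -[Y]mul1mx -(mulVmx hu) -mulmxA hY mulmx1.
by rewrite -YE addrK.
Qed.

End PositiveDefinite.

(** * Symmetry of second partial derivatives *)

Section Schwarz.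
Variables (R : realType) (m : nat).
Implicit Types (f : 'rV[R]_m -> R) (U : set 'rV[R]_m).

Lemma is_derive_line f (p v : 'rV[R]_m) (t : R) : differentiable f (p + t *: v) ->
  is_derive t 1 (fun s : R => f (p + s *: v)) ('D_v f (p + t *: v)).
Proof.
move=> df.
have dl : is_diff t (fun s : R => p + s *: v) (fun s => s *: v).
  by apply: is_diff_eq; rewrite add0r.
have dlt : differentiable (fun s : R => p + s *: v) t by [].
have dc : differentiable (fun s : R => f (p + s *: v)) t.
  exact: (differentiable_comp dlt df).
apply: DeriveDef; first exact/derivable1_diffP.
rewrite deriveE // (diff_comp dlt df) /= [in LHS](@diff_val _ _ _ _ _ _ _ dl).
by rewrite scale1r deriveE.
Qed.

Lemma open_ball U (x : 'rV[R]_m) : open U -> U x ->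
  exists2 r : R, 0 < r & forall y, `|y - x| < r -> U y.
Proof.
move=> Uo Ux; have /nbhs_normP[r /= r0 rU] : nbhs x U by exact: open_nbhs_nbhs.
by exists r => // y yr; apply: rU; rewrite /= distrC.
Qed.

Let mixed f (x v w : 'rV[R]_m) (s : R) :=
  f (x + s *: v + s *: w) - f (x + s *: v) - f (x + s *: w) + f x.

(** The mean value theorem is used twice: along v for the difference of f in the direction w, then
    along w for the partial derivative so obtained. *)
Let mixedE U f x (i j : 'I_m) (s r : R) : smooth_on U f ->
  (forall y, `|y - x| < r -> U y) -> 0 < s ->
  s * (`|delta_mx 0 i : 'rV[R]_m| + `|delta_mx 0 j : 'rV[R]_m|) < r ->
  exists2 y, `|y - x| < r & 
    mixed f x (delta_mx 0 i) (delta_mx 0 j) s = s ^+ 2 * partial j (partial i f) y.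
Proof.
move=> sf rU s0 sr; set v := delta_mx 0 i; set w := delta_mx 0 j.
have nr a b : 0 <= a <= s -> 0 <= b <= s -> `|x + a *: v + b *: w - x| < r.
  move=> /andP[a0 as_] /andP[b0 bs]; rewrite -[x + _ + _]addrA (addrC x) addrK.
  apply: le_lt_trans sr; apply: le_trans (ler_normD _ _) _.
  by rewrite !normrZ !ger0_norm // mulrDr lerD // ler_wpM2r.
have s0' : 0 <= s := ltW s0.
have ss : 0 <= s <= s by rewrite s0' lexx.
have z0 : 0 <= (0:R) <= s by rewrite s0' lexx.
have UU a b : 0 <= a <= s -> 0 <= b <= s -> U (x + a *: v + b *: w).
  by move=> ha hb; apply: rU; exact: nr.
have in01 (a : R) : a \in `[0, s] -> 0 <= a <= s by rewrite in_itv.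
have in01o (a : R) : a \in `]0, s[ -> 0 <= a <= s.
  by rewrite in_itv /= => /andP[/ltW -> /ltW ->].
pose g a := f ((x + s *: w) + a *: v) - f (x + a *: v).
pose dg a := partial i f ((x + s *: w) + a *: v) - partial i f (x + a *: v).
have dfi a : 0 <= a <= s -> is_derive a 1 g (dg a).
  move=> ha; apply: is_deriveB; apply: is_derive_line; apply: (smooth_on_diff sf).
    by rewrite addrAC; exact: UU.
  by have := UU a 0 ha z0; rewrite scale0r addr0.
have [||a a0s ga] := @MVT R g dg 0 s s0.
- by move=> a /in01o; exact: dfi.
- by apply: derivable_within_continuous => a /in01/dfi[].
have sfi := smooth_on_partial i sf.
pose k b := partial i f ((x + a *: v) + b *: w).
pose dk b := partial j (partial i f) ((x + a *: v) + b *: w).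
have dki b : 0 <= b <= s -> is_derive b 1 k (dk b).
  by move=> hb; apply: is_derive_line; apply: (smooth_on_diff sfi); apply: UU => //; exact: in01o.
have [||b b0s kb] := @MVT R k dk 0 s s0.
- by move=> b /in01o; exact: dki.
- by apply: derivable_within_continuous => b /in01/dki[].
exists (x + a *: v + b *: w); first by apply: nr; exact: in01o.
transitivity (g s - g 0).
  by rewrite /g /mixed !scale0r !addr0 (addrAC x (s *: w)); ring.
move: ga kb; rewrite /dg /k /dk !subr0 scale0r addr0 (addrAC x (s *: w)) => -> ->.
by ring.
Qed.

(** The second difference [mixed] is symmetric in its two directions, so the two mixed derivatives
    take a common value at points arbitrarily close to x. Continuity concludes. *)
Lemma partialC U f (i j : 'I_m) x : open U -> smooth_on U f -> U x ->
  partial i (partial j f) x = partial j (partial i f) x.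
Proof.
move=> Uo sf Ux; apply/eqP; rewrite -subr_eq0 -normr_le0; apply/ler_addgt0Pl => e e0.
have ct k l : {for x, continuous (partial k (partial l f))}.
  by apply/differentiable_continuous/smooth_on_diff; [do 2 apply: smooth_on_partial; exact: sf|].
have [r0 r00 rU] := open_ball Uo Ux.
have e2 : 0 < e / 2 by rewrite divr_gt0.
have near_ct k l : exists2 r : R, 0 < r & forall y, `|y - x| < r ->
    `|partial k (partial l f) x - partial k (partial l f) y| < e / 2.
  have /cvgrPdist_lt/(_ _ e2) := ct k l.
  move=> /nbhs_normP[r /= r_gt0 rP]; exists r => // y yr.
  by apply: rP; rewrite /= distrC.
have [r1 r10 rP1] := near_ct i j; have [r2 r20 rP2] := near_ct j i.
pose r := Num.min r0 (Num.min r1 r2).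
have r_gt0 : 0 < r by rewrite !lt_min r00 r10 r20.
pose K : R := `|delta_mx 0 i : 'rV[R]_m| + `|delta_mx 0 j : 'rV[R]_m|.
have K0 : 0 <= K by rewrite addr_ge0.
(* This step keeps the whole parallelogram within distance r of x. *)
pose s := r / (K + 1).
have K1 : 0 < K + 1 by rewrite ltr_wpDl.
have s0 : 0 < s by rewrite divr_gt0.
have sK : s * K < r.
  by rewrite /s mulrAC ltr_pdivrMr // ltr_pM2l // ltrDl.
have rU' y : `|y - x| < r -> U y by rewrite !lt_min => /andP[? _]; exact: rU.
have [y yr Ey] := mixedE sf rU' s0 sK.
have [|z zr Ez] := @mixedE U f x j i s r sf rU' s0; first by rewrite addrC.
have yz : partial j (partial i f) y = partial i (partial j f) z.
  apply: (mulfI (lt0r_neq0 (exprn_gt0 2 s0))); apply: etrans (esym Ey) _; apply: etrans Ez.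
  rewrite /mixed.
  by rewrite (addrAC x (s *: delta_mx 0 j)); ring.
move: yr zr; rewrite !lt_min => /and3P[_ _ yr] /and3P[_ zr _].
rewrite -(subrKA (partial i (partial j f) z)) addr0 -{2}yz (splitr e).
apply: le_trans (ler_normD _ _) _; apply: lerD; first exact/ltW/rP1.
by rewrite distrC; exact/ltW/rP2.
Qed.

End Schwarz.

(** * Gradient and Laplacian of a submanifold in ambient terms *)

Section InducedOperators.
Variable R : realType.

Definition egrad (n : nat) (f : 'rV[R]_n -> R) (x : 'rV[R]_n) : 'rV[R]_n :=
  \row_i partial i f x.

Definition dirmx (n p q : nat) (X : 'rV[R]_n) (A : 'rV[R]_n -> 'M[R]_(p, q)) (x : 'rV[R]_n) :=
  \sum_k X 0 k *: partial k A x.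

Lemma mul_egrad_tr (n p : nat) (D : 'M[R]_(p, n)) (f : 'rV[R]_n -> R) x i :
  (egrad f x *m D^T) 0 i = \sum_j D i j * partial j f x.
Proof. by rewrite mxE; apply: eq_bigr => j _; rewrite !mxE mulrC. Qed.

Section Chart.
Variables (m n : nat) (U : set 'rV[R]_m) (W : set 'rV[R]_n).
Variables (phi : 'rV[R]_m -> 'rV[R]_n).
Hypotheses (Uo : open U) (Wo : open W) (sphi : smooth_on U phi).
Hypothesis phiW : forall u, U u -> W (phi u).

Lemma differentialE (f : 'rV[R]_n -> R) u : smooth_on W f -> U u ->
  differential phi f u = egrad f (phi u) *m ('J phi u)^T.
Proof.
move=> sf Uu; have dphi := smooth_on_diff sphi Uu.
apply/rowP => i; rewrite mxE partial_comp //; last exact: smooth_on_diff sf (phiW Uu).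
by rewrite mul_egrad_tr; apply: eq_bigr => j _; rewrite jacobian_partial.
Qed.

Lemma partial_comp_mx (p q : nat) (A : 'rV[R]_n -> 'M[R]_(p, q)) i u : smooth_on W A -> U u ->
  partial i (fun v => A (phi v)) u = dirmx (row i ('J phi u)) A (phi u).
Proof.
move=> sA Uu; have dphi := smooth_on_diff sphi Uu.
have dA := smooth_on_diff sA (phiW Uu).
have dAphi : differentiable (fun v => A (phi v)) u by apply: differentiable_comp.
apply/matrixP => a b; rewrite partial_mxE //.
rewrite (partial_comp i dphi (differentiable_mx_coord a b dA)) summxE.
by apply: eq_bigr => j _; rewrite [RHS]mxE [row _ _ _ _]mxE jacobian_partial // partial_mxE.
Qed.

Lemma partial_jacobianC i k l u : U u ->
  partial i (fun v => 'J phi v) u k l = partial k (fun v => 'J phi v) u i l.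
Proof.
move=> Uu; have sJ := smooth_on_jacobian Uo sphi.
have sl := (smooth_on_mxP Uo _).1 sphi 0 l.
have E (j : 'I_m) v : U v -> 'J phi v j l = partial j (fun w => phi w 0 l) v.
  by move=> Uv; rewrite jacobian_partial //; exact: smooth_on_diff sphi Uv.
have dJ := smooth_on_diff sJ Uu.
have [J JE] : exists J, J = jacobian phi by exists (jacobian phi).
rewrite -JE in dJ E *.
rewrite (partial_mxE _ _ _ dJ) (partial_mxE _ _ _ dJ).
by rewrite (partial_eq_on _ Uo Uu (E k)) (partial_eq_on _ Uo Uu (E i)) (partialC _ _ Uo sl).
Qed.

End Chart.

Lemma dirmx_sum (n p q k : nat) (c : 'rV[R]_k) (X : 'M[R]_(k, n)) (A : 'rV[R]_n -> 'M[R]_(p, q)) x :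
  \sum_i c 0 i *: dirmx (row i X) A x = dirmx (c *m X) A x.
Proof.
rewrite /dirmx; under eq_bigr do rewrite scaler_sumr.
rewrite exchange_big /=; apply: eq_bigr => j _; rewrite mxE scaler_suml.
by apply: eq_bigr => i _; rewrite !mxE scalerA.
Qed.

Section Laplacian.
Variables (m : nat).
Local Notation n := m.+1.
Variables (U : set 'rV[R]_m) (W : set 'rV[R]_n) (phi : 'rV[R]_m -> 'rV[R]_n).
Variables (h : 'rV[R]_n -> 'M[R]_n) (f : 'rV[R]_n -> R).
Hypotheses (Uo : open U) (Wo : open W) (sphi : smooth_on U phi).
Hypotheses (phiW : forall u, U u -> W (phi u)) (Jfree : forall u, U u -> row_free ('J phi u)).
Hypotheses (sh : smooth_on W h) (hpos : forall x, W x -> posdefmx (h x)).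
(** What a Hessian cone metric provides: dh is totally symmetric and h is constant on rays. The
    remaining hypotheses make f constant on rays and the position vector a unit normal of the
    chart. *)
Hypothesis partial_h_sym : forall x i j k, W x -> partial i h x j k = partial j h x i k.
Hypothesis h_radial : forall x, W x -> dirmx x h x = 0.
Hypotheses (sf : smooth_on W f) (f_radial : forall x, W x -> egrad f x *m x^T = 0).
Hypothesis phi_normal : forall u, U u -> 'J phi u *m h (phi u) *m (phi u)^T = 0.
Hypothesis phi_unit : forall u, U u -> phi u *m h (phi u) *m (phi u)^T = 1%:M.

Definition ambient_grad (x : 'rV[R]_n) : 'rV[R]_n := egrad f x *m invmx (h x).

(** For a Hessian metric the Christoffel symbols of the first kind are half of the third derivatives
    of the potential, so the matrix in parentheses is the covariant Hessian of f for h. *)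
Definition ambient_laplacian (x : 'rV[R]_n) : R :=
  \tr (invmx (h x) *m (hessian f x - 2^-1 *: dirmx (ambient_grad x) h x)).

Let hdet x : W x -> \det (h x) != 0.
Proof. by move=> /hpos[_]; exact: posdef_det_neq0. Qed.

Let hunit x : W x -> h x \in unitmx.
Proof. by move=> Wx; rewrite unitmxE unitfE hdet. Qed.

Lemma gram_posdef u : U u -> posdefmx (gram h phi u).
Proof.
move=> Uu; have [hs hp] := hpos (phiW Uu); split.
  by rewrite /gram !trmx_mul trmxK hs mulmxA.
move=> v v0; have vJ : v *m 'J phi u != 0.
  by apply: contra v0 => /eqP vJ; apply/eqP/(row_free_inj (Jfree Uu)); rewrite vJ mul0mx.
by have := hp _ vJ; rewrite trmx_mul !mulmxA.
Qed.

Lemma gram_smooth : smooth_on U (gram h phi).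
Proof.
have sJ := smooth_on_jacobian Uo sphi.
apply: (smooth_on_mulmx Uo); last exact: smooth_on_trmx.
by apply: (smooth_on_mulmx Uo) => //; exact: (smooth_on_comp_mx Uo Wo sh).
Qed.

Let Gpos u : U u -> 0 < \det (gram h phi u).
Proof. by move=> /gram_posdef[_]; exact: posdef_det_gt0. Qed.

Let Gunit u : U u -> gram h phi u \in unitmx.
Proof. by move=> Uu; rewrite unitmxE unitfE gt_eqF ?Gpos. Qed.

Let Qu u : U u ->
  ('J phi u)^T *m invmx (gram h phi u) *m 'J phi u = invmx (h (phi u)) - (phi u)^T *m phi u.
Proof.
move=> Uu; apply: gram_inverse; [exact: Jfree|by case: (hpos (phiW Uu))|exact/hunit/phiW
  |exact: phi_normal|exact: phi_unit|exact: Gunit].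
Qed.

Let segrad : smooth_on W (egrad f).
Proof.
apply/(smooth_on_mxP Wo) => a i; under eq_fun do rewrite mxE.
exact: smooth_on_partial.
Qed.

Let sX : smooth_on W ambient_grad.
Proof.
apply: (smooth_on_mulmx Wo) => //.
by apply: (smooth_on_invmx Wo) => //; exact: hdet.
Qed.

(** In the splitting of h^-1 the part along x is killed because df vanishes on x; the ambient
    gradient is thus already tangent. *)
Lemma grad_jacobian u : U u -> grad h phi f u *m 'J phi u = ambient_grad (phi u).
Proof.
move=> Uu; rewrite /grad (differentialE sphi phiW sf Uu) -!mulmxA.
rewrite (mulmxA ('J phi u)^T) Qu // mulmxBr mulmxA f_radial ?mul0mx ?subr0 //.
exact: phiW.
Qed.

Lemma grad_sqnormE u : U u ->
  grad_sqnorm h phi f u = (ambient_grad (phi u) *m (egrad f (phi u))^T) 0 0.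
Proof.
move=> Uu; have Wx := phiW Uu; have [hs _] := hpos Wx.
rewrite /grad_sqnorm /gram !mulmxA grad_jacobian // -mulmxA -trmx_mul grad_jacobian //.
rewrite {2}/ambient_grad trmx_mul trmx_inv hs !mulmxA.
by rewrite mulmxKV //; exact: hunit.
Qed.

Let sgrad : smooth_on U (grad h phi f).
Proof.
apply: (smooth_on_mulmx Uo).
  apply/(smooth_on_mxP Uo) => a i; under eq_fun do rewrite mxE.
  apply: smooth_on_partial; apply: (smooth_on_comp Uo sf phiW) => j.
  by move/(smooth_on_mxP Uo) : sphi.
apply: (smooth_on_invmx Uo) gram_smooth => u Uu.
by rewrite gt_eqF ?Gpos.
Qed.

(* Differentiating [ambient_grad x *m h x = egrad f x]. *)
Let DX x : W x -> (\matrix_(k, l) partial k ambient_grad x 0 l) *m h x =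
  hessian f x - dirmx (ambient_grad x) h x.
Proof.
move=> Wx; apply/eqP; rewrite eq_sym subr_eq; apply/eqP/matrixP => k l.
have dX := smooth_on_diff sX Wx; have dh := smooth_on_diff sh Wx.
have E y : W y -> (ambient_grad y *m h y) = egrad f y.
  by move=> Wy; rewrite /ambient_grad mulmxKV //; exact: hunit.
have -> : hessian f x k l = partial k (fun y => ambient_grad y *m h y) x 0 l.
  have -> : partial k (fun y => ambient_grad y *m h y) x = partial k (egrad f) x.
    by apply: near_eq_derive; exact: open_near Wo Wx E.
  rewrite partial_mxE; last exact: smooth_on_diff segrad Wx.
  by rewrite mxE; congr (partial k _ x); apply/funext => y; rewrite mxE.
rewrite partial_mulmx // mxE [RHS]mxE; congr (_ + _).
  by rewrite !mxE; apply: eq_bigr => j _; rewrite mxE.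
rewrite mxE summxE; apply: eq_bigr => j _.
by rewrite partial_h_sym // [RHS]mxE.
Qed.

(** By total symmetry of dh, contracting D_X h with x amounts to contracting D_x h with X, and D_x h
    vanishes. *)
Let KxT x X : W x -> dirmx X h x *m x^T = 0.
Proof.
move=> Wx; have dh := smooth_on_diff sh Wx.
have hsym y k l : W y -> h y k l = h y l k.
  by move=> /hpos[hs _]; rewrite -{1}hs mxE.
have Es i k l : partial i h x k l = partial i h x l k.
  rewrite !partial_mxE //; apply: (partial_eq_on _ Wo Wx) => y Wy; exact: hsym.
rewrite /dirmx mulmx_suml big1 // => j _; rewrite -scalemxAl.
suff -> : partial j h x *m x^T = 0 by rewrite scaler0.
apply/colP => k; rewrite mxE [RHS]mxE.
have := h_radial Wx => /matrixP/(_ j k); rewrite summxE mxE => {2}<-.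
apply: eq_bigr => l _; rewrite [RHS]mxE mulrC [_^T _ _]mxE.
by congr (_ * _); exact: etrans (Es j k l) (partial_h_sym j l k Wx).
Qed.

(** Differentiating df(x) = 0 along x shows that the Hessian sends x to - df, which vanishes on
    x. *)
Let hessian_bilinear_radial x : W x -> x *m hessian f x *m x^T = 0.
Proof.
move=> Wx; rewrite -mulmxA; have -> : hessian f x *m x^T = - (egrad f x)^T.
  have dg := smooth_on_diff segrad Wx.
  have dx : differentiable (fun y : 'rV[R]_n => y^T) x.
    by apply: differentiable_mx => a b; under eq_fun do rewrite mxE; exact: differentiable_coord.
  apply/colP => k.
  have : partial k (fun y => egrad f y *m y^T) x = 0.
    have -> : partial k (fun y => egrad f y *m y^T) x = partial k (fun=> 0) x.
      by apply: near_eq_derive; exact: open_near Wo Wx f_radial.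
    exact: derive_cst.
  rewrite partial_mulmx // => /matrixP/(_ 0 0); rewrite !mxE.
  have -> : \sum_j egrad f x 0 j * partial k (fun y : 'rV[R]_n => y^T) x j 0 = partial k f x.
    rewrite (bigD1 k) //= big1 ?addr0 => [|j jk]; rewrite partial_mxE //.
      under eq_fun do rewrite mxE; rewrite -/(partial k (fun y : 'rV[R]_n => y 0 k : R) x).
      by rewrite partial_coord eqxx mulr1 mxE.
    under eq_fun do rewrite mxE.
    rewrite -/(partial k (fun y : 'rV[R]_n => y 0 j : R) x) partial_coord.
    by rewrite eq_sym (negPf jk) mulr0.
  move/eqP; rewrite addr_eq0 => /eqP <-.
  apply: eq_bigr => j _; rewrite !mxE partial_mxE //.
  have -> // : (fun y => egrad f y 0 j) = partial j f.
  by apply/funext => y; rewrite mxE.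
rewrite mulmxN; apply/eqP; rewrite oppr_eq0 -(inj_eq (@trmx_inj _ _ _)).
by rewrite trmx_mul trmxK f_radial ?trmx0.
Qed.

(** The coordinate formula is tr D(xi) plus half the logarithmic derivative of det G along xi.
    Second derivatives of the chart enter through [dJxi] only, and the identity xi J = X turns them
    into the ambient derivative of X minus D(xi), so that tr D(xi) cancels. *)
Lemma laplacianE u : U u -> laplacian h phi f u = ambient_laplacian (phi u).
Proof.
move=> Uu; have Wx := phiW Uu; set x := phi u.
have [hs _] := hpos Wx; rewrite -/x in hs.
pose xi := grad h phi f; pose G := gram h phi; pose J := fun v => 'J phi v.
have sJ : smooth_on U J := smooth_on_jacobian Uo sphi.
have sH : smooth_on U (fun v => h (phi v)) := smooth_on_comp_mx Uo Wo sh phiW sphi.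
have dJ := smooth_on_diff sJ Uu; have dH := smooth_on_diff sH Uu.
have dG := smooth_on_diff gram_smooth Uu; have dxi := smooth_on_diff sgrad Uu.
have dJT : differentiable (fun v => (J v)^T) u.
  exact: smooth_on_diff (smooth_on_trmx Uo sJ) Uu.
have dJH : differentiable (fun v => J v *m h (phi v)) u.
  exact: smooth_on_diff (smooth_on_mulmx Uo sJ sH) Uu.
have ddet := smooth_on_diff (smooth_on_det Uo gram_smooth) Uu.
have G0 := Gpos Uu; have Gu := Gunit Uu.
have GT : (invmx (G u))^T = invmx (G u).
  by rewrite trmx_inv; have [-> _] := gram_posdef Uu.
pose Dxi : 'M[R]_m := \matrix_(a, b) partial a xi u 0 b.
pose DXx : 'M[R]_n := \matrix_(k, l) partial k ambient_grad x 0 l.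
pose K := dirmx (ambient_grad x) h x.
have sqrtG : Num.sqrt (\det (G u)) != 0 by rewrite sqrtr_eq0 -ltNge.
(* Product rule and Jacobi's formula; the factor 2^-1 comes from the square root of the
   determinant. *)
have lap1 : laplacian h phi f u =
    \tr Dxi + 2^-1 * \tr (invmx (G u) *m \sum_i xi u 0 i *: partial i G u).
  rewrite /laplacian mulmx_sumr (raddf_sum (@mxtrace R m)) !big_distrr /= -big_split /=.
  apply: eq_bigr => i _.
  have dxii := differentiable_mx_coord 0 i dxi.
  rewrite partialM //; last exact: differentiable_sqrt.
  rewrite partial_sqrt // partial_det_unit // ?gt_eqF // -partial_mxE //.
  have -> : Dxi i i = partial i xi u 0 i by rewrite mxE.
  rewrite -scalemxAr mxtraceZ -/G -/xi.
  have E : \det (G u) = Num.sqrt (\det (G u)) * Num.sqrt (\det (G u)).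
    by rewrite -expr2 sqr_sqrtr // ltW.
  set s := Num.sqrt _ in E sqrtG *; rewrite E.
  by field; rewrite sqrtG.
have dGE i : partial i G u = partial i J u *m h x *m (J u)^T +
    J u *m partial i (fun v => h (phi v)) u *m (J u)^T + J u *m h x *m (partial i J u)^T.
  by rewrite /G /gram partial_mulmx // partial_mulmx // partial_trmx // mulmxDl.
pose dJxi := \sum_i xi u 0 i *: partial i J u.
have dGxi : \sum_i xi u 0 i *: partial i G u =
   dJxi *m h x *m (J u)^T + J u *m K *m (J u)^T + J u *m h x *m dJxi^T.
  under eq_bigr do rewrite dGE !scalerDr; rewrite !big_split /=; congr (_ + _ + _).
  - by rewrite /dJxi !mulmx_suml; apply: eq_bigr => i _; rewrite -!scalemxAl.
  - rewrite /K -(grad_jacobian Uu) -dirmx_sum mulmx_sumr mulmx_suml; apply: eq_bigr => i _.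
    by rewrite -scalemxAr -scalemxAl (partial_comp_mx sphi phiW _ sh).
  - rewrite /dJxi linear_sum mulmx_sumr; apply: eq_bigr => i _.
    by rewrite linearZ /= -scalemxAr.
(* The rows of both sides are the derivatives of [xi *m J = X (phi)], and mixed
   partial derivatives of phi commute. *)
have dJxiE : dJxi = J u *m DXx - Dxi *m J u.
  apply/eqP; rewrite eq_sym subr_eq; apply/eqP/row_matrixP => a.
  have -> : row a (J u *m DXx) = partial a (fun v => xi v *m J v) u.
    have -> : partial a (fun v => xi v *m J v) u = partial a (fun v => ambient_grad (phi v)) u.
      by apply: near_eq_derive; apply: open_near Uo Uu _ => v; exact: grad_jacobian.
    rewrite (partial_comp_mx sphi phiW _ sX Uu); apply/rowP => l.
    by rewrite row_mul mxE summxE; apply: eq_bigr => k _; rewrite !mxE.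
  rewrite partial_mulmx // addrC linearD /= row_mul; congr (_ + _).
    apply/rowP => l; rewrite mxE mxE summxE; apply: eq_bigr => k _.
    by rewrite [RHS]mxE; congr (_ * _); exact: (partial_jacobianC Uo sphi).
  by congr (_ *m _); apply/rowP => b; rewrite !mxE.
(* The two terms of [dGxi] that contain [dJxi] are transposes of each other and contribute equally,
   which absorbs the factor 2^-1. *)
have trT : \tr (invmx (G u) *m (J u *m h x *m dJxi^T)) =
    \tr (invmx (G u) *m (dJxi *m h x *m (J u)^T)).
  by rewrite -mxtrace_tr !trmx_mul trmxK hs GT mxtrace_mulC -!mulmxA.
(* A trace in the chart is a trace against the tangential part of h^-1. *)
have Q A : \tr (invmx (G u) *m (J u *m A *m (J u)^T)) = \tr ((invmx (h x) - x^T *m x) *m A).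
  by rewrite -Qu // -/(J u) -/(G u) mulmxA mxtrace_mulC !mulmxA.
rewrite lap1 dGxi !mulmxDr !mxtraceD trT Q dJxiE.
rewrite !mulmxBl mulmxBr (raddfB (@mxtrace R m)) /= -(mulmxA (J u)) Q DX // -/K.
(* This term cancels the [\tr Dxi] of [lap1]. *)
have -> : \tr (invmx (G u) *m (Dxi *m J u *m h x *m (J u)^T)) = \tr Dxi.
  have -> : Dxi *m J u *m h x *m (J u)^T = Dxi *m G u by rewrite /G /gram !mulmxA.
  by rewrite mxtrace_mulC -mulmxA mulmxV // mulmx1.
rewrite /ambient_laplacian -/K !mulmxBl !mulmxBr -!scalemxAr !(raddfB (@mxtrace R n)) /= mxtraceZ.
have tr0 A : x *m A *m x^T = 0 -> \tr (x^T *m x *m A) = 0.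
  by move=> xA; rewrite -mulmxA mxtrace_mulC xA mxtrace0.
rewrite (tr0 (hessian f x)) ?hessian_bilinear_radial //.
rewrite (tr0 K); last by rewrite -mulmxA KxT ?mulmx0.
by field.
Qed.

End Laplacian.

End InducedOperators.

(** * Indicatrices of Minkowski norms *)

Section Homogeneous.
Variables (R : realType) (n : nat).
Implicit Types (f : 'rV[R]_n -> R) (x : 'rV[R]_n).

Definition punctured : set 'rV[R]_n := [set x | x != 0].

Lemma open_punctured : open punctured.
Proof.
rewrite openE => x /= x0; apply: (@nbhs_normP R 'rV[R]_n x punctured).2.
exists `|x|; first by rewrite /= normr_gt0.
by move=> y /= yx; apply: contraTneq yx => ->; rewrite subr0 ltxx.
Qed.

Lemma punctured_scale (l : R) x : 0 < l -> punctured x -> punctured (l *: x).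
Proof. by move=> l0 x0; rewrite /punctured /= scaler_eq0 negb_or gt_eqF. Qed.

Definition homogeneous (k : nat) f :=
  forall (l : R) x, 0 < l -> x != 0 -> f (l *: x) = l ^+ k * f x.

(** A free constant c in place of a power of l also covers degree -1, the degree of the partial
    derivatives of a function that is constant on rays. *)
Lemma partial_scaling (c l : R) f i x :
  smooth_on punctured f -> 0 < l -> (forall y, y != 0 -> f (l *: y) = c * f y) -> x != 0 ->
  l * partial i f (l *: x) = c * partial i f x.
Proof.
move=> sf l0 hf x0.
have dl : differentiable (fun y : 'rV[R]_n => l *: y) x.
  by apply: differentiable_mx => a b; under eq_fun do rewrite mxE; apply: differentiableM;
    [exact: differentiable_cst|rewrite ord1; exact: differentiable_coord_rV].
have dfl := smooth_on_diff sf (punctured_scale l0 x0).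
have df := smooth_on_diff sf x0.
transitivity (partial i (fun y => f (l *: y)) x).
  rewrite (partial_comp i dl dfl) (bigD1 i) //= big1 ?addr0 => [|j ji].
    under [in RHS]eq_fun do rewrite mxE.
    rewrite partialM; [|exact: differentiable_cst|exact: differentiable_coord_rV].
    by rewrite partial_cst partial_coord eqxx mul0r add0r mulr1.
  under eq_fun do rewrite mxE.
  rewrite partialM; [|exact: differentiable_cst|exact: differentiable_coord_rV].
  by rewrite partial_cst partial_coord eq_sym (negPf ji) mul0r mulr0 addr0 mul0r.
rewrite (partial_eq_on i open_punctured x0 hf).
by rewrite partialM ?partial_cst ?mul0r ?add0r //; exact: differentiable_cst.
Qed.

(** The factor l on the left avoids the exponent k - 1, which is negative for k = 0. *)
Lemma homogeneous_partial k f i (l : R) x :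
  smooth_on punctured f -> homogeneous k f -> 0 < l -> x != 0 ->
  l * partial i f (l *: x) = l ^+ k * partial i f x.
Proof. by move=> sf hf l0 x0; apply: partial_scaling => // y y0; exact: hf. Qed.

Lemma homogeneous_partialS k f i :
  smooth_on punctured f -> homogeneous k.+1 f -> homogeneous k (partial i f).
Proof.
move=> sf hf l x l0 x0; apply: (mulfI (lt0r_neq0 l0)).
by rewrite (homogeneous_partial i sf hf) // exprS mulrA.
Qed.

(** Differentiate l |-> f (l x) at l = 1. The line is based at 0, so that its parameter is the
    scaling factor. *)
Lemma euler k f x : smooth_on punctured f -> homogeneous k f -> x != 0 ->
  egrad f x *m x^T = (k%:R * f x)%:M.
Proof.
move=> sf hf x0; have df := smooth_on_diff sf x0.
apply/matrixP => a b; rewrite !ord1 !mxE eqxx mulr1n.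
transitivity ('D_x f x).
  by rewrite derive_sum_partial //; apply: eq_bigr => i _; rewrite !mxE mulrC.
have d1 : differentiable f (0 + 1 *: x) by rewrite add0r scale1r.
have := is_derive_line d1; rewrite add0r scale1r => -[_ <-].
rewrite (@near_eq_derive _ _ _ _ (fun l : R => l ^+ k * f x)); last first.
  near=> l; rewrite add0r; apply: hf => //; near: l.
  by apply: lt_nbhsr; exact: ltr01.
rewrite deriveMr; last exact: exprn_derivable.
case: k {hf} => [|k]; first by rewrite derive_cst /GRing.scale /= mulr0 mul0r.
by rewrite exp_derive expr1n /GRing.scale /= !mulr1 mulrC.
Unshelve. all: by end_near. Qed.

Lemma smooth_hessian f : smooth_on punctured f -> smooth_on punctured (hessian f).
Proof.
move=> sf; apply/(smooth_on_mxP open_punctured) => i j; under eq_fun do rewrite mxE.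
by do 2 apply: smooth_on_partial.
Qed.

Lemma smooth_egrad f : smooth_on punctured f -> smooth_on punctured (egrad f).
Proof.
move=> sf; apply/(smooth_on_mxP open_punctured) => i j; under eq_fun do rewrite mxE.
exact: smooth_on_partial.
Qed.

Lemma partial_hessianE f x i j k : smooth_on punctured f -> x != 0 ->
  partial i (hessian f) x j k = partial i (partial j (partial k f)) x.
Proof.
move=> sf x0; rewrite partial_mxE; last exact: smooth_on_diff (smooth_hessian sf) x0.
by apply: partial_eq_on open_punctured x0 _ => y _; rewrite mxE.
Qed.

Lemma partial_hessian_sym f x i j k : smooth_on punctured f -> x != 0 ->
  partial i (hessian f) x j k = partial j (hessian f) x i k.
Proof.
move=> sf x0; transitivity (partial i (partial j (partial k f)) x).
  exact: partial_hessianE.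
rewrite (partialC i j open_punctured (smooth_on_partial k sf) x0).
by symmetry; exact: partial_hessianE.
Qed.

Lemma hessian_egrad f x : smooth_on punctured f -> homogeneous 2 f -> x != 0 ->
  x *m hessian f x = egrad f x.
Proof.
move=> sf hf x0; apply/rowP => j; rewrite mxE mxE.
have := euler (smooth_on_partial j sf) (homogeneous_partialS j sf hf) x0.
move=> /matrixP/(_ 0 0); rewrite !mxE eqxx mulr1n mul1r => <-.
by apply: eq_bigr => i _; rewrite !mxE mulrC.
Qed.

Lemma hessian_radial f x : smooth_on punctured f -> homogeneous 2 f -> x != 0 ->
  dirmx x (hessian f) x = 0.
Proof.
move=> sf hf x0; apply/matrixP => j k; rewrite summxE [RHS]mxE.
have hk := homogeneous_partialS j (smooth_on_partial k sf) (homogeneous_partialS k sf hf).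
have := euler (smooth_on_partial j (smooth_on_partial k sf)) hk x0.
move=> /matrixP/(_ 0 0); rewrite !mxE eqxx mulr1n mul0r => {2}<-.
by apply: eq_bigr => i _; rewrite !mxE partial_hessianE // mulrC.
Qed.

End Homogeneous.

(** * Charts of indicatrices; the sphere as the Euclidean indicatrix *)

Section Indicatrix.
Variables (R : realType) (m : nat).
Local Notation n := m.+1.
Implicit Types (F N : 'rV[R]_n -> R) (x : 'rV[R]_n).

Let W0 := @punctured R n.

Lemma smooth_energy F : minkowski_norm F -> smooth_on W0 (energy F).
Proof.
move=> mF; apply: (smooth_onM (@open_punctured R n)); last exact: smooth_on_cst.
by apply: (smooth_onX (@open_punctured R n)); exact: mn_smooth mF.
Qed.

Lemma energy_homog F : minkowski_norm F -> homogeneous 2 (energy F).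
Proof.
by move=> mF l x l0 x0; rewrite /energy (mn_homog mF) ?ltW // exprMn mulrA.
Qed.

Lemma indicatrix_punctured F x : minkowski_norm F -> indicatrix F x -> W0 x.
Proof.
move=> mF Fx; apply/eqP => x0; move: Fx; rewrite /indicatrix /= x0.
by rewrite -(scale0r (0 : 'rV[R]_n)) (mn_homog mF) // mul0r => /eqP; rewrite eq_sym oner_eq0.
Qed.

Lemma indicatrix_scale F x : minkowski_norm F -> x != 0 -> indicatrix F ((F x)^-1 *: x).
Proof.
move=> mF x0; have Fx := mn_gt0 mF x0.
by rewrite /indicatrix /= (mn_homog mF) ?invr_ge0 ?ltW // mulVf ?gt_eqF.
Qed.

Section Chart.
Variables (F : 'rV[R]_n -> R) (U : set 'rV[R]_m) (phi : 'rV[R]_m -> 'rV[R]_n).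
Hypotheses (mF : minkowski_norm F) (lp : local_param (indicatrix F) U phi).
Let h := hessian_metric F.
Let Uo := lp_open lp.
Let sphi := lp_smooth lp.

Lemma chart_indicatrix u : U u -> F (phi u) = 1.
Proof. by move=> Uu; apply: (lp_sub lp); exists u. Qed.

Lemma chart_punctured u : U u -> W0 (phi u).
Proof. by move=> /chart_indicatrix; exact: indicatrix_punctured. Qed.

(** Euler's identity used twice gives h (x, x) = dE (x) = 2 E (x), and E is 1/2 on the
    indicatrix. *)
Lemma chart_unit u : U u -> phi u *m h (phi u) *m (phi u)^T = 1%:M.
Proof.
move=> Uu; have x0 := chart_punctured Uu.
rewrite hessian_egrad //; [|exact: smooth_energy|exact: energy_homog].
rewrite (euler (smooth_energy mF) (energy_homog mF) x0) /energy chart_indicatrix //.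
by congr (_%:M); field.
Qed.

(** Contracting h with x gives dE, and E is constant along the chart. *)
Lemma chart_normal u : U u -> 'J phi u *m h (phi u) *m (phi u)^T = 0.
Proof.
move=> Uu; have x0 := chart_punctured Uu; have sE := smooth_energy mF.
have hT : (h (phi u))^T = h (phi u) by have [] := mn_convex mF x0.
apply: trmx_inj; rewrite !trmx_mul trmxK hT mulmxA.
rewrite hessian_egrad //; last exact: energy_homog.
rewrite -(differentialE sphi chart_punctured sE Uu) trmx0.
apply/rowP => i; rewrite !mxE.
rewrite (@partial_eq_on _ _ _ i _ (fun=> 2^-1) _ Uo Uu) ?partial_cst //.
by move=> v Uv; rewrite /= /energy chart_indicatrix // expr1n mul1r.
Qed.

Let smooth_h : smooth_on W0 h.
Proof. exact/smooth_hessian/smooth_energy. Qed.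

Lemma chart_gram : smooth_on U (gram h phi) /\ forall u, U u -> posdefmx (gram h phi u).
Proof.
split=> [|u Uu].
  exact: (gram_smooth Uo (@open_punctured R n) sphi chart_punctured smooth_h).
exact: (gram_posdef chart_punctured (lp_immersion lp) (mn_convex mF) Uu).
Qed.

Variable f : 'rV[R]_n -> R.
Hypotheses (sf : smooth_on W0 f) (hf : homogeneous 0 f).

Let f_radial x : W0 x -> egrad f x *m x^T = 0.
Proof. by move=> x0; rewrite (euler sf hf) // mul0r raddf0. Qed.

Lemma chart_grad_sqnorm u : U u ->
  grad_sqnorm h phi f u = (ambient_grad h f (phi u) *m (egrad f (phi u))^T) 0 0.
Proof.
move=> Uu.
by apply: (grad_sqnormE (W := W0) (U := U)) => //;
  [exact: chart_punctured|exact: (lp_immersion lp)|exact: (mn_convex mF)|exact: chart_normal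
  |exact: chart_unit].
Qed.

Lemma chart_laplacian u : U u -> laplacian h phi f u = ambient_laplacian h f (phi u).
Proof.
move=> Uu.
apply: (laplacianE Uo (@open_punctured R n) sphi chart_punctured (lp_immersion lp) smooth_h
  (mn_convex mF) _ _ sf f_radial chart_normal chart_unit) => //.
  by move=> x i j k x0; apply: partial_hessian_sym => //; exact: smooth_energy.
by move=> x x0; apply: hessian_radial => //; [exact: smooth_energy|exact: energy_homog].
Qed.

End Chart.

(** Only values on S enter. This lets the flat metric and the given function on the sphere be
    exchanged for the Euclidean Hessian metric and the extension that is constant on rays. *)
Lemma grad_sqnorm_eq (S : set 'rV[R]_n) (U : set 'rV[R]_m) phi g g' (f f' : 'rV[R]_n -> R) u :
  local_param S U phi -> U u -> (forall x, S x -> g x = g' x) -> (forall x, S x -> f x = f' x) ->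
  grad_sqnorm g phi f u = grad_sqnorm g' phi f' u.
Proof.
move=> lp Uu gg' ff'; have SU v : U v -> S (phi v) by move=> Uv; apply: (lp_sub lp); exists v.
have -> : grad_sqnorm g phi f u = grad_sqnorm g' phi f u.
  by rewrite /grad_sqnorm /grad /gram gg' //; exact: SU.
have dE : differential phi f u = differential phi f' u.
  apply/rowP => i; rewrite !mxE.
  by apply: partial_eq_on (lp_open lp) Uu _ => v Uv; apply: ff'; exact: SU.
by rewrite /grad_sqnorm /grad dE.
Qed.

Lemma laplacian_eq (S : set 'rV[R]_n) (U : set 'rV[R]_m) phi g g' (f f' : 'rV[R]_n -> R) u :
  local_param S U phi -> U u -> (forall x, S x -> g x = g' x) -> (forall x, S x -> f x = f' x) ->
  laplacian g phi f u = laplacian g' phi f' u.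
Proof.
move=> lp Uu gg' ff'; have SU v : U v -> S (phi v) by move=> Uv; apply: (lp_sub lp); exists v.
have gE v : U v -> gram g phi v = gram g' phi v by move=> Uv; rewrite /gram gg' //; exact: SU.
have dE v : U v -> differential phi f v = differential phi f' v.
  move=> Uv; apply/rowP => i; rewrite !mxE.
  by apply: partial_eq_on (lp_open lp) Uv _ => w Uw; apply: ff'; exact: SU.
rewrite /laplacian (gE u Uu).
apply: (congr1 (fun z => _ * z)); apply: eq_bigr => i _.
by apply: partial_eq_on (lp_open lp) Uu _ => v Uv; rewrite /grad gE // dE.
Qed.

Lemma smooth_radial N : minkowski_norm N -> smooth_on W0 (fun x => (N x)^-1 *: x).
Proof.
move=> mN; have W0o := @open_punctured R n.
apply: (smooth_on_scalemx W0o); last exact: smooth_on_id.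
apply: (smooth_onV W0o); last exact: mn_smooth mN.
by move=> x x0; rewrite gt_eqF // (mn_gt0 mN).
Qed.

(** Radial projection between two indicatrices. It makes the indicatrix of a Minkowski norm a
    submanifold, starting from the sphere, and in the other direction carries its charts to the
    sphere over the same parameter domain. *)
Lemma local_param_radial F N U (phi : 'rV[R]_m -> 'rV[R]_n) :
  minkowski_norm F -> minkowski_norm N -> local_param (indicatrix F) U phi ->
  local_param (indicatrix N) U (fun u => (N (phi u))^-1 *: phi u).
Proof.
move=> mF mN lp; have W0o := @open_punctured R n.
have Uo := lp_open lp; have sphi := lp_smooth lp.
have p0 : forall u, U u -> W0 (phi u) := chart_punctured mF lp.
have N0 u : U u -> 0 < N (phi u) by move=> /p0; exact: mn_gt0.
pose c u := (N (phi u))^-1.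
have c0 u : U u -> 0 < c u by move=> /N0; rewrite invr_gt0.
have Fc u : U u -> F (c u *: phi u) = c u.
  by move=> Uu; rewrite (mn_homog mF) ?ltW ?c0 // (chart_indicatrix lp) // mulr1.
have sc : smooth_on U c.
  apply: (smooth_onV Uo) => [u Uu|]; first by rewrite gt_eqF ?N0.
  by apply: (smooth_on_comp Uo (mn_smooth mN) p0); exact/(smooth_on_mxP Uo _).1.
have sphi' := smooth_on_scalemx Uo sc sphi.
split => //.
- by move=> _ [u Uu <-]; apply: indicatrix_scale => //; exact: p0.
- move=> u Uu; apply/inj_row_free => v vJ.
  have dc := smooth_on_diff sc Uu; have dphi := smooth_on_diff sphi Uu.
  have JE : 'J (fun u => c u *: phi u) u =
      c u *: 'J phi u + (\row_i partial i c u)^T *m phi u.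
    apply/matrixP => i j; rewrite jacobian_partial; last exact: smooth_on_diff sphi' Uu.
    under eq_fun do rewrite mxE.
    rewrite partialM //; last exact: differentiable_mx_coord.
    rewrite [RHS]mxE [LHS]addrC; congr (_ + _).
      by rewrite -(jacobian_partial i j dphi) [RHS]mxE.
    by rewrite mxE big_ord1 !mxE.
  have := vJ; rewrite -/c JE mulmxDr -scalemxAr mulmxA.
  (* Pairing with h x kills the tangential part and isolates the radial coefficient, which must
     therefore vanish. *)
  move=> E; have := congr1 (mulmx^~ (hessian_metric F (phi u) *m (phi u)^T)) E.
  rewrite mulmxDl -scalemxAl -!mulmxA (mulmxA ('J phi u)) (chart_normal mF lp Uu).
  rewrite (mulmxA (phi u)) (chart_unit mF lp Uu) mulmx0 scaler0 add0r mulmx1 mul0mx => E'.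
  move: E; rewrite -mulmxA mulmxA E' mul0mx addr0 => /eqP.
  rewrite scaler_eq0 gt_eqF ?c0 //= => /eqP vJ0.
  by apply: (row_free_inj (lp_immersion lp Uu)); rewrite vJ0 mul0mx.
(* On the image F returns the scaling factor, so equal image points have equal factors. *)
- move=> u v Uu Uv E; apply: (lp_inj lp) => //.
  have := congr1 F E; rewrite -/(c u) -/(c v) !Fc // => cE.
  move: E; rewrite -/(c u) -/(c v) cE => /(scalerI _); apply.
  by rewrite gt_eqF ?c0.
move=> V Vo VU; have [W Wo WE] := lp_open_map lp Vo VU.
(* The preimage of [W] under the inverse projection, which is continuous away from 0. *)
exists [set x | W0 x /\ W ((F x)^-1 *: x)].
  rewrite openE => x [x0 Wx]; have dx := smooth_on_diff (smooth_radial mF) x0.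
  have cx := differentiable_continuous dx.
  have n1 : nbhs x W0 by apply: open_nbhs_nbhs.
  have n2 : nbhs x [set y | W ((F y)^-1 *: y)].
    by apply: cx; apply: open_nbhs_nbhs.
  exact: filterI n1 n2.
rewrite eqEsubset; split=> [_ [u Vu <-]|x [Nx [x0 Wx]]].
  have Uu := VU _ Vu; split; first by apply: indicatrix_scale => //; exact: p0.
  split; first by apply: punctured_scale; [exact: c0|exact: p0].
  rewrite -/(c u) Fc // scalerA mulVf ?gt_eqF ?c0 // scale1r.
  by have : (phi @` V) (phi u) by [exists u]; rewrite WE => -[].
have : (phi @` V) ((F x)^-1 *: x).
  by rewrite WE; split => //; exact: indicatrix_scale.
have Fx := mn_gt0 mF x0.
move=> [u Vu phiu]; exists u => //; rewrite phiu (mn_homog mN) ?invr_ge0 ?ltW //.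
have -> : N x = 1 by [].
by rewrite mulr1 invrK scalerA mulfV ?gt_eqF // scale1r.
Qed.

Definition enorm (x : 'rV[R]_n) : R := Num.sqrt (dot x x).

Lemma dotE x y : dot x y = \sum_i x 0 i * y 0 i.
Proof. exact: dot_sum. Qed.

Lemma dot_xx_gt0 x : x != 0 -> 0 < dot x x.
Proof. exact: dot_gt0. Qed.

Lemma dot_xx_ge0 x : 0 <= dot x x.
Proof.
by have [->|/dot_xx_gt0/ltW//] := eqVneq x 0; rewrite /dot mul0mx mxE.
Qed.

Lemma smooth_dot U : open U -> smooth_on U (fun x => dot x x).
Proof.
move=> Uo; under eq_fun do rewrite dotE.
by apply: (smooth_on_sum Uo) => i _; apply: (smooth_onM Uo); exact: smooth_on_coord.
Qed.

Lemma hessian_enorm x : x != 0 -> hessian_metric enorm x = 1%:M.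
Proof.
move=> x0; apply/matrixP => i j; rewrite !mxE.
have E y : energy enorm y = (\sum_i y 0 i * y 0 i) / 2.
  by rewrite /energy /enorm sqr_sqrtr ?dot_xx_ge0 // dotE.
have pE y : partial j (energy enorm) y = y 0 j.
  rewrite (_ : energy enorm = fun y => (\sum_i y 0 i * y 0 i) / 2); last exact/funext.
  have dM k : differentiable (fun z : 'rV[R]_n => z 0 k * z 0 k) y.
    by apply: differentiableM; exact: differentiable_coord_rV.
  rewrite partialM; [|exact: differentiable_sumf|exact: differentiable_cst].
  rewrite partial_cst mulr0 addr0 partial_sum // (bigD1 j) //= big1 ?addr0 => [|k kj].
    rewrite partialM; try exact: differentiable_coord_rV.
    by rewrite partial_coord eqxx /=; field.
  rewrite partialM; try exact: differentiable_coord_rV.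
  by rewrite partial_coord eq_sym (negPf kj) mul0r mulr0 addr0.
by rewrite (_ : partial j (energy enorm) = fun y => y 0 j) ?partial_coord //; apply/funext.
Qed.

Lemma minkowski_enorm : minkowski_norm enorm.
Proof.
split.
- move=> x; apply: continuous_comp; last exact: sqrt_continuous.
  apply/differentiable_continuous.
  exact: smooth_on_diff (smooth_dot openT) (I : setT x).
- by move=> x; rewrite sqrtr_ge0.
- by move=> x x0; rewrite sqrtr_gt0 dot_xx_gt0.
- have W0o := @open_punctured R n.
  by apply: (smooth_on_sqrt W0o (@dot_xx_gt0)); exact: smooth_dot.
- move=> l x l0; rewrite /enorm /dot linearZ /= -scalemxAl -scalemxAr scalerA mxE.
  by rewrite sqrtrM ?mulr_ge0 // -expr2 sqrtr_sqr ger0_norm.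
- move=> x x0; rewrite hessian_enorm //; split; first exact: trmx1.
  by move=> v v0; rewrite mulmx1; exact: dot_gt0.
Qed.

Lemma sphere_indicatrix : @sphere R n = indicatrix enorm.
Proof.
rewrite eqEsubset; split=> x; rewrite /sphere /indicatrix /enorm /=.
  by move=> ->; rewrite sqrtr1.
by move=> /(congr1 (fun z => z ^+ 2)); rewrite sqr_sqrtr ?dot_xx_ge0 // expr1n.
Qed.

Lemma sphere_enorm x : sphere x -> enorm x = 1.
Proof. by rewrite sphere_indicatrix. Qed.

Lemma enorm_gt0 x : x != 0 -> 0 < enorm x.
Proof. exact: (mn_gt0 minkowski_enorm). Qed.

Lemma sqr_enorm x : enorm x ^+ 2 = dot x x.
Proof. by rewrite sqr_sqrtr ?dot_xx_ge0. Qed.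

End Indicatrix.

(** * Functions that are constant on the leaves *)

Section OneVariable.
Variable R : realType.

Lemma is_derive_linear_approx (g : R -> R) (c e : R) : is_derive (0 : R) 1 g c -> 0 < e ->
  exists2 r : R, 0 < r & forall t, `|t| < r -> `|g t - g 0 - c * t| <= e * `|t|.
Proof.
move=> [dg <-] e0; have dd : differentiable g 0 by exact/derivable1_diffP.
have [_ /eqaddoP go] := (diff_locallyP (0 : R) g).1 dd.
have /nbhs_normP[r /= r0 rP] := go e e0.
exists r => // t tr; have := rP t; rewrite /= sub0r normrN => /(_ tr).
rewrite !fctE /= addr0 opprD addrA; congr (`|_ - _| <= _).
by rewrite -[in LHS](mulr1 t) linearZ /= -deriveE // mulrC.
Qed.

(** Parameters a and b with g1 a = g2 b satisfy b = a + o(a), because both functions have the slope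
    c. Since u1 a = u2 b at such pairs, the slopes of u1 and u2 agree. The intermediate value
    theorem supplies b, so no inverse function is constructed. *)
Lemma derive_along_levels (g1 g2 u1 u2 : R -> R) (c d1 d2 r : R) :
  is_derive (0 : R) 1 g1 c -> is_derive (0 : R) 1 g2 c -> c != 0 -> g1 0 = g2 0 ->
  is_derive (0 : R) 1 u1 d1 -> is_derive (0 : R) 1 u2 d2 -> 0 < r ->
  (forall t, `|t| < r -> derivable g2 t 1) ->
  (forall a b, `|a| < r -> `|b| < r -> g1 a = g2 b -> u1 a = u2 b) -> d1 = d2.
Proof.
wlog c0 : g1 g2 c / 0 < c.
  move=> H dg1 dg2 c_neq0 g0 du1 du2 r0 dr lev.
  have [cpos|cneg|ceq] := ltgtP c 0; last by rewrite ceq eqxx in c_neq0.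
    apply: (H (fun t => - g1 t) (fun t => - g2 t) (- c)); rewrite ?oppr_gt0 ?oppr_eq0 ?g0 //.
      by move=> t tr; apply: derivableN; exact: dr.
    by move=> a b ar br /oppr_inj; exact: lev.
  exact: (H g1 g2 c).
move=> dg1 dg2 c_neq0 g0 du1 du2 r0 dr lev.
have u0 : u1 0 = u2 0 by apply: lev; rewrite ?normr0.
(* The 3 collects the errors of [u1] at a and of [u2] at b <= 2 a; the other term comes from |b - a|
   <= e a. *)
suff H e : 0 < e -> e <= 2^-1 -> `|d1 - d2| <= e * (3 + `|d2|).
  apply/eqP; rewrite -subr_eq0 -normr_le0; apply/ler_addgt0Pl => e e0.
  have K0 : 0 < 3 + `|d2| by rewrite ltr_pwDl.
  have m0 : 0 < Num.min (e / (3 + `|d2|)) 2^-1 by rewrite lt_min divr_gt0 // invr_gt0 ltr0n.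
  apply: le_trans (H _ m0 _) _; first by rewrite ge_min lexx orbT.
  by rewrite addr0 -ler_pdivlMr // ge_min lexx.
(* With this tolerance the approximation errors at a and at a - e a, a + e a stay below the gap c e
   a, so g1 a lies between the values of [g2] at the last two points. *)
move=> e0 e1; pose eta := c * e / 4.
have eta0 : 0 < eta by rewrite divr_gt0 // mulr_gt0.
have [r1 r10 P1] := is_derive_linear_approx dg1 eta0.
have [r2 r20 P2] := is_derive_linear_approx dg2 eta0.
have [r3 r30 P3] := is_derive_linear_approx du1 e0.
have [r4 r40 P4] := is_derive_linear_approx du2 e0.
pose s := Num.min r (Num.min (Num.min r1 r2) (Num.min r3 r4)).
have s0 : 0 < s by rewrite !lt_min r0 r10 r20 r30 r40.
pose a := s / 4; have a0 : 0 < a by rewrite divr_gt0.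
have as_ : 2 * a < s by rewrite /a; lra.
have small b : 0 <= b <= 2 * a -> [/\ `|b| < r, `|b| < r1, `|b| < r2, `|b| < r3 & `|b| < r4].
  move=> /andP[b0 b2]; rewrite ger0_norm //; have := le_lt_trans b2 as_.
  by rewrite !lt_min => /andP[-> /andP[/andP[-> ->] /andP[-> ->]]].
have ea : 0 < e * a by rewrite mulr_gt0.
have ea2 : e * a <= a / 2 by rewrite mulrC ler_pM2l.
have ha : 0 <= a <= 2 * a by lra.
have hl : 0 <= a - e * a <= 2 * a by lra.
have hr : 0 <= a + e * a <= 2 * a by lra.
have [ar ar1 _ ar3 _] := small _ ha.
have [_ _ lr2 _ _] := small _ hl; have [_ _ rr2 _ _] := small _ hr.
have A1 := P1 _ ar1; have A2 := P2 _ lr2; have A3 := P2 _ rr2.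
rewrite (gtr0_norm a0) g0 in A1.
have al0 : 0 <= a - e * a by case/andP: hl.
have ar0 : 0 <= a + e * a by case/andP: hr.
rewrite (ger0_norm al0) in A2; rewrite (ger0_norm ar0) in A3.
have [|||b] := @IVT R g2 (a - e * a) (a + e * a) (g1 a).
- lra.
- apply: derivable_within_continuous => t; rewrite in_itv /= => /andP[t1 t2].
  apply: dr; have [] // := small t; lra.
- move: A1 A2 A3; rewrite !ler_norml => /andP[A11 A12] /andP[A21 A22] /andP[A31 A32].
  have cea : 0 < c * (e * a) by rewrite mulr_gt0.
  have Ee : eta * a = c * (e * a) / 4 by rewrite /eta; field.
  have Ee2 : eta * (e * a) <= c * (e * a) / 8.
    rewrite (_ : eta * (e * a) = c * (e * a) / 4 * e); last by rewrite /eta; field.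
    rewrite (_ : c * (e * a) / 8 = c * (e * a) / 4 / 2); last by field.
    by rewrite ler_pM2l // divr_gt0.
  have ee0 : 0 < eta * (e * a) by rewrite mulr_gt0.
  have lo : g2 (a - e * a) <= g1 a by nra.
  have hi : g1 a <= g2 (a + e * a) by nra.
  by rewrite ge_min lo le_max hi orbT.
rewrite in_itv /= => /andP[b1 b2] gb.
have hb : 0 <= b <= 2 * a by lra.
have b0 : 0 <= b by case/andP: hb.
have [br _ _ _ br4] := small _ hb.
have uab := lev _ _ ar br (esym gb).
have B1 := P3 _ ar3; have B2 := P4 _ br4.
rewrite (gtr0_norm a0) uab u0 in B1; rewrite (ger0_norm b0) in B2.
have D1 : `|d1 * a - d2 * b| <= 3 * (e * a).
  move: B1 B2; rewrite !ler_norml => /andP[B11 B12] /andP[B21 B22].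
  have eb : e * b <= 2 * (e * a) by rewrite mulrCA ler_pM2l //; lra.
  by apply/andP; split; lra.
have D2 : `|d2 * b - d2 * a| <= `|d2| * (e * a).
  rewrite -mulrBr normrM ler_wpM2l // ler_norml; lra.
rewrite -(ler_pM2r a0) -{1}(gtr0_norm a0) -normrM mulrBl.
rewrite -(subrKA (d2 * b)); apply: le_trans (ler_normD _ _) _.
by apply: le_trans (lerD D1 D2) _; rewrite -mulrDl mulrAC mulrC mulrA.
Qed.

End OneVariable.

(** * Functions of |x| and p, and their gradients *)

Section InvariantClass.
Variables (R : realType) (m : nat).
Local Notation n := m.+1.
Variable p : 'rV[R]_n -> R.
Let W0 := @punctured R n.
Hypotheses (sp : smooth_on W0 p) (hp : homogeneous 0 p).

Definition regular_cone : set 'rV[R]_n := [set x | x != 0 /\ -1 < p x < 1].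
Local Notation Om := regular_cone.
Local Notation P := (egrad p).
Local Notation B := (hessian p).

Definition same_leaf (x y : 'rV[R]_n) : Prop :=
  [/\ Om x, Om y, dot x x = dot y y & p x = p y].

Hypothesis normP_leaf : forall x y, same_leaf x y -> dot (P x) (P x) = dot (P y) (P y).
Hypothesis trB_leaf : forall x y, same_leaf x y -> \tr (B x) = \tr (B y).
Hypothesis P_neq0 : forall x, Om x -> P x != 0.

Lemma regular_cone_punctured x : Om x -> W0 x. Proof. by case. Qed.

Lemma open_regular_cone : open Om.
Proof.
rewrite openE => x [x0 /andP[px1 px2]].
have cp : {for x, continuous p} by apply: differentiable_continuous; exact: (smooth_on_diff sp).
have n1 : nbhs x W0 by apply: open_nbhs_nbhs; split => //; exact: open_punctured.
have n2 : nbhs x [set y | -1 < p y] by apply: (cp [set z | -1 < z]); exact: lt_nbhsr.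
have n3 : nbhs x [set y | p y < 1] by apply: (cp [set z | z < 1]); exact: lt_nbhsl.
apply: filterS (filterI n1 (filterI n2 n3)) => y [y0 [y1 y2]]; split => //.
by apply/andP.
Qed.
Let Oo := open_regular_cone.

Lemma dotC (x y : 'rV[R]_n) : dot x y = dot y x.
Proof. by rewrite !dotE; apply: eq_bigr => i _; rewrite mulrC. Qed.

Lemma dotDl (x y z : 'rV[R]_n) : dot (x + y) z = dot x z + dot y z.
Proof. by rewrite /dot mulmxDl mxE. Qed.

Lemma dotZl (l : R) (x y : 'rV[R]_n) : dot (l *: x) y = l * dot x y.
Proof. by rewrite /dot -scalemxAl mxE. Qed.

Lemma dotDr (x y z : 'rV[R]_n) : dot z (x + y) = dot z x + dot z y.
Proof. by rewrite dotC dotDl !(dotC z). Qed.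

Lemma dotZr (l : R) (x y : 'rV[R]_n) : dot y (l *: x) = l * dot y x.
Proof. by rewrite dotC dotZl dotC. Qed.

Lemma dot_scalar (x y : 'rV[R]_n) : x *m y^T = (dot x y)%:M.
Proof. by apply/matrixP => i j; rewrite !ord1 [RHS]mxE eqxx mulr1n. Qed.

Lemma derive_dot (f : 'rV[R]_n -> R) x v : differentiable f x -> 'D_v f x = dot v (egrad f x).
Proof. by move=> df; rewrite derive_sum_partial // dotE; apply: eq_bigr => i _; rewrite mxE. Qed.

Lemma dirmx_eq_on (U : set 'rV[R]_n) (a b : nat) (X : 'rV[R]_n) (f g : 'rV[R]_n -> 'M[R]_(a, b)) x :
  open U -> U x -> (forall y, U y -> f y = g y) -> dirmx X f x = dirmx X g x.
Proof.
move=> Uo Ux fg; apply: eq_bigr => i _; congr (_ *: _).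
by apply: near_eq_derive; exact: open_near Uo Ux fg.
Qed.

Lemma dot_xP x : W0 x -> dot x (P x) = 0.
Proof. by move=> x0; rewrite dotC /dot (euler sp hp) // mul0r !mxE mul0rn. Qed.

Lemma regular_cone_scale l x : 0 < l -> Om x -> Om (l *: x).
Proof.
move=> l0 [x0 px]; split; first exact: punctured_scale.
by rewrite hp // expr0 mul1r.
Qed.

Definition invariant (u : 'rV[R]_n -> R) : Prop :=
  smooth_on Om u /\ forall x y, same_leaf x y -> u x = u y.

Lemma invariant_ext u v : (forall x, Om x -> u x = v x) -> invariant u -> invariant v.
Proof.
move=> uv [su iu]; split; first by apply: (@smooth_on_ext _ _ _ Oo u v).
by move=> x y xy; have [Ox Oy _ _] := xy; rewrite -!uv //; exact: iu.
Qed.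

Lemma invariant_cst c : invariant (fun=> c).
Proof. by split => //; exact: smooth_on_cst. Qed.

Lemma invariantD u v : invariant u -> invariant v -> invariant (fun x => u x + v x).
Proof.
move=> [su iu] [sv iv]; split; first exact: smooth_onD.
by move=> x y xy; rewrite (iu _ _ xy) (iv _ _ xy).
Qed.

Lemma invariantM u v : invariant u -> invariant v -> invariant (fun x => u x * v x).
Proof.
move=> [su iu] [sv iv]; split; first exact: smooth_onM.
by move=> x y xy; rewrite (iu _ _ xy) (iv _ _ xy).
Qed.

Lemma invariantN u : invariant u -> invariant (fun x => - u x).
Proof.
move=> iu; apply: (invariant_ext _ (invariantM (invariant_cst (-1)) iu)).
by move=> x _; rewrite mulN1r.
Qed.

Lemma invariantV u : (forall x, Om x -> u x != 0) -> invariant u -> invariant (fun x => (u x)^-1).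
Proof.
move=> u0 [su iu]; split; first exact: smooth_onV.
by move=> x y xy; rewrite (iu _ _ xy).
Qed.

Lemma invariant_dotxx : invariant (fun x => dot x x).
Proof. by split=> [|x y []//]; exact: smooth_dot. Qed.

Let smooth_sub (V : normedModType R) (f : 'rV[R]_n -> V) : smooth_on W0 f -> smooth_on Om f.
Proof. exact: smooth_on_sub regular_cone_punctured. Qed.

Lemma smooth_on_dot (f g : 'rV[R]_n -> 'rV[R]_n) : smooth_on Om f -> smooth_on Om g ->
  smooth_on Om (fun x => dot (f x) (g x)).
Proof.
move=> sf sg; have := smooth_on_mulmx Oo sf (smooth_on_trmx Oo sg).
by move/(smooth_on_mxP Oo) => /(_ 0 0).
Qed.

Lemma smooth_on_egrad u : smooth_on Om u -> smooth_on Om (egrad u).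
Proof.
move=> su; apply/(smooth_on_mxP Oo) => i j; under eq_fun do rewrite mxE.
exact: smooth_on_partial.
Qed.

Let sP : smooth_on Om P. Proof. exact/smooth_on_egrad/smooth_sub. Qed.
Let sB : smooth_on Om B. Proof. exact/smooth_sub/smooth_hessian. Qed.

Lemma invariant_normP : invariant (fun x => dot (P x) (P x)).
Proof. by split=> [|x y]; [exact: smooth_on_dot|exact: normP_leaf]. Qed.

Lemma normP_neq0 x : Om x -> dot (P x) (P x) != 0.
Proof. by move=> Ox; rewrite gt_eqF // dot_xx_gt0 // P_neq0. Qed.

(** Scaling both points by one factor keeps them on a common leaf, so u takes the same values along
    the two rays. *)
Lemma invariant_radial u : invariant u -> invariant (fun x => dot x (egrad u x)).
Proof.
move=> [su iu]; split; first by apply: smooth_on_dot; [exact: smooth_on_id|exact: smooth_on_egrad].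
move=> x y xy; have [Ox Oy dxy pxy] := xy.
have dx : differentiable u (x + 0 *: x) by rewrite scale0r addr0; exact: smooth_on_diff su Ox.
have dy : differentiable u (y + 0 *: y) by rewrite scale0r addr0; exact: smooth_on_diff su Oy.
have [_ Ex] := is_derive_line dx; have [_ Ey] := is_derive_line dy.
rewrite scale0r addr0 derive_dot in Ex; last exact: smooth_on_diff su Ox.
rewrite scale0r addr0 derive_dot in Ey; last exact: smooth_on_diff su Oy.
rewrite -Ex -Ey; apply: near_eq_derive; near=> t.
have t1 : 0 < 1 + t.
  rewrite -ltrBlDl sub0r; near: t; apply: lt_nbhsr; rewrite oppr_lt0; exact: ltr01.
have E (z : 'rV[R]_n) : z + t *: z = (1 + t) *: z by rewrite scalerDl scale1r.
rewrite !E; apply: iu; split; [exact: regular_cone_scale|exact: regular_cone_scale| |].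
  by rewrite !dotZl !dotZr dxy.
by rewrite !hp // ?expr0 ?pxy //; [case: Oy|case: Ox].
Unshelve. all: by end_near. Qed.

Lemma partial_dotxx i (x : 'rV[R]_n) : partial i (fun y => dot y y) x = 2 * x 0 i.
Proof.
have dM k : differentiable (fun z : 'rV[R]_n => z 0 k * z 0 k) x.
  by apply: differentiableM; exact: differentiable_coord_rV.
under eq_fun do rewrite dotE.
rewrite partial_sum // (bigD1 i) //= big1 ?addr0 => [|k ki].
  rewrite partialM; try exact: differentiable_coord_rV.
  by rewrite partial_coord eqxx /=; ring.
rewrite partialM; try exact: differentiable_coord_rV.
by rewrite partial_coord eq_sym (negPf ki) mul0r mulr0 addr0.
Qed.

(* Restricting u to the sphere of radius rho and extending it to be constant on
   rays does not change its derivatives tangent to that sphere. *)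
Let radialize (rho : R) (u : 'rV[R]_n -> R) (z : 'rV[R]_n) : R := u ((rho / enorm z) *: z).

Let radialize_smooth rho u : 0 < rho -> smooth_on Om u -> smooth_on Om (radialize rho u).
Proof.
move=> rho0 su; apply: (smooth_on_comp Oo su).
  by move=> x Ox; apply: regular_cone_scale => //; rewrite divr_gt0 // enorm_gt0 //; case: Ox.
move=> j; under eq_fun do rewrite mxE.
apply: (smooth_onM Oo); last exact: smooth_on_coord.
apply: (smooth_onM Oo); first exact: smooth_on_cst.
apply: (smooth_onV Oo); last exact/smooth_sub/(mn_smooth (@minkowski_enorm R m)).
by move=> x [x0 _]; rewrite gt_eqF ?enorm_gt0.
Qed.

Let radialize_derive u x v : smooth_on Om u -> Om x -> dot v x = 0 ->
  dot v (egrad (radialize (enorm x) u) x) = dot v (egrad u x).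
Proof.
move=> su Ox vx; have x0 := regular_cone_punctured Ox.
have e0 := enorm_gt0 x0; set rho := enorm x.
pose c z := rho / @enorm R m z.
have cx : c x = 1 by rewrite /c mulfV // gt_eqF.
have dn : differentiable (@enorm R m) x.
  exact: smooth_on_diff (mn_smooth (@minkowski_enorm R m)) x0.
have dc : differentiable c x.
  by apply: differentiableM; [exact: differentiable_cst|apply: differentiableV => //; rewrite gt_eqF].
(* The gradient of the factor is a multiple of x, hence vanishes on v. *)
have pc i : partial i c x = - (x 0 i / rho ^+ 2).
  rewrite partialM; [|exact: differentiable_cst|by apply: differentiableV => //; rewrite gt_eqF].
  rewrite partial_cst mul0r add0r partialV ?gt_eqF //.
  rewrite partial_sqrt; [|exact: smooth_on_diff (smooth_dot openT) (I : setT x)|exact: dot_xx_gt0].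
  rewrite partial_dotxx -/(enorm x) -/rho.
  by field; rewrite gt_eqF.
have dR : differentiable (fun z => c z *: z) x.
  apply: differentiable_mx => a b; under eq_fun do rewrite mxE.
  by apply: differentiableM => //; rewrite ord1; exact: differentiable_coord_rV.
have du : differentiable u (c x *: x) by rewrite cx scale1r; exact: smooth_on_diff su Ox.
rewrite !dotE.
transitivity (\sum_i \sum_j v 0 i * (- (x 0 i / rho ^+ 2) * x 0 j + (i == j)%:R) * partial j u x).
  apply: eq_bigr => i _; rewrite mxE /radialize (partial_comp i dR du) cx scale1r big_distrr /=.
  apply: eq_bigr => j _; rewrite mulrA; congr (_ * _ * _).
  under eq_fun do rewrite mxE.
  rewrite partialM //; last exact: differentiable_coord_rV.
  by rewrite pc partial_coord cx mul1r.
rewrite exchange_big /=; apply: eq_bigr => j _; rewrite -big_distrl /= mxE; congr (_ * _).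
under eq_bigr do rewrite mulrDr.
rewrite big_split /= [X in _ + X](bigD1 j) //= eqxx mulr1 [X in _ + (_ + X)]big1 => [|k kj].
  rewrite addr0 -[RHS]add0r; congr (_ + _).
  transitivity (- (dot v x * (x 0 j / rho ^+ 2))); last by rewrite vx mul0r oppr0.
  rewrite dotE big_distrl /= -sumrN; apply: eq_bigr => i _; ring.
by rewrite (negPf kj) mulr0.
Qed.

(** On straight lines |x| varies; once u is made constant on rays, only p matters, and the two lines
    are compared at equal values of p by [derive_along_levels]. *)
Lemma leaf_derivative u x y v w : invariant u -> same_leaf x y ->
  dot v x = 0 -> dot w y = 0 -> dot v (P x) = dot w (P y) -> dot v (P x) != 0 ->
  dot v (egrad u x) = dot w (egrad u y).
Proof.
move=> [su iu] xy vx wy vw vP; have [Ox Oy dxy pxy] := xy.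
have exy : enorm x = enorm y by rewrite /enorm dxy.
have e0 := enorm_gt0 (regular_cone_punctured Ox).
rewrite -(radialize_derive su Ox vx) -(radialize_derive su Oy wy) -exy.
set uh := radialize _ u.
have suh : smooth_on Om uh by exact: radialize_smooth.
have spO := smooth_sub sp.
have [rx rx0 Px] := open_ball Oo Ox; have [ry ry0 Py] := open_ball Oo Oy.
have ball (z v' : 'rV[R]_n) r t : 0 < r -> `|t| < r / (`|v'| + 1) -> `|z + t *: v' - z| < r.
  move=> r0 tr; rewrite addrC addKr normrZ.
  have v1 : 0 < `|v'| + 1 by rewrite ltr_wpDl.
  rewrite ltr_pdivlMr // in tr; apply: le_lt_trans tr.
  by rewrite ler_wpM2l // lerDl.
pose r := Num.min (rx / (`|v| + 1)) (ry / (`|w| + 1)).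
have r0 : 0 < r by rewrite lt_min !divr_gt0 // ltr_wpDl.
have lx t : `|t| < r -> Om (x + t *: v).
  by rewrite lt_min => /andP[tr _]; apply: Px; exact: ball.
have ly t : `|t| < r -> Om (y + t *: w).
  by rewrite lt_min => /andP[_ tr]; apply: Py; exact: ball.
have n0 : `|0 : R| < r by rewrite normr0.
have dl (f : 'rV[R]_n -> R) (z v' : 'rV[R]_n) : smooth_on Om f -> Om z ->
    is_derive (0 : R) 1 (fun t : R => f (z + t *: v')) (dot v' (egrad f z)).
  move=> sf Oz; have dz : differentiable f z by exact: smooth_on_diff sf Oz.
  have := @is_derive_line _ _ f z v' 0; rewrite scale0r addr0 => /(_ dz).
  by rewrite derive_dot.
have d1 := dl p x v spO Ox; have d2 := dl p y w spO Oy; rewrite -vw in d2.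
have d3 := dl uh x v suh Ox; have d4 := dl uh y w suh Oy.
apply: (derive_along_levels d1 d2 vP _ d3 d4 r0).
- by rewrite !scale0r !addr0.
- by move=> t tr; have [] := @is_derive_line _ _ p y w t (smooth_on_diff spO (ly _ tr)).
move=> a b ar br pab; rewrite /uh /radialize.
have /regular_cone_punctured xa0 := lx _ ar; have /regular_cone_punctured yb0 := ly _ br.
have xe := enorm_gt0 xa0; have ye := enorm_gt0 yb0.
apply: iu; split; try by apply: regular_cone_scale; [rewrite divr_gt0|auto].
  rewrite !dotZl !dotZr -!sqr_enorm.
  by field; rewrite !gt_eqF.
by rewrite !hp ?divr_gt0 // !expr0 !mul1r.
Qed.

Lemma invariant_along u : invariant u -> invariant (fun x => dot (P x) (egrad u x)).
Proof.
move=> iu; have [su _] := iu; split.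
  by apply: smooth_on_dot => //; exact: smooth_on_egrad.
move=> x y xy; have [Ox Oy _ _] := xy.
apply: leaf_derivative => //.
- by rewrite dotC dot_xP //; exact: regular_cone_punctured.
- by rewrite dotC dot_xP //; exact: regular_cone_punctured.
- exact: normP_leaf.
- exact: normP_neq0.
Qed.

Definition in_span (w : 'rV[R]_n -> 'rV[R]_n) : Prop :=
  exists a b, [/\ invariant a, invariant b & forall x, Om x -> w x = a x *: x + b x *: P x].

Lemma in_span_id : in_span id.
Proof.
exists (fun=> 1), (fun=> 0); split; try exact: invariant_cst.
by move=> x _; rewrite scale1r scale0r addr0.
Qed.

Lemma in_span_P : in_span P.
Proof.
exists (fun=> 0), (fun=> 1); split; try exact: invariant_cst.
by move=> x _; rewrite scale1r scale0r add0r.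
Qed.

(** The coefficients are those of the orthogonal projection onto x and dp, whose remainder k is
    tangent to the leaf. As [leaf_derivative] needs a direction in which p varies, k is not tested
    alone: dp and dp + k are compared at the same point, which gives du (k) = 0. *)
Lemma in_span_egrad u : invariant u -> in_span (egrad u).
Proof.
move=> iu; pose a x := dot x (egrad u x) * (dot x x)^-1.
pose b x := dot (P x) (egrad u x) * (dot (P x) (P x))^-1.
exists a, b; split.
- apply: invariantM; first exact: invariant_radial.
  by apply: invariantV invariant_dotxx => x [x0 _]; rewrite gt_eqF ?dot_xx_gt0.
- apply: invariantM; first exact: invariant_along.
  by apply: invariantV invariant_normP; exact: normP_neq0.
move=> x Ox; have x0 := regular_cone_punctured Ox.
have xx0 : dot x x != 0 by rewrite gt_eqF ?dot_xx_gt0.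
have PP0 := normP_neq0 Ox; have xP := dot_xP x0; have Px : dot (P x) x = 0 by rewrite dotC.
set w := egrad u x; pose k := w + (- a x) *: x + (- b x) *: P x.
have kx : dot k x = 0.
  by rewrite !dotDl !dotZl Px mulr0 addr0 (dotC w) /a mulNr divfK // subrr.
have kP : dot k (P x) = 0.
  by rewrite !dotDl !dotZl xP mulr0 addr0 (dotC w) /b mulNr divfK // subrr.
have kw : dot k w = 0.
  have leafxx : same_leaf x x by [].
  have := @leaf_derivative u x x (P x) (P x + k) iu leafxx.
  rewrite (dotDl (P x) k x) Px kx (dotDl (P x) k (P x)) kP (dotDl (P x) k w) !addr0.
  move=> /(_ erefl erefl erefl PP0)/esym/eqP.
  by rewrite -subr_eq0 addrC addKr => /eqP.
have kk : dot k k = 0 by rewrite {2}/k !dotDr !dotZr kx kP !mulr0 !addr0.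
have /eqP : k = 0.
  by apply: contra_eq kk => k0; rewrite gt_eqF ?dot_xx_gt0.
by rewrite /k -addrA !scaleNr -opprD subr_eq0 => /eqP.
Qed.

Lemma in_span_ext v w : (forall x, Om x -> v x = w x) -> in_span v -> in_span w.
Proof. by move=> vw [a [b [ia ib E]]]; exists a, b; split=> // x Ox; rewrite -vw ?E. Qed.

Lemma in_spanD v w : in_span v -> in_span w -> in_span (fun x => v x + w x).
Proof.
move=> [a [b [ia ib E]]] [a' [b' [ia' ib' E']]].
exists (fun x => a x + a' x), (fun x => b x + b' x); split; try exact: invariantD.
by move=> x Ox; rewrite E // E' // !scalerDl addrACA.
Qed.

Lemma in_spanZ u v : invariant u -> in_span v -> in_span (fun x => u x *: v x).
Proof.
move=> iu [a [b [ia ib E]]].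
exists (fun x => u x * a x), (fun x => u x * b x); split; try exact: invariantM.
by move=> x Ox; rewrite E // scalerDr !scalerA.
Qed.

Lemma in_span_combination a b v w : invariant a -> invariant b -> in_span v -> in_span w ->
  in_span (fun x => a x *: v x + b x *: w x).
Proof. by move=> ia ib sv sw; apply: in_spanD; exact: in_spanZ. Qed.

Lemma smooth_in_span v : in_span v -> smooth_on Om v.
Proof.
move=> [a [b [[sa _] [sb _] E]]].
have H : smooth_on Om (fun x => a x *: x + b x *: P x).
  by apply: (smooth_on_addmx Oo); apply: (smooth_on_scalemx Oo) => //; exact: smooth_on_id.
apply/(smooth_on_mxP Oo) => i j.
apply: (@smooth_on_ext _ _ _ Oo (fun x => (a x *: x + b x *: P x) i j)).
  by move=> x Ox; rewrite E.
by move/(smooth_on_mxP Oo) : H.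
Qed.

Lemma invariant_dot_span v w : in_span v -> in_span w -> invariant (fun x => dot (v x) (w x)).
Proof.
move=> [a [b [ia ib E]]] [a' [b' [ia' ib' E']]].
apply: (@invariant_ext (fun x => a x * a' x * dot x x + b x * b' x * dot (P x) (P x))).
  move=> x Ox; have xP := dot_xP (regular_cone_punctured Ox).
  rewrite E // E' // !dotDl !dotDr !dotZl !dotZr xP (dotC _ x) xP; ring.
apply: invariantD.
  by apply: invariantM invariant_dotxx; exact: invariantM.
by apply: invariantM invariant_normP; exact: invariantM.
Qed.

Lemma partial_egrad (u : 'rV[R]_n -> R) x k l : smooth_on Om u -> Om x ->
  partial k (egrad u) x 0 l = hessian u x k l.
Proof.
move=> su Ox; rewrite partial_mxE; last exact: smooth_on_diff (smooth_on_egrad su) Ox.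
by rewrite mxE; congr (partial k _ x); apply/funext => y; rewrite mxE.
Qed.

Lemma hessian_decomposition (u a b : 'rV[R]_n -> R) x :
  smooth_on Om u -> smooth_on Om a -> smooth_on Om b ->
  (forall y, Om y -> egrad u y = a y *: y + b y *: P y) -> Om x ->
  hessian u x = (a x)%:M + (b x)%:M *m B x + (egrad a x)^T *m x + (egrad b x)^T *m P x.
Proof.
move=> su sa sb E Ox; apply/matrixP => k l; rewrite !mxE !big_ord1 !mxE.
have dp := smooth_on_diff (smooth_on_partial l (smooth_sub sp)) Ox.
have da := smooth_on_diff sa Ox; have db := smooth_on_diff sb Ox.
have dc := differentiable_coord_rV x l.
rewrite (@partial_eq_on _ _ _ k _ (fun y => a y * y 0 l + b y * partial l p y) _ Oo Ox); last first.
  by move=> y Oy; have /rowP/(_ l) := E y Oy; rewrite !mxE.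
rewrite partialD; try by apply: differentiableM.
rewrite !partialM // partial_coord.
have -> : \sum_j (b x)%:M k j * B x j l = b x * partial k (partial l p) x.
  rewrite (bigD1 k) //= big1 ?addr0 => [|j jk]; first by rewrite !mxE eqxx mulr1n.
  by rewrite !mxE eq_sym (negPf jk) mul0r.
by rewrite mulr_natr; ring.
Qed.

Let normP2 (x : 'rV[R]_n) : R := dot (P x) (P x) / 2.

Let invariant_normP2 : invariant normP2.
Proof. by apply: invariantM; [exact: invariant_normP|exact: invariant_cst]. Qed.

Let egrad_normP2 x : W0 x -> egrad normP2 x = P x *m B x.
Proof.
move=> x0; have dP j : differentiable (partial j p) x.
  exact: smooth_on_diff (smooth_on_partial j sp) x0.
have dM j : differentiable (fun y => partial j p y * partial j p y) x by exact: differentiableM.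
apply/rowP => k; rewrite !mxE /normP2.
have -> : (fun y => dot (P y) (P y) / 2) = fun y => (\sum_j partial j p y * partial j p y) / 2.
  by apply/funext => y; rewrite dotE; congr (_ / _); apply: eq_bigr => j _; rewrite mxE.
rewrite partialM; [|exact: differentiable_sumf|exact: differentiable_cst].
rewrite partial_cst mulr0 addr0 partial_sum // big_distrl /=; apply: eq_bigr => j _.
rewrite partialM // !mxE (partialC _ _ (@open_punctured R n) sp x0).
by field.
Qed.

(** Obtained by differentiating the relation that dp is orthogonal to x. *)
Lemma radial_hessian x : W0 x -> x *m B x = - P x.
Proof.
move=> x0; have sPx := smooth_egrad sp.
have dP := smooth_on_diff sPx x0.
have W0o := @open_punctured R n.
have dT := smooth_on_diff (smooth_on_trmx W0o (smooth_on_id W0o)) x0.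
apply/rowP => k.
have : partial k (fun y => y *m (P y)^T) x = 0.
  rewrite -[RHS](@derive_cst _ _ _ (0 : 'M[R]_1) x (delta_mx 0 k)).
  apply: near_eq_derive; apply: (open_near (@open_punctured R n) x0) => y y0.
  by rewrite dot_scalar dot_xP // raddf0.
have did : differentiable (fun y : 'rV[R]_n => y) x by [].
have dPT := smooth_on_diff (smooth_on_trmx (@open_punctured R n) sPx) x0.
rewrite partial_mulmx // partial_trmx // => /matrixP/(_ 0 0).
rewrite [LHS]mxE [RHS]mxE [X in X + _]mxE [X in _ + X]mxE.
have -> : \sum_j partial k (fun y : 'rV[R]_n => y) x 0 j * (P x)^T j 0 = P x 0 k.
  rewrite (bigD1 k) //= big1 ?addr0 => [|j jk].
    by rewrite partial_mxE // partial_coord eqxx mul1r mxE.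
  by rewrite partial_mxE // partial_coord eq_sym (negPf jk) mul0r.
move/eqP; rewrite addrC addr_eq0 => /eqP E.
rewrite [RHS]mxE -E mxE; apply: eq_bigr => j _; congr (_ * _).
rewrite [RHS]mxE (partial_mxE _ _ _ dP) mxE (partialC _ _ (@open_punctured R n) sp x0).
by congr (partial k _ x); apply/funext => y; rewrite mxE.
Qed.

Lemma span_mul_hessian v : in_span v -> in_span (fun x => v x *m B x).
Proof.
move=> [a [b [ia ib E]]].
apply: (@in_span_ext (fun x => (- a x) *: P x + b x *: egrad normP2 x)).
  move=> x Ox; have x0 := regular_cone_punctured Ox.
  by rewrite E // mulmxDl -!scalemxAl radial_hessian // scalerN scaleNr egrad_normP2.
apply: in_span_combination; [exact: invariantN|by []|exact: in_span_P|exact: in_span_egrad].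
Qed.

Lemma dirmx_mulmx (a b c : nat) X (f : 'rV[R]_n -> 'M[R]_(a, b)) (g : 'rV[R]_n -> 'M[R]_(b, c)) x :
  differentiable f x -> differentiable g x ->
  dirmx X (fun y => f y *m g y) x = dirmx X f x *m g x + f x *m dirmx X g x.
Proof.
move=> df dg; rewrite /dirmx mulmx_suml mulmx_sumr -big_split /=; apply: eq_bigr => i _.
by rewrite partial_mulmx // scalerDr -scalemxAl -scalemxAr.
Qed.

Lemma dirmxD (a b : nat) X (f g : 'rV[R]_n -> 'M[R]_(a, b)) x :
  differentiable f x -> differentiable g x ->
  dirmx X (fun y => f y + g y) x = dirmx X f x + dirmx X g x.
Proof.
move=> df dg; rewrite /dirmx -big_split /=; apply: eq_bigr => i _; rewrite -scalerDr.
congr (_ *: _).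
exact: (deriveD (@diff_derivable _ _ _ _ _ (delta_mx 0 i) df)
                (@diff_derivable _ _ _ _ _ (delta_mx 0 i) dg)).
Qed.

Lemma dirmx_trmx (a b : nat) X (f : 'rV[R]_n -> 'M[R]_(a, b)) x :
  differentiable f x -> dirmx X (fun y => (f y)^T) x = (dirmx X f x)^T.
Proof.
move=> df; rewrite /dirmx linear_sum /=; apply: eq_bigr => i _.
by rewrite partial_trmx // linearZ.
Qed.

Lemma dirmx_scalar X (u : 'rV[R]_n -> R) x : differentiable u x ->
  dirmx X (fun y => (u y)%:M : 'M[R]_n) x = (dot X (egrad u x))%:M.
Proof.
move=> du; have ds : differentiable (fun y => (u y)%:M : 'M[R]_n) x.
  apply: differentiable_mx => a b; under eq_fun do rewrite mxE.
  case: (a == b); first by under eq_fun do rewrite mulr1n.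
  by under eq_fun do rewrite mulr0n; exact: differentiable_cst.
apply/matrixP => a b; rewrite summxE mxE dotE -sumrMnl; apply: eq_bigr => i _.
rewrite mxE (partial_mxE _ _ _ ds) mxE; under eq_fun do rewrite mxE.
by case: (a == b); [under eq_fun do rewrite mulr1n; rewrite mulr1n
  |under eq_fun do rewrite mulr0n; rewrite partial_cst mulr0].
Qed.

Lemma dirmx_id X (x : 'rV[R]_n) : dirmx X id x = X.
Proof.
rewrite /dirmx [RHS]row_sum_delta; apply: eq_bigr => i _.
by congr (_ *: _); exact: derive_id.
Qed.

Lemma dirmx_scale X (u : 'rV[R]_n -> R) (v : 'rV[R]_n -> 'rV[R]_n) x :
  differentiable u x -> differentiable v x ->
  dirmx X (fun y => u y *: v y : 'rV[R]_n) x = dot X (egrad u x) *: v x + u x *: dirmx X v x.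
Proof.
move=> du dv; apply/rowP => j; rewrite [RHS]mxE [X in X + _]mxE [X in _ + X]mxE !summxE dotE.
rewrite big_distrl big_distrr -big_split /=; apply: eq_bigr => i _.
have duv : differentiable (fun y => u y *: v y) x.
  apply: differentiable_mx => a b; under eq_fun do rewrite mxE.
  by apply: differentiableM => //; exact: differentiable_mx_coord.
have dvj := differentiable_mx_coord 0 j dv.
rewrite !mxE (partial_mxE _ _ _ duv); under eq_fun do rewrite mxE.
by rewrite partialM // (partial_mxE _ _ _ dv); ring.
Qed.

Lemma dirmx_P x : Om x -> dirmx (P x) P x = P x *m B x.
Proof.
move=> Ox; apply/rowP => l; rewrite summxE mxE; apply: eq_bigr => k _.
by rewrite mxE partial_egrad //; exact: smooth_sub.
Qed.

Lemma in_span_along v : in_span v -> in_span (fun x => dirmx (P x) v x).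
Proof.
move=> [a [b [ia ib E]]]; have [[sa _] [sb _]] := (ia, ib).
apply: (@in_span_ext (fun x => (dot (P x) (egrad a x) *: x + a x *: P x) +
    (dot (P x) (egrad b x) *: P x + b x *: (P x *m B x)))).
  move=> x Ox; have da := smooth_on_diff sa Ox; have db := smooth_on_diff sb Ox.
  have dP := smooth_on_diff sP Ox.
  have did : differentiable (fun y : 'rV[R]_n => y) x by [].
  have s1 := smooth_on_scalemx Oo sa (smooth_on_id Oo).
  have s2 := smooth_on_scalemx Oo sb sP.
  rewrite (dirmx_eq_on _ Oo Ox E) dirmxD; [|exact: smooth_on_diff s1 Ox
    |exact: smooth_on_diff s2 Ox].
  by rewrite !dirmx_scale // dirmx_id dirmx_P.
by apply: in_spanD; apply: in_span_combination => //;
  [exact: invariant_along|exact: in_span_id|exact: in_span_P|exact: invariant_along|exact: in_span_P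
  |exact/span_mul_hessian/in_span_P].
Qed.

(** * The algebra of matrix fields generated by the Hessian of p *)

Inductive leaf_algebra : ('rV[R]_n -> 'M[R]_n) -> Prop :=
| LAscalar u : invariant u -> leaf_algebra (fun x => (u x)%:M)
| LAhessian : leaf_algebra B
| LAtensor v w : in_span v -> in_span w -> leaf_algebra (fun x => (v x)^T *m w x)
| LAadd A1 A2 : leaf_algebra A1 -> leaf_algebra A2 -> leaf_algebra (fun x => A1 x + A2 x)
| LAmul A1 A2 : leaf_algebra A1 -> leaf_algebra A2 -> leaf_algebra (fun x => A1 x *m A2 x)
| LAext A1 A2 : (forall x, Om x -> A1 x = A2 x) -> leaf_algebra A1 -> leaf_algebra A2.

Lemma leaf_algebra_smooth A : leaf_algebra A -> smooth_on Om A.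
Proof.
elim=> {A}.
- move=> u [su _]; apply/(smooth_on_mxP Oo) => i j; under eq_fun do rewrite mxE.
  case: (i == j); first by under eq_fun do rewrite mulr1n.
  by under eq_fun do rewrite mulr0n; exact: smooth_on_cst.
- exact: sB.
- by move=> v w sv sw; apply: (smooth_on_mulmx Oo); [apply: (smooth_on_trmx Oo)|]; exact: smooth_in_span.
- by move=> A1 A2 _ s1 _ s2; exact: smooth_on_addmx.
- by move=> A1 A2 _ s1 _ s2; exact: smooth_on_mulmx.
- move=> A1 A2 E _ /(smooth_on_mxP Oo) s1; apply/(smooth_on_mxP Oo) => i j.
  by apply: (@smooth_on_ext _ _ _ Oo (fun x => A1 x i j)) => // x Ox; rewrite E.
Qed.

Lemma leaf_algebra_span A v : leaf_algebra A -> in_span v -> in_span (fun x => v x *m A x).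
Proof.
move=> lA; elim: lA v => {A}.
- move=> u iu v sv; apply: in_span_ext (in_spanZ iu sv) => x _.
  by rewrite mul_mx_scalar.
- by move=> v sv; exact: span_mul_hessian.
- move=> v1 w sv1 sw v sv.
  apply: in_span_ext (in_spanZ (invariant_dot_span sv sv1) sw) => x _.
  by rewrite mulmxA dot_scalar mul_scalar_mx.
- move=> A1 A2 _ I1 _ I2 v sv; apply: in_span_ext (in_spanD (I1 v sv) (I2 v sv)) => x _.
  by rewrite mulmxDr.
- move=> A1 A2 _ I1 _ I2 v sv; apply: in_span_ext (I2 _ (I1 v sv)) => x _.
  by rewrite mulmxA.
- by move=> A1 A2 E _ I1 v sv; apply: in_span_ext (I1 v sv) => x Ox; rewrite E.
Qed.

Lemma leaf_algebra_hessian u : invariant u -> leaf_algebra (hessian u).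
Proof.
move=> iu; have [a [b [ia ib E]]] := in_span_egrad iu.
have [[su _] [sa _] [sb _]] := And3 iu ia ib.
apply: LAext => [x Ox|]; first by rewrite (hessian_decomposition su sa sb E Ox).
apply: LAadd; last by apply: LAtensor; [exact: in_span_egrad|exact: in_span_P].
apply: LAadd; last by apply: LAtensor; [exact: in_span_egrad|exact: in_span_id].
by apply: LAadd; [exact: LAscalar|apply: LAmul; [exact: LAscalar|exact: LAhessian]].
Qed.

(** Differentiate dp B = d (|dp|^2 / 2). The symmetry of third derivatives turns the derivative of B
    contracted with dp into the derivative of B along dp. *)
Lemma riccati x : Om x -> dirmx (P x) B x = - (B x *m B x) + hessian normP2 x.
Proof.
move=> Ox; have x0 := regular_cone_punctured Ox; have [sN _] := invariant_normP2.
have dP := smooth_on_diff sP Ox; have dB := smooth_on_diff sB Ox.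
apply/eqP; rewrite addrC -subr_eq opprK addrC; apply/eqP/matrixP => k l.
rewrite -(partial_egrad k l sN Ox).
have -> : partial k (egrad normP2) x = partial k (fun y => P y *m B y) x.
  apply: near_eq_derive; apply: (open_near Oo Ox) => y Oy.
  by rewrite egrad_normP2 //; exact: regular_cone_punctured.
rewrite partial_mulmx // [LHS]mxE [RHS]mxE; congr (_ + _).
  by rewrite !mxE; apply: eq_bigr => j _; rewrite (partial_egrad _ _ (smooth_sub sp) Ox).
rewrite summxE mxE; apply: eq_bigr => j _; rewrite [LHS]mxE; congr (_ * _).
exact: partial_hessian_sym.
Qed.

Lemma leaf_algebra_along A : leaf_algebra A -> leaf_algebra (fun x => dirmx (P x) A x).
Proof.
elim=> {A}.
- move=> u iu; have [su _] := iu.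
  apply: LAext (LAscalar (invariant_along iu)) => x Ox.
  by rewrite dirmx_scalar //; exact: smooth_on_diff su Ox.
(* Only the generator B requires an argument: the Riccati equation expresses its derivative inside
   the algebra. *)
- apply: (@LAext (fun x => (-1)%:M *m (B x *m B x) + hessian normP2 x)).
    by move=> x Ox; rewrite riccati // mul_scalar_mx scaleN1r.
  apply: LAadd; last exact: leaf_algebra_hessian.
  by apply: LAmul; [exact/LAscalar/invariant_cst|apply: LAmul; exact: LAhessian].
- move=> v w sv sw; have [smv smw] := (smooth_in_span sv, smooth_in_span sw).
  apply: (@LAext (fun x => (dirmx (P x) v x)^T *m w x + (v x)^T *m dirmx (P x) w x)).
    move=> x Ox; have dv := smooth_on_diff smv Ox; have dw := smooth_on_diff smw Ox.
    have dvT := smooth_on_diff (smooth_on_trmx Oo smv) Ox.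
    by rewrite dirmx_mulmx // dirmx_trmx.
  by apply: LAadd; apply: LAtensor => //; exact: in_span_along.
- move=> A1 A2 l1 I1 l2 I2; apply: LAext (LAadd I1 I2) => x Ox.
  have d1 := smooth_on_diff (leaf_algebra_smooth l1) Ox.
  by rewrite dirmxD //; exact: smooth_on_diff (leaf_algebra_smooth l2) Ox.
- move=> A1 A2 l1 I1 l2 I2; apply: LAext (LAadd (LAmul I1 l2) (LAmul l1 I2)) => x Ox.
  have d1 := smooth_on_diff (leaf_algebra_smooth l1) Ox.
  by rewrite dirmx_mulmx //; exact: smooth_on_diff (leaf_algebra_smooth l2) Ox.
- by move=> A1 A2 E _ I1; apply: LAext I1 => x Ox; exact: dirmx_eq_on Oo Ox E.
Qed.

Lemma leaf_algebraX k : leaf_algebra (fun x => B x ^+ k).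
Proof.
elim: k => [|k IH].
  by apply: (LAext _ (LAscalar (invariant_cst 1))) => x _; rewrite expr0.
by apply: (LAext _ (LAmul LAhessian IH)) => x _; rewrite exprS.
Qed.

Lemma trace_along (A : 'rV[R]_n -> 'M[R]_n) x : smooth_on Om A -> Om x ->
  dot (P x) (egrad (fun y => \tr (A y)) x) = \tr (dirmx (P x) A x).
Proof.
move=> sA Ox; have dA := smooth_on_diff sA Ox.
rewrite dotE /dirmx linear_sum; apply: eq_bigr => i _.
rewrite linearZ /=; congr (_ * _); rewrite mxE; exact: partial_tr.
Qed.

(** B and its derivative need not commute. The factor B^j collects the powers met on the left, and
    cyclicity of the trace brings round those on the right. *)
Lemma trace_power_along x j k : Om x ->
  \tr (B x ^+ j * dirmx (P x) (fun y => B y ^+ k.+1) x) =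
  k.+1%:R * \tr (B x ^+ (j + k) * dirmx (P x) B x).
Proof.
move=> Ox; have dB := smooth_on_diff sB Ox.
elim: k j => [|k IH] j; first by rewrite addn0 mul1r.
have dBk := smooth_on_diff (leaf_algebra_smooth (leaf_algebraX k.+1)) Ox.
rewrite (@dirmx_eq_on _ _ _ _ _ (fun y => B y *m (B y ^+ k.+1)) _ Oo Ox) => [|y _]; last by rewrite exprS.
apply: etrans (congr1 (fun Z => \tr (B x ^+ j * Z)) (dirmx_mulmx (P x) dB dBk)) _.
rewrite mulrDr mxtraceD (mulrA (B x ^+ j) (B x)) -exprSr (IH j.+1) addSnnS.
set D := dirmx (P x) B x.
have -> : \tr (B x ^+ j * (D * B x ^+ k.+1)) = \tr (B x ^+ (j + k.+1) * D).
  by rewrite mulrA -mulmxE mxtrace_mulC mulmxE mulrA -exprD addnC.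
by rewrite -[k.+2]addn1 natrD mulrDl mul1r addrC.
Qed.

Lemma trace_tensor_power v w k : in_span v -> in_span w ->
  invariant (fun x => \tr (B x ^+ k * ((v x)^T *m w x))).
Proof.
move=> sv sw.
apply: (invariant_ext _ (invariant_dot_span (leaf_algebra_span (leaf_algebraX k) sw) sv)) => x _.
by rewrite -mulmxE mulmxA mxtrace_mulC mulmxA dot_scalar mxtrace_scalar mulr1n.
Qed.

(* Differentiating the trace of B^(k+1) along the gradient of p produces the
   trace of B^(k+2) by the Riccati equation. *)
Lemma invariant_trace_power k : invariant (fun x => \tr (B x ^+ k)).
Proof.
(* Two consecutive powers are carried, because the Hessian of |dp|^2 / 2 contains a scalar term and
   a multiple of B, which yield tr B^k and tr B^(k+1). *)
suff H : invariant (fun x => \tr (B x ^+ k)) /\ invariant (fun x => \tr (B x ^+ k.+1)) by case: H.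
elim: k => [|k [IH0 IH1]].
  split.
    apply: (invariant_ext _ (invariant_cst n%:R)) => x _.
    by rewrite expr0 mxtrace1.
  split; first exact: (smooth_on_tr Oo (leaf_algebra_smooth (leaf_algebraX 1))).
  by move=> x y xy; exact: (trB_leaf xy).
split; first exact: IH1.
have iN := invariant_normP2.
have [a [b [ia ib E]]] := in_span_egrad iN.
have [[su _] [sa _] [sb _]] := And3 iN ia ib.
have sk := leaf_algebra_smooth (leaf_algebraX k.+1).
have iD := invariant_along IH1.
(* The Riccati equation, multiplied by B^k, traced, and solved for tr B^(k+2). *)
apply: (@invariant_ext (fun x => - (k.+1%:R^-1 * dot (P x) (egrad (fun y => \tr (B y ^+ k.+1)) x)) +
  (a x * \tr (B x ^+ k) + b x * \tr (B x ^+ k.+1) + \tr (B x ^+ k * ((egrad a x)^T *m x)) +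
   \tr (B x ^+ k * ((egrad b x)^T *m P x))))).
  move=> x Ox; rewrite (trace_along sk Ox) -[dirmx _ _ x]mul1r -(expr0 (B x)).
  rewrite trace_power_along // mulKf ?pnatr_eq0 // add0n riccati //.
  set H := hessian normP2 x.
  have -> : a x * \tr (B x ^+ k) + b x * \tr (B x ^+ k.+1) + \tr (B x ^+ k * ((egrad a x)^T *m x)) +
      \tr (B x ^+ k * ((egrad b x)^T *m P x)) = \tr (B x ^+ k * H).
    rewrite /H (hessian_decomposition su sa sb E Ox) !mulrDr !mxtraceD.
    by rewrite -mulmxE mul_mx_scalar mxtraceZ mul_scalar_mx -scalemxAr mxtraceZ mulmxE -exprSr.
  rewrite mulrDr mxtraceD mulrN (raddfN (@mxtrace R n)) opprD opprK subrK.
  by rewrite mulmxE -expr2 -exprD addn2.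
apply: invariantD; first by apply: invariantN; exact: invariantM (invariant_cst _) iD.
apply: invariantD; last exact: trace_tensor_power (in_span_egrad ib) in_span_P.
apply: invariantD; last exact: trace_tensor_power (in_span_egrad ia) in_span_id.
by apply: invariantD; exact: invariantM.
Qed.

(* Traces are not compatible with products, so the trace of A is controlled
   through left multiplication by A of the fields that are good below. *)
Let good (W : 'rV[R]_n -> 'M[R]_n) :=
  (forall k, invariant (fun x => \tr (W x *m B x ^+ k))) /\
  forall v, in_span v -> in_span (fun x => v x *m W x).

Let good_mul A W : leaf_algebra A -> good W -> good (fun x => A x *m W x).
Proof.
move=> lA; elim: lA W => {A}.
- move=> u iu W [tW sW]; split=> [k|v sv].
    apply: (invariant_ext _ (invariantM iu (tW k))) => x _.
    by rewrite mul_scalar_mx -scalemxAl mxtraceZ.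
  apply: in_span_ext (in_spanZ iu (sW v sv)) => x _.
  by rewrite mul_scalar_mx scalemxAr.
- move=> W [tW sW]; split=> [k|v sv].
    apply: (invariant_ext _ (tW k.+1)) => x _.
    by rewrite exprSr -mulmxE mulmxA mxtrace_mulC mulmxA.
  by apply: in_span_ext (sW _ (span_mul_hessian sv)) => x _; rewrite mulmxA.
- move=> v w sv sw W [tW sW]; split=> [k|v' sv'].
    apply: (invariant_ext _ (invariant_dot_span (leaf_algebra_span (leaf_algebraX k) (sW w sw)) sv)) => x _.
    by rewrite -!mulmxA mxtrace_mulC !mulmxA dot_scalar mxtrace_scalar mulr1n.
  apply: in_span_ext (in_spanZ (invariant_dot_span sv' sv) (sW w sw)) => x _.
  by rewrite !mulmxA dot_scalar mul_scalar_mx scalemxAl.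
- move=> A1 A2 _ I1 _ I2 W gW; have [[t1 s1] [t2 s2]] := (I1 W gW, I2 W gW); split=> [k|v sv].
    apply: (invariant_ext _ (invariantD (t1 k) (t2 k))) => x _.
    by rewrite !mulmxDl mxtraceD.
  by apply: in_span_ext (in_spanD (s1 v sv) (s2 v sv)) => x _; rewrite mulmxDl mulmxDr.
- move=> A1 A2 _ I1 _ I2 W gW; have [t s] := I1 _ (I2 W gW); split=> [k|v sv].
    by apply: (invariant_ext _ (t k)) => x _; rewrite !mulmxA.
  by apply: in_span_ext (s v sv) => x _; rewrite !mulmxA.
- move=> A1 A2 E _ I1 W gW; have [t s] := I1 W gW; split=> [k|v sv].
    by apply: (invariant_ext _ (t k)) => x Ox; rewrite E.
  by apply: in_span_ext (s v sv) => x Ox; rewrite E.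
Qed.

Lemma leaf_algebra_trace A : leaf_algebra A -> invariant (fun x => \tr (A x)).
Proof.
move=> lA; have g1 : good (fun=> 1%:M).
  split=> [k|v sv]; first by apply: (invariant_ext _ (invariant_trace_power k)) => x _; rewrite mul1mx.
  by apply: in_span_ext sv => x _; rewrite mulmx1.
have [t _] := good_mul lA g1.
by apply: (invariant_ext _ (t 0)) => x _; rewrite expr0 !mulmx1.
Qed.

Lemma leaf_algebra_horner A q : leaf_algebra A -> leaf_algebra (fun x => horner_mx (A x) q).
Proof.
move=> lA; elim/poly_ind: q => [|q c IH].
  by apply: (LAext _ (LAscalar (invariant_cst 0))) => x _; rewrite rmorph0 raddf0.
apply: (LAext _ (LAadd (LAmul IH lA) (LAscalar (invariant_cst c)))) => x _.
by rewrite rmorphD rmorphM /= horner_mx_X horner_mx_C.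
Qed.

(* Cayley-Hamilton for the product of the two characteristic polynomials. *)
Lemma common_inverse (A A' : 'M[R]_n) : A \in unitmx -> A' \in unitmx ->
  exists q, horner_mx A q = invmx A /\ horner_mx A' q = invmx A'.
Proof.
move=> uA uA'; pose r := char_poly A * char_poly A'.
have r0 : r.[0] != 0.
  rewrite hornerM !horner_coef0 !char_poly_det !mulf_neq0 ?signr_eq0 //.
    by rewrite -unitfE -unitmxE.
  by rewrite -unitfE -unitmxE.
have /factor_theorem[s] : root (r - r.[0]%:P) 0 by rewrite rootE hornerD hornerN hornerC subrr.
rewrite subr0 => rs.
have rE : r = s * 'X + r.[0]%:P by rewrite -rs subrK.
(* From r (Z) = 0 one reads s (Z) Z = - r (0), so - s / r (0) evaluates to the inverse of Z. *)
suff H (Z : 'M[R]_n) : Z \in unitmx -> horner_mx Z r = 0 -> horner_mx Z (- r.[0]^-1 *: s) = invmx Z.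
  exists (- r.[0]^-1 *: s); split; apply: H => //.
    by rewrite rmorphM /= Cayley_Hamilton mul0r.
  by rewrite rmorphM /= Cayley_Hamilton mulr0.
move=> uZ; rewrite {1}rE rmorphD rmorphM /= horner_mx_X horner_mx_C.
move=> H0; have sZ : horner_mx Z s * Z = - (r.[0])%:M by apply/eqP; rewrite -subr_eq0 opprK H0.
rewrite horner_mxZ -[LHS]mulmx1 -(mulmxV uZ) mulmxA -scalemxAl mulmxE sZ.
by rewrite scalerN scaleNr opprK scale_scalar_mx mulVf // mul1r.
Qed.

(** * Invariance of the two operators for a homogeneous invariant energy *)

Section InvariantEnergy.
Variable e : 'rV[R]_n -> R.
Hypotheses (se : smooth_on W0 e) (he : homogeneous 2 e) (ie : invariant e).
Hypothesis hessian_unit : forall x, W0 x -> hessian e x \in unitmx.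
Local Notation h := (hessian e).

Lemma ambient_invariants x y : same_leaf x y ->
  (ambient_grad h p x *m (P x)^T) 0 0 = (ambient_grad h p y *m (P y)^T) 0 0 /\
  ambient_laplacian h p x = ambient_laplacian h p y.
Proof.
move=> xy; have [Ox Oy _ _] := xy.
have [x0 y0] := (regular_cone_punctured Ox, regular_cone_punctured Oy).
(* One [q] serves both points; its coefficients are constant, so q (h) belongs to the algebra. *)
have [q [qx qy]] := common_inverse (hessian_unit x0) (hessian_unit y0).
have lh := leaf_algebra_hessian ie.
have lq := leaf_algebra_horner q lh.
have sX := leaf_algebra_span lq in_span_P.
have [_ iG] := invariant_dot_span sX in_span_P.
split.
  have gx : ambient_grad h p x = P x *m horner_mx (h x) q := congr1 (mulmx (P x)) (esym qx).
  have gy : ambient_grad h p y = P y *m horner_mx (h y) q := congr1 (mulmx (P y)) (esym qy).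
  by rewrite gx gy; exact: (iG _ _ xy).
have [a [b [ia ib E]]] := sX.
(* The component along z of the gradient is lost because h is constant on rays. *)
have KE z : Om z -> dirmx (P z *m horner_mx (h z) q) h z = b z *: dirmx (P z) h z.
  move=> Oz; rewrite E //.
  rewrite /dirmx scaler_sumr; under eq_bigr do rewrite mxE scalerDl.
  rewrite big_split /=; under eq_bigr do rewrite mxE -scalerA.
  rewrite -scaler_sumr -/(dirmx z h z) hessian_radial //; last exact: regular_cone_punctured.
  rewrite scaler0 add0r; apply: eq_bigr => i _.
  by rewrite mxE scalerA.
pose L z := horner_mx (h z) q *m (B z + (- 2^-1 * b z)%:M *m dirmx (P z) h z).
have lL : leaf_algebra L.
  apply: LAmul => //; apply: LAadd; first exact: LAhessian.
  apply: LAmul; last exact: leaf_algebra_along.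
  by apply: LAscalar; exact: invariantM (invariant_cst _) ib.
have [_ iL] := leaf_algebra_trace lL.
have LE z : Om z -> horner_mx (h z) q = invmx (h z) -> \tr (L z) = ambient_laplacian h p z.
  move=> Oz qz; rewrite /L /ambient_laplacian /ambient_grad -qz KE //.
  by rewrite mul_scalar_mx scalerA mulNr scaleNr.
transitivity (\tr (L x)); first by symmetry; apply: LE.
by transitivity (\tr (L y)); [exact: (iL _ _ xy)|apply: LE].
Qed.

End InvariantEnergy.

End InvariantClass.

(** * The foliation of the indicatrix *)

Section Polynomials.
Variables (R : realType) (n : nat).

Definition polyfun (Q : mpoly n R) (x : 'rV[R]_n) : R := meval (fun i => x 0 i) Q.

Lemma smooth_polyfun Q (U : set 'rV[R]_n) : open U -> smooth_on U (polyfun Q).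
Proof.
move=> Uo; rewrite /polyfun; under eq_fun do rewrite mevalE.
apply: (smooth_on_sum Uo) => k _; apply: (smooth_onM Uo); first exact: smooth_on_cst.
by apply: (smooth_on_prod Uo) => i _; apply: (smooth_onX Uo); exact: smooth_on_coord.
Qed.

Lemma polyfun_homog d Q (l : R) (x : 'rV[R]_n) : Q \is ishomog1 d mdeg ->
  polyfun Q (l *: x) = l ^+ d * polyfun Q x.
Proof.
move=> /dhomogP hQ; rewrite /polyfun !mevalE big_distrr /=.
rewrite big_seq [RHS]big_seq; apply: eq_bigr => k kQ.
under eq_bigr do rewrite mxE exprMn.
by rewrite big_split /= prodrXr -mdegE (hQ k kQ) mulrCA.
Qed.

(** Reduces vanishing near a point and sign changes to polynomials in one variable. *)
Lemma polyfun_line Q (x v : 'rV[R]_n) :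
  exists r : {poly R}, forall t, r.[t] = polyfun Q (x + t *: v).
Proof.
exists (\sum_(k <- msupp Q) (mcoeff k Q)%:P * \prod_i ((x 0 i)%:P + (v 0 i)%:P * 'X) ^+ k i).
move=> t; rewrite /polyfun mevalE horner_sum; apply: eq_bigr => k _.
rewrite hornerM hornerC horner_prod; congr (_ * _); apply: eq_bigr => i _.
by rewrite horner_exp hornerD hornerM !hornerC hornerX !mxE (mulrC t).
Qed.

End Polynomials.

Lemma poly0_near0 (R : realType) (r : {poly R}) (e : R) : 0 < e ->
  (forall t, `|t| < e -> r.[t] = 0) -> r = 0.
Proof.
move=> e0 r0; apply/eqP/negPn/negP => rn0.
(* As many distinct roots as the size of [r], one more than its degree allows; the shift k + 2
   places them strictly inside the interval. *)
pose s := [seq e / (k.+2)%:R | k <- iota 0 (size r)].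
have sr : all (root r) s.
  apply/allP => _ /mapP[k _ ->]; apply/eqP/r0.
  rewrite ger0_norm ?divr_ge0 ?ltW // ltr_pdivrMr ?ltr0n //.
  by rewrite ltr_pMr // ltr1n.
have su : uniq s.
  rewrite map_inj_uniq ?iota_uniq // => a b /(mulfI (lt0r_neq0 e0))/invr_inj/eqP.
  by rewrite eqr_nat => /eqP[].
by have := max_poly_roots rn0 sr su; rewrite size_map size_iota ltnn.
Qed.

Section Foliation.
Variables (R : realType) (m d : nat).
Local Notation n := m.+1.
Variables (M : R -> set 'rV[R]_n) (p0 : 'rV[R]_n -> R).
Hypotheses (m2 : (1 < m)%N) (fol : sphere_foliation_by d M p0).

Let W0 := @punctured R n.
Let W0o := @open_punctured R n.
Local Notation Sph := (@sphere R n).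

(** Degree 0, instead of the degree d of the polynomial, makes dp tangent to spheres and the level
    sets cones. *)
Definition radial_extension (x : 'rV[R]_n) : R := p0 ((enorm x)^-1 *: x).
Local Notation p := radial_extension.

Lemma sphere_normalize x : W0 x -> Sph ((enorm x)^-1 *: x).
Proof.
by move=> x0; rewrite sphere_indicatrix; apply: indicatrix_scale => //; exact: minkowski_enorm.
Qed.

Lemma sphere_punctured x : Sph x -> W0 x.
Proof. by rewrite sphere_indicatrix; apply: indicatrix_punctured; exact: minkowski_enorm. Qed.

Lemma radial_extension_sphere x : Sph x -> p x = p0 x.
Proof. by move=> Sx; rewrite /p sphere_enorm // invr1 scale1r. Qed.

Lemma radial_extension_homog : homogeneous 0 p.
Proof.
move=> l x l0 x0; rewrite expr0 mul1r /p.
rewrite (mn_homog (@minkowski_enorm R m)) ?ltW // scalerA invfM mulrAC mulVf ?gt_eqF //.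
by rewrite mul1r.
Qed.
Local Notation hp := radial_extension_homog.

Lemma smooth_radial_extension : smooth_on W0 p.
Proof.
have [Q hQ Qp] := sf_polynomial fol.
apply: (@smooth_on_ext _ _ _ W0o (fun x => polyfun Q ((enorm x)^-1 *: x))).
  by move=> x x0; rewrite /p Qp //; exact: sphere_normalize.
apply: (@smooth_on_comp _ _ _ W0o _ setT) => //; first by apply: smooth_polyfun; exact: openT.
have := smooth_radial (@minkowski_enorm R m).
by move/(smooth_on_mxP W0o) => /(_ 0).
Qed.
Local Notation sp := smooth_radial_extension.

Lemma radial_extension_range x : W0 x -> -1 <= p x <= 1.
Proof. by move=> x0; apply: (sf_range fol); exact: sphere_normalize. Qed.

Lemma sphere_chart x : Sph x -> exists (U : set 'rV[R]_m) (phi : 'rV[R]_m -> 'rV[R]_n) u,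
  [/\ local_param Sph U phi, U u & phi u = x].
Proof.
have [[sub _] _ _ _] := sf_isoparametric fol.
by move=> /sub[U [phi [lp [u Uu xu]]]]; exists U, phi, u.
Qed.

Lemma chart_sphere_indicatrix (U : set 'rV[R]_m) phi :
  local_param Sph U phi -> local_param (indicatrix (@enorm R m)) U phi.
Proof. by rewrite sphere_indicatrix. Qed.

(** By scaling, a zero of dp yields a critical point on the sphere with the same value of p, and
    critical values are 1 or -1. *)
Lemma regular_egrad x : regular_cone p x -> egrad p x != 0.
Proof.
move=> [x0 px]; apply: contraTneq px => P0.
set y := (enorm x)^-1 *: x; have Sy : Sph y by exact: sphere_normalize.
have e0 : 0 < (enorm x)^-1 by rewrite invr_gt0 enorm_gt0.
have Py : egrad p y = 0.
  apply/rowP => i; rewrite !mxE; apply: (mulfI (lt0r_neq0 e0)).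
  rewrite mulr0 (homogeneous_partial i sp hp e0 x0) expr0 mul1r.
  by have /rowP/(_ i) := P0; rewrite !mxE.
have [U [phi [u [lp Uu xu]]]] := sphere_chart Sy.
have crit : critical_points m Sph p0 y.
  exists U, phi, u; split => //.
  have -> : differential phi p0 u = differential phi p u.
    apply/rowP => i; rewrite !mxE; apply: partial_eq_on (lp_open lp) Uu _ => v Uv /=.
    by rewrite radial_extension_sphere //; apply: (lp_sub lp); exists v.
  have cp := chart_punctured (@minkowski_enorm R m) (chart_sphere_indicatrix lp).
  by rewrite (differentialE (lp_smooth lp) cp sp Uu) xu Py mul0mx.
have : [set -1; 1] (p0 y) by rewrite -(sf_critical_values fol); exists y.
by rewrite /p -/y => -[] ->; rewrite ltxx ?andbF.
Qed.

Lemma sphere_operators : exists a b : R -> R, forall x, Sph x ->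
  dot (egrad p x) (egrad p x) = a (p x) /\ \tr (hessian p x) = b (p x).
Proof.
have [_ _ _ [a [b ab]]] := sf_isoparametric fol.
exists a, b => x Sx; have [U [phi [u [lp Uu xu]]]] := sphere_chart Sx.
have [ga lb] := ab _ _ lp _ Uu; rewrite xu in ga lb.
have lpi := chart_sphere_indicatrix lp.
have gE y : Sph y -> @flat_metric R n y = hessian_metric (@enorm R m) y.
  by move=> /sphere_punctured y0; rewrite hessian_enorm.
have fE y : Sph y -> p0 y = p y by move=> Sy; rewrite radial_extension_sphere.
rewrite (grad_sqnorm_eq lp Uu gE fE) in ga; rewrite (laplacian_eq lp Uu gE fE) in lb.
rewrite (chart_grad_sqnorm (@minkowski_enorm R m) lpi sp hp Uu) xu in ga.
rewrite (chart_laplacian (@minkowski_enorm R m) lpi sp hp Uu) xu in lb.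
have x0 := sphere_punctured Sx.
rewrite radial_extension_sphere // -ga -lb; split.
  by rewrite /ambient_grad hessian_enorm // invmx1 mulmx1.
rewrite /ambient_laplacian hessian_enorm // invmx1 mul1mx.
rewrite (_ : dirmx _ _ _ = 0) ?scaler0 ?subr0 //.
rewrite (@dirmx_eq_on _ _ _ _ _ _ _ (fun=> 1%:M) _ W0o x0) => [|y y0]; last exact: hessian_enorm.
by rewrite /dirmx big1 // => i _; rewrite /partial derive_cst scaler0.
Qed.

Lemma scale_egrad (l : R) x : 0 < l -> W0 x -> l *: egrad p (l *: x) = egrad p x.
Proof.
move=> l0 x0; apply/rowP => i; rewrite !mxE.
by rewrite (homogeneous_partial i sp hp l0 x0) expr0 mul1r.
Qed.

Lemma scale_hessian (l : R) x : 0 < l -> W0 x -> l ^+ 2 *: hessian p (l *: x) = hessian p x.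
Proof.
move=> l0 x0; apply/matrixP => i j.
have hE y : hessian p y i j = partial i (partial j p) y by rewrite mxE.
rewrite mxE (hE (l *: x)) (hE x).
have H y : y != 0 -> partial j p (l *: y) = l^-1 * partial j p y.
  move=> y0; apply: (mulfI (lt0r_neq0 l0)).
  by rewrite (homogeneous_partial j sp hp l0 y0) expr0 mul1r mulrA mulfV ?gt_eqF // mul1r.
rewrite expr2 -mulrA (partial_scaling i (smooth_on_partial j sp) l0 H x0).
by rewrite mulrA mulfV ?gt_eqF // mul1r.
Qed.

(** Points of equal norm reach the sphere by the same factor, and both quantities are homogeneous of
    degree -2. *)
Lemma operators_same_leaf x y : same_leaf p x y ->
  dot (egrad p x) (egrad p x) = dot (egrad p y) (egrad p y) /\
  \tr (hessian p x) = \tr (hessian p y).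
Proof.
move=> [[x0 _] [y0 _] dxy pxy]; have [a [b ab]] := sphere_operators.
have exy : enorm x = enorm y by rewrite /enorm dxy.
have e0 : 0 < (enorm x)^-1 by rewrite invr_gt0 enorm_gt0.
have [ax bx] := ab _ (sphere_normalize x0).
have [ay by_] := ab _ (sphere_normalize y0).
rewrite -exy in ay by_.
have pE z : W0 z -> p ((enorm x)^-1 *: z) = p z by move=> z0; rewrite (hp e0 z0) expr0 mul1r.
rewrite (pE x x0) in ax bx; rewrite (pE y y0) -pxy in ay by_.
split.
  by rewrite -(scale_egrad e0 x0) -(scale_egrad e0 y0) !dotZl !dotZr ax ay.
apply: etrans (esym (congr1 (@mxtrace R n) (scale_hessian e0 x0))) _.
apply: etrans (congr1 (@mxtrace R n) (scale_hessian e0 y0)).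
apply: etrans (mxtraceZ _ _) _; apply: etrans (esym (mxtraceZ _ _)).
exact: (congr1 (fun z => (enorm x)^-1 ^+ 2 * z) (etrans bx (esym by_))).
Qed.

(* If p were locally constant equal to +-1 then, on each line, the polynomials
   Q^2 and |x|^(2d) would agree, and p would only take the values +-1. *)
Lemma nonconstant_near x (e : R) : W0 x -> `|p x| = 1 -> 0 < e ->
  exists y, [/\ `|y - x| < e, y != 0 & p y != p x].
Proof.
move=> x0 px e0; apply: contrapT => H.
have pcst y : `|y - x| < e -> y != 0 -> p y = p x.
  by move=> ye y0; apply/eqP/negPn/negP => pyx; apply: H; exists y.
have [Q hQ Qp] := sf_polynomial fol.
have QE y : W0 y -> polyfun Q y = enorm y ^+ d * p y.
  move=> y0; rewrite /p Qp; last exact: sphere_normalize.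
  rewrite -/(polyfun Q _) (polyfun_homog _ _ hQ) mulrA -exprMn mulfV ?expr1n ?mul1r //.
  by rewrite gt_eqF ?enorm_gt0.
have d0 : (0 < d)%N by move: (sf_degree fol); rewrite !inE; case: (d).
(* On the line from x to y both sides are polynomials in t that agree near t = 0; evaluate at t =
   1. *)
have Q2 y : polyfun Q y ^+ 2 = dot y y ^+ d.
  have [r rE] := polyfun_line Q x (y - x).
  pose s : {poly R} := \sum_i ((x 0 i)%:P + ((y - x) 0 i)%:P * 'X) ^+ 2.
  have sE t : s.[t] = dot (x + t *: (y - x)) (x + t *: (y - x)).
    rewrite horner_sum dotE; apply: eq_bigr => i _.
    by rewrite horner_exp hornerD hornerM !hornerC hornerX !mxE (mulrC t) expr2.
  have [e1 e10 P1] := open_ball W0o x0.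
  pose e' := Num.min e e1 / (`|y - x| + 1).
  have y1 : 0 < `|y - x| + 1 by rewrite ltr_wpDl.
  have e'0 : 0 < e' by rewrite divr_gt0 // lt_min e0 e10.
  have /(congr1 (horner^~ 1)) : r ^+ 2 - s ^+ d = 0.
    apply: (poly0_near0 e'0) => t te.
    have : `|x + t *: (y - x) - x| < Num.min e e1.
      rewrite addrC addKr normrZ; move: te; rewrite /e' ltr_pdivlMr //.
      by apply: le_lt_trans; rewrite ler_wpM2l // lerDl.
    rewrite lt_min => /andP[te1 te2]; have z0 := P1 _ te2.
    rewrite hornerD hornerN !horner_exp rE sE QE // pcst // exprMn.
    rewrite -[p x ^+ 2]real_normK ?num_real // px expr1n mulr1.
    by rewrite exprAC sqr_enorm subrr.
  have y1E : x + 1 *: (y - x) = y by rewrite scale1r addrC subrK.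
  rewrite hornerD hornerN !horner_exp rE sE y1E horner0 => /eqP.
  by rewrite subr_eq0 => /eqP.
have segE (a b : 'rV[R]_n) t i : (a + t *: (b - a)) 0 i = (1 - t) * a 0 i + t * b 0 i.
  by rewrite !mxE; ring.
(* By [Q2] the polynomial vanishes at 0 only, so a change of sign along a segment forces the segment
   through 0. *)
have segment a b : 0 < polyfun Q a -> polyfun Q b < 0 ->
    exists2 t, 0 <= t <= 1 & a + t *: (b - a) = 0.
  move=> Qa Qb; have [r rE] := polyfun_line Q a (b - a).
  have [t t01 /eqP rt] : exists2 t, 0 <= t <= 1 & root (- r) t.
    apply: poly_ivt; rewrite ?ler01 // !hornerN !rE scale0r addr0 scale1r addrC subrK.
    by rewrite oppr_le0 oppr_ge0 !ltW.
  exists t => //; move: rt; rewrite hornerN rE => /eqP; rewrite oppr_eq0 => /eqP rt.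
  have := Q2 (a + t *: (b - a)); rewrite rt expr0n /= => /esym/eqP.
  rewrite expf_eq0 d0 /=; apply: contraTeq => z0.
  by rewrite gt_eqF // dot_xx_gt0.
have crit c : [set -1; 1] c -> exists2 z, Sph z & polyfun Q z = c.
  rewrite -(sf_critical_values fol) => -[z [U [phi [u [lp Uu xu _]]]] <-].
  have Sz : Sph z by rewrite -xu; apply: (lp_sub lp); exists u.
  by exists z => //; rewrite /polyfun -Qp.
have [a Sa Qa] := crit 1 (or_intror erefl).
have [b Sb Qb] := crit (-1) (or_introl erefl).
have [a0 b0] := (sphere_punctured Sa, sphere_punctured Sb).
have [||t _ ab] := segment a b; rewrite ?Qa ?Qb ?oppr_lt0 //.
have /rV0Pn[i ai] := a0.
have abi : (1 - t) * a 0 i + t * b 0 i = 0.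
  by rewrite -segE ab mxE.
have bi : b 0 i != 0.
  apply/eqP => bi; move: abi; rewrite bi mulr0 addr0 => /eqP.
  rewrite mulf_eq0 (negPf ai) orbF subr_eq0 => /eqP t1.
  by move: ab; rewrite -t1 scale1r addrC subrK => /eqP; apply/negP.
have [j ij] : exists j : 'I_n, j != i.
  have [->|] := eqVneq i 0; first by exists ord_max; rewrite -(inj_eq val_inj) /= -lt0n ltnW.
  by exists 0; rewrite eq_sym.
(* The i-th coordinate vanishes for [w] but not for a and b, so the segments joining [w] to a and to
   b avoid 0; yet Q changes sign along one of them. *)
pose w : 'rV[R]_n := delta_mx 0 j.
have wi : w 0 i = 0 by rewrite mxE eqxx /= eq_sym (negPf ij).
have w0 : w != 0.
  by apply/eqP => /rowP/(_ j); rewrite !mxE !eqxx => /eqP; rewrite oner_eq0.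
have Qw : polyfun Q w != 0.
  by rewrite -sqrf_eq0 Q2 expf_neq0 // gt_eqF // dot_xx_gt0.
have [Qw0|Qw0|Qw0] := ltgtP (polyfun Q w) 0; last by rewrite Qw0 eqxx in Qw.
  have [||s _ aw] := segment a w; rewrite ?Qa //.
  have : (1 - s) * a 0 i = 0.
    by have := segE a w s i; rewrite aw mxE wi mulr0 addr0.
  move/eqP; rewrite mulf_eq0 (negPf ai) orbF subr_eq0 => /eqP s1.
  by move: aw; rewrite -s1 scale1r addrC subrK => /eqP; apply/negP.
have [||s _ wb] := segment w b; rewrite ?Qb ?oppr_lt0 //.
have : s * b 0 i = 0.
  by have := segE w b s i; rewrite wb mxE wi mulr0 add0r.
move/eqP; rewrite mulf_eq0 (negPf bi) orbF => /eqP s1.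
by move: wb; rewrite s1 scale0r addr0 => /eqP; apply/negP.
Qed.

(** * The Minkowski norm: regular leaves, focal leaves and conclusion *)

Section Minkowski.
Variable F : 'rV[R]_n -> R.
Hypotheses (mF : minkowski_norm F) (Find : induced_by d M F).
Local Notation SF := (indicatrix F).
Local Notation h := (hessian_metric F).

Lemma induced_const x y : W0 x -> W0 y -> p x = p y ->
  F ((enorm x)^-1 *: x) = F ((enorm y)^-1 *: y).
Proof.
move=> x0 y0 pxy; have [Sx Sy] := (sphere_normalize x0, sphere_normalize y0).
have : level_sets Sph p0 (level_set Sph p0 (p x)).
  by split; [exists ((enorm x)^-1 *: x)|exists (p x)].
rewrite -(sf_leaves fol) => -[t t01 Mt].
by apply: (Find t01); rewrite Mt.
Qed.

Lemma normalizeK x : W0 x -> enorm x *: ((enorm x)^-1 *: x) = x.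
Proof. by move=> x0; rewrite scalerA mulfV ?scale1r // gt_eqF ?enorm_gt0. Qed.

(** F is determined by |x| and p, so on the indicatrix p alone fixes |x|; equal values of p then
    give [same_leaf]. *)
Lemma enorm_indicatrix x y : SF x -> SF y -> p x = p y -> enorm x = enorm y.
Proof.
move=> Fx Fy pxy; have [x0 y0] := (indicatrix_punctured mF Fx, indicatrix_punctured mF Fy).
have [ex ey] := (enorm_gt0 x0, enorm_gt0 y0).
have := induced_const x0 y0 pxy; rewrite !(mn_homog mF) ?invr_ge0 ?ltW //.
by rewrite Fx Fy !mulr1 => /invr_inj.
Qed.

Lemma invariant_energy : invariant p (energy F).
Proof.
split; first by apply: smooth_on_sub (smooth_energy mF) => x [].
move=> x y [[x0 _] [y0 _] dxy pxy]; rewrite /energy.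
have FE z : W0 z -> F z = enorm z * F ((enorm z)^-1 *: z).
  by move=> z0; rewrite -{1}(normalizeK z0) (mn_homog mF) ?sqrtr_ge0.
by rewrite (FE x) // (FE y) // (induced_const x0 y0 pxy) /enorm dxy.
Qed.

Lemma hessian_energy_unit x : W0 x -> h x \in unitmx.
Proof.
move=> x0; rewrite unitmxE unitfE; apply: posdef_det_neq0.
by have [_] := mn_convex mF x0.
Qed.

Definition ambient_sqnorm (x : 'rV[R]_n) : R := (ambient_grad h p x *m (egrad p x)^T) 0 0.

Lemma operators_regular x y : SF x -> SF y -> p x = p y -> -1 < p x < 1 ->
  ambient_sqnorm x = ambient_sqnorm y /\ ambient_laplacian h p x = ambient_laplacian h p y.
Proof.
move=> Fx Fy pxy px; have [x0 y0] := (indicatrix_punctured mF Fx, indicatrix_punctured mF Fy).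
have leaf : same_leaf p x y.
  by split; [split|split; rewrite -?pxy| rewrite -!sqr_enorm (enorm_indicatrix Fx Fy pxy)|].
exact: (ambient_invariants sp hp (fun x y xy => (operators_same_leaf xy).1)
  (fun x y xy => (operators_same_leaf xy).2) regular_egrad (smooth_energy mF)
  (energy_homog mF) invariant_energy hessian_energy_unit leaf).
Qed.

Lemma smooth_operators : smooth_on W0 ambient_sqnorm /\ smooth_on W0 (ambient_laplacian h p).
Proof.
have sh := smooth_hessian (smooth_energy mF).
have shi : smooth_on W0 (fun x => invmx (h x)).
  apply: (smooth_on_invmx W0o) => // x /hessian_energy_unit.
  by rewrite unitmxE unitfE.
have sP := smooth_egrad sp.
have sX : smooth_on W0 (ambient_grad h p) by exact: smooth_on_mulmx.
split.
  have := smooth_on_mulmx W0o sX (smooth_on_trmx W0o sP).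
  by move/(smooth_on_mxP W0o) => /(_ 0 0).
apply: (smooth_on_tr W0o); apply: (smooth_on_mulmx W0o) => //.
apply/(smooth_on_mxP W0o) => i j; under eq_fun do rewrite !mxE summxE.
apply: (smooth_onB W0o).
  by apply: smooth_on_partial; apply: smooth_on_partial; exact: sp.
apply: (smooth_onM W0o); first exact: smooth_on_cst.
apply: (smooth_on_sum W0o) => k _; under eq_fun do rewrite mxE.
apply: (smooth_onM W0o); first by move/(smooth_on_mxP W0o) : sX.
have := smooth_on_partial k sh.
by move/(smooth_on_mxP W0o) => /(_ i j).
Qed.

(** Intermediate value theorem on the segment from x to a nearby point where p differs. The sign s
    treats the two focal values at once, since s p is at most 1 and equals 1 at x. *)
Lemma value_near (s : R) x e : s ^+ 2 = 1 -> W0 x -> p x = s -> 0 < e ->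
  exists2 c, c < 1 & forall v, c <= v <= 1 -> exists y, [/\ `|y - x| < e, y != 0 & s * p y = v].
Proof.
move=> s2 x0 px e0; have [e1 e10 P1] := open_ball W0o x0.
have n1 : `|p x| = 1.
  by apply/eqP; rewrite px -(@pexpr_eq1 _ _ 2) // real_normK ?num_real // s2.
have me : 0 < Num.min e e1 by rewrite lt_min e0 e10.
have [y [ye y0 pyx]] := nonconstant_near x0 n1 me.
have sle z : W0 z -> s * p z <= 1.
  move=> /radial_extension_range pz; apply: le_trans (ler_norm _) _.
  by rewrite normrM -px n1 mul1r ler_norml.
have ss : s * p x = 1 by rewrite px -expr2.
exists (s * p y).
  rewrite lt_neqAle sle // andbT; apply: contra pyx => /eqP spy.
  apply/eqP; have s0 : s != 0 by rewrite -sqrf_eq0 s2 oner_eq0.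
  by apply: (mulfI s0); rewrite spy ss.
move=> v /andP[v1 v2]; pose g t := s * p (x + t *: (y - x)).
have near t : 0 <= t <= 1 -> `|x + t *: (y - x) - x| < Num.min e e1.
  move=> /andP[t0 t1]; rewrite addrC addKr normrZ ger0_norm //.
  by apply: le_lt_trans ye; rewrite ler_piMl.
have gW t : 0 <= t <= 1 -> W0 (x + t *: (y - x)).
  by move=> /near; rewrite lt_min => /andP[_]; exact: P1.
have [|||t] := @IVT R g 0 1 v.
- exact: ler01.
- apply: derivable_within_continuous => t; rewrite in_itv /= => t01.
  have [dg _] := is_derive_line (smooth_on_diff sp (gW _ t01)).
  exact: derivableM (derivable_cst _ _ _) dg.
- rewrite /g scale0r addr0 scale1r addrC subrK ss.
  by rewrite ge_min v1 orbT le_max v2.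
rewrite in_itv /= => t01 gt; exists (x + t *: (y - x)); split => //; last exact: gW.
by have := near _ t01; rewrite lt_min => /andP[].
Qed.

(** Two focal points with the same value of p are approached by points x' and y' that share one
    regular value of p, where the hypothesis applies. *)
Lemma focal_constant (G : 'rV[R]_n -> R) : smooth_on W0 G ->
  (forall x y, SF x -> SF y -> p x = p y -> -1 < p x < 1 -> G x = G y) ->
  forall x y, SF x -> SF y -> p x = p y -> G x = G y.
Proof.
move=> sG Greg x y Fx Fy pxy.
have [x0 y0] := (indicatrix_punctured mF Fx, indicatrix_punctured mF Fy).
have [px|px] := boolP (-1 < p x < 1); first exact: Greg.
pose s := p x.
have s2 : s ^+ 2 = 1.
  move: px (radial_extension_range x0); rewrite negb_and -!leNgt -/s => /orP[] h1 /andP[h2 h3].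
    have -> : s = -1 by lra.
    by rewrite sqrrN expr1n.
  have -> : s = 1 by lra.
  by rewrite expr1n.
have sn : s != 0 by rewrite -sqrf_eq0 s2 oner_eq0.
(* The approximating points need not lie on the indicatrix, so G is first precomposed with the
   radial projection. *)
pose H z := G ((F z)^-1 *: z).
have sH : smooth_on W0 H.
  apply: (@smooth_on_comp _ _ _ W0o _ W0) => //.
    by move=> z z0; apply: punctured_scale => //; rewrite invr_gt0 (mn_gt0 mF).
  by have := smooth_radial mF; move/(smooth_on_mxP W0o) => /(_ 0).
have HE z : SF z -> H z = G z by rewrite /H => ->; rewrite invr1 scale1r.
rewrite -HE // -(HE y) //; apply/eqP; rewrite -subr_eq0 -normr_le0; apply/ler_addgt0Pl => e e0.
have e2 : 0 < e / 2 by rewrite divr_gt0.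
have cH z : W0 z -> exists2 r : R, 0 < r & forall z', `|z' - z| < r -> `|H z - H z'| < e / 2.
  move=> z0; have /cvgrPdist_lt/(_ _ e2) : {for z, continuous H}.
    by apply: differentiable_continuous; exact: smooth_on_diff sH z0.
  move=> /nbhs_normP[r /= r_gt0 rP]; exists r => // z' z'r.
  by apply: rP; rewrite /= distrC.
have [rx rx0 Hx] := cH _ x0; have [ry ry0 Hy] := cH _ y0.
have [cx cx1 Vx] := value_near s2 x0 erefl rx0.
have [cy cy1 Vy] := value_near s2 y0 (esym pxy) ry0.
(* The value (c + 1) / 2 is then reached near both points and lies strictly between 0 and 1, hence
   is regular. *)
pose c := Num.max (Num.max cx cy) 0.
have c1 : c < 1 by rewrite !gt_max cx1 cy1 ltr01.
have c0 : 0 <= c by rewrite le_max lexx orbT.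
have cxc : cx <= c by rewrite !le_max lexx.
have cyc : cy <= c by rewrite !le_max lexx orbT.
have [|x' [x'r x'0 px']] := Vx ((c + 1) / 2); first by apply/andP; split; lra.
have [|y' [y'r y'0 py']] := Vy ((c + 1) / 2); first by apply/andP; split; lra.
have pxy' : p x' = p y' by apply: (mulfI sn); rewrite px' py'.
have Hxy : H x' = H y'.
  have Fx' := mn_gt0 mF x'0; have Fy' := mn_gt0 mF y'0.
  apply: Greg; try exact: indicatrix_scale; rewrite !hp ?invr_gt0 // !expr0 !mul1r //.
  have v2 : p x' ^+ 2 < 1.
    have : (s * p x') ^+ 2 < 1 by rewrite px' expr_lt1 //; lra.
    by rewrite exprMn s2 mul1r.
  by rewrite -ltr_norml -(@expr_lt1 _ 2) // real_normK ?num_real.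
rewrite addr0 (splitr e) -(subrKA (H x')) {2}Hxy.
apply: le_trans (ler_normD _ _) _; apply: lerD; first exact/ltW/Hx.
by rewrite distrC; exact/ltW/Hy.
Qed.

Lemma indicatrix_submanifold : submanifold m SF.
Proof.
move=> x Fx; have x0 := indicatrix_punctured mF Fx.
have [U [phi [u [lp Uu xu]]]] := sphere_chart (sphere_normalize x0).
have lp' := local_param_radial (@minkowski_enorm R m) mF (chart_sphere_indicatrix lp).
exists U, (fun u => (F (phi u))^-1 *: phi u); split => //.
exists u => //; rewrite xu (mn_homog mF) ?invr_ge0 ?sqrtr_ge0 //.
by rewrite Fx mulr1 invrK normalizeK.
Qed.

Lemma chart_to_sphere (U : set 'rV[R]_m) phi : local_param SF U phi ->
  local_param Sph U (fun u => (enorm (phi u))^-1 *: phi u).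
Proof.
move=> lp; rewrite sphere_indicatrix.
exact: (local_param_radial mF (@minkowski_enorm R m) lp).
Qed.

(** In the projected chart the function on the sphere reads as p composed with phi, so the condition
    on the differential carries over unchanged. *)
Lemma critical_to_sphere x : critical_points m SF p x ->
  critical_points m Sph p0 ((enorm x)^-1 *: x).
Proof.
move=> [U [phi [u [lp Uu <- du]]]].
by exists U, (fun u => (enorm (phi u))^-1 *: phi u), u; split => //; exact: chart_to_sphere.
Qed.

(** The value at c is read off at a point picked by [get] in the level c; the default of [get] is
    never met, since x itself lies in its level. *)
Lemma choose_function (A : set 'rV[R]_n) (G : 'rV[R]_n -> R) :
  (forall x y, A x -> A y -> p x = p y -> G x = G y) ->
  exists a : R -> R, forall x, A x -> G x = a (p x).
Proof.
move=> AG; exists (fun c => G (get [set x | A x /\ p x = c])) => x Ax.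
have [Ay pxy] : [set y | A y /\ p y = p x] (get [set y | A y /\ p y = p x]).
  by apply: (getI (x := x)).
by apply: AG.
Qed.

Lemma isoparametric_radial_extension : isoparametric_function m SF h p.
Proof.
split.
- split; first exact: indicatrix_submanifold.
  by move=> U phi lp; exact: chart_gram mF lp.
- move=> U phi lp; have Uo := lp_open lp.
  apply: (smooth_on_comp Uo sp (chart_punctured mF lp)).
  by have := lp_smooth lp; move/(smooth_on_mxP Uo) => /(_ 0).
(* Projecting the chart to the sphere keeps its domain, so the same boxes cover the critical
   parameters. *)
- move=> U phi lp e e0; have [_ _ reg _] := sf_isoparametric fol.
  have [l [r [lr cov sum]]] := reg _ _ (chart_to_sphere lp) e e0.
  exists l, r; split => // u [Uu cu]; apply: cov; split => //.
  exact: critical_to_sphere.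
have [s1 s2] := smooth_operators.
have [a aE] := choose_function (focal_constant s1
  (fun x y Fx Fy pxy px => (operators_regular Fx Fy pxy px).1)).
have [b bE] := choose_function (focal_constant s2
  (fun x y Fx Fy pxy px => (operators_regular Fx Fy pxy px).2)).
exists a, b => U phi lp u Uu; have Fu := chart_indicatrix lp Uu.
rewrite -aE // -bE //; split.
  exact: (chart_grad_sqnorm mF lp sp hp Uu).
exact: (chart_laplacian mF lp sp hp Uu).
Qed.

Lemma cone_level_set c :
  SF `&` positive_cone (level_set Sph p0 c) = level_set SF p c.
Proof.
rewrite eqEsubset; split=> x.
  move=> [Fx [l [l0 [y [Sy py] xy]]]]; split => //.
  by rewrite xy hp ?expr0 ?mul1r ?radial_extension_sphere //; exact: sphere_punctured.
move=> [Fx px]; have x0 := indicatrix_punctured mF Fx; split => //.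
exists (enorm x); split; first exact: enorm_gt0.
exists ((enorm x)^-1 *: x); last by rewrite normalizeK.
by split => //; exact: sphere_normalize.
Qed.

Lemma cone_leaves :
  [set SF `&` positive_cone (M t) | t in [set t | 0 <= t <= pi / d%:R]] = level_sets SF p.
Proof.
have leaves := sf_leaves fol; rewrite eqEsubset; split=> L.
  move=> [t t01 <-]; have : level_sets Sph p0 (M t) by rewrite -leaves; exists t.
  move=> [[y My] [c Mc]]; rewrite Mc cone_level_set; split; last by exists c.
  move: My; rewrite Mc => -[Sy py]; have y0 := sphere_punctured Sy.
  exists ((F y)^-1 *: y); split; first exact: indicatrix_scale.
  by rewrite hp ?invr_gt0 ?(mn_gt0 mF) // expr0 mul1r radial_extension_sphere.
move=> [[x Lx] [c Lc]]; move: Lx; rewrite Lc => -[Fx px].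
have x0 := indicatrix_punctured mF Fx.
have : level_sets Sph p0 (level_set Sph p0 c).
  by split; [exists ((enorm x)^-1 *: x); split => //; exact: sphere_normalize|exists c].
rewrite -leaves => -[t t01 Mt]; exists t => //.
by rewrite Mt cone_level_set.
Qed.

End Minkowski.

End Foliation.

Theorem theoremB (R : realType) (n d : nat) (M : R -> set 'rV[R]_n)
    (F : 'rV[R]_n -> R) :
  (2 < n)%N ->
  sphere_isoparametric_foliation d M ->
  minkowski_norm F ->
  induced_by d M F ->
  isoparametric_foliation n.-1 (indicatrix F) (hessian_metric F)
    [set indicatrix F `&` positive_cone (M t) | t in [set t | 0 <= t <= pi / d%:R]].
Proof.
case: n M F => // m M F m2 [p0 fol] mF Find.
exists (radial_extension p0); first exact: (isoparametric_radial_extension m2 fol mF Find).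
exact: (cone_leaves fol mF).
Qed.
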